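(* Let $G$ be a reductive complex Lie group with Lie algebra $\mathfrak g$ equipped with a nondegenerate invariant quadratic form, let $\{e_i\}$ be an orthonormal basis of $\mathfrak g$ and $t=\sum_i e_i\otimes e_i$. Let $l$ be a ciliated fat graph, and for each vertex $n\in N(l)$ let $r(n)=\sum_{i,j} r^{ij}(n)\,e_i\otimes e_j\in\mathfrak g\otimes\mathfrak g$ be a solution of the classical Yang–Baxter equation $$[r_{12}(n),r_{13}(n)]+[r_{12}(n),r_{23}(n)]+[r_{13}(n),r_{23}(n)]=0$$ with $\tfrac12(r_{12}(n)+r_{21}(n))=t$. On the space $\mathcal A^l$ of graph connections define the bivector field (summation over repeated $i,j$) $$B=\sum_{n\in N(l)}\left(\sum_{\alpha,\beta\in n;\ \alpha<\beta} r^{ij}(n)\,X_i^\alpha\wedge X_j^\beta+\frac12\sum_{\alpha\in n} r^{ij}(n)\,X_i^\alpha\wedge X_j^\alpha\right).$$ Then: a) The bivector $B$ defines a Poisson structure on $\mathcal A^l$. b) The group $\mathcal G^l$ of graph gauge transformations, endowed with the direct product Poisson–Lie structure, acts on $\mathcal A^l$ in a Poisson way, i.e. the action map $\mathcal A^l\times\mathcal G^l\to\mathcal A^l$ is a Poisson map, where the source carries the product Poisson structure.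
   Context: A ciliated fat graph $l$ is given by a finite set $E(l)$ (the ends of edges), a partition $N(l)$ of $E(l)$ into subsets (the vertices), each equipped with a linear order, and an involution $\alpha\mapsto\alpha^\vee$ of $E(l)$ without fixed points (sending an end of an edge to the opposite end of the same edge). The vertex containing $\alpha$ is denoted $[\alpha]$. A graph connection is an assignment of an element $\mathbf A_\alpha\in G$ to each $\alpha\in E(l)$ such that $\mathbf A_{\alpha^\vee}=\mathbf A_\alpha^{-1}$. The space $\mathcal A^l$ of graph connections is thus a product of copies of $G$, one for each edge. The graph gauge group $\mathcal G^l=\prod_{n\in N(l)}G$ acts on $\mathcal A^l$ (from the right) by $\mathbf A_\alpha\mapsto\mathbf g_{[\alpha^\vee]}^{-1}\,\mathbf A_\alpha\,\mathbf g_{[\alpha]}$. Vector fields: $X_i^\alpha=L_i^\alpha-R_i^{\alpha^\vee}$, where $L_i^\alpha$ and $R_i^\alpha$ are the left- and right-invariant vector fields corresponding to $e_i$ on the copy of $G$ assigned to $\alpha$. That is, $X_i^\alpha$ is the derivative at $s=0$ of the flow $\mathbf A_\alpha\mapsto\mathbf A_\alpha e^{s e_i}$, $\mathbf A_{\alpha^\vee}\mapsto e^{-s e_i}\mathbf A_{\alpha^\vee}$, all other group elements being fixed. Poisson–Lie structure on $\mathcal G^l$: the direct product of the Poisson structures on the copies of $G$, the copy at the vertex $n$ carrying the Poisson bivector $\pi_n=\frac12 r^{ij}(n)\,(L_i\wedge L_j-R_i\wedge R_j)$, where $L_i,R_i$ are the left- and right-invariant vector fields on $G$ equal to $e_i$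 at the identity. The same normalization of $\wedge$ on vector fields is used in $B$ and in $\pi_n$. *)

(* Defs.v *)
(* Manifolds are modelled on normed spaces over a [numFieldType] K; the case of
   interest is K = R[i], where "smooth" means holomorphic. *)
From HB Require Import structures.
From mathcomp Require Import all_boot all_order all_algebra.
From mathcomp Require Import all_classical all_reals all_analysis.
From mathcomp Require Import complex.

Set Implicit Arguments.
Unset Strict Implicit.
Unset Printing Implicit Defensive.

Import Order.TTheory GRing.Theory Num.Theory.
Import numFieldNormedType.Exports.

Local Open Scope classical_set_scope.
Local Open Scope ring_scope.

(* ** Smooth maps and manifolds *)

(* Only meaningful for U open: differentiability at a point of U is
   differentiability in the ambient normed space. *)
Fixpoint Cn_on (K : numFieldType) (V W : normedModType K) (n : nat)
    (U : set V) (f : V -> W) : Prop :=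
  match n with
  | 0 => forall x, U x -> {for x, continuous f}
  | n'.+1 => (forall x, U x -> differentiable f x) /\
             (forall v, Cn_on n' U ('D_v f))
  end.

(* Over K = R[i] (and finite-dimensional V) the derivatives are complex
   derivatives, so this is holomorphy: by the Cauchy formula one complex
   derivative on an open set already yields all the others. *)
Definition smooth_on (K : numFieldType) (V W : normedModType K)
    (U : set V) (f : V -> W) : Prop :=
  forall n, Cn_on n U f.

(* The values of [cmap] outside [cdom], and of [cinv] outside the image of
   [cdom], are irrelevant. *)
Record chart (T V : Type) := Chart {
  cdom : set T;
  cmap : T -> V;
  cinv : V -> T
}.

Section Manifolds.
Context {K : numFieldType}.

Definition is_chart (T : topologicalType) (V : normedModType K)
    (c : chart T V) : Prop :=
  [/\ open (cdom c),
      open (cmap c @` cdom c),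
      forall x, cdom c x -> cinv c (cmap c x) = x,
      forall x, cdom c x -> {for x, continuous (cmap c)} &
      forall y, (cmap c @` cdom c) y -> {for y, continuous (cinv c)}].

Definition is_atlas (T : topologicalType) (V : normedModType K)
    (A : set (chart T V)) : Prop :=
  [/\ forall c, A c -> is_chart c,
      forall x, exists2 c, A c & cdom c x &
      forall c c', A c -> A c' ->
        smooth_on (cmap c @` (cdom c `&` cdom c')) (cmap c' \o cinv c)].

Definition smooth_map (T T' : topologicalType) (V V' : normedModType K)
    (A : set (chart T V)) (A' : set (chart T' V')) (h : T -> T') : Prop :=
  continuous h /\
  forall c c', A c -> A' c' ->
    smooth_on (cmap c @` (cdom c `&` h @^-1` cdom c')) (cmap c' \o h \o cinv c).

Definition smooth_fun (T : topologicalType) (V : normedModType K)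
    (A : set (chart T V)) (U : set T) (f : T -> K) : Prop :=
  forall c, A c -> smooth_on (cmap c @` (U `&` cdom c)) (f \o cinv c).

Definition prod_atlas (T T' : topologicalType) (V V' : normedModType K)
    (A : set (chart T V)) (A' : set (chart T' V')) :
    set (chart (T * T')%type (V * V')%type) :=
  [set c | exists c1 c2, [/\ A c1, A' c2 &
    c = Chart (cdom c1 `*` cdom c2)
              (fun p => (cmap c1 p.1, cmap c2 p.2))
              (fun q => (cinv c1 q.1, cinv c2 q.2))]].

Definition pow_chart (I : finType) (T : topologicalType) (d : nat)
    (k : I -> chart T 'rV[K]_d) : chart {ptws I -> T} 'M[K]_(#|I|, d) :=
  Chart (fun x : {ptws I -> T} => forall i, cdom (k i) (x i))
        (fun x : {ptws I -> T} =>
           \matrix_(i, j) cmap (k (enum_val i)) (x (enum_val i)) 0 j)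
        (fun M i => cinv (k i) (row (enum_rank i) M)).

Definition pow_atlas (I : finType) (T : topologicalType) (d : nat)
    (A : set (chart T 'rV[K]_d)) : set (chart {ptws I -> T} 'M[K]_(#|I|, d)) :=
  [set c | exists2 k, forall i, A (k i) & c = pow_chart k].

(* The sheaf of functions of a submanifold S: a function on the relatively
   open set [S `&` U] is represented by a total function (of which only the
   values on [S `&` U] matter), and it is smooth when it is locally the
   restriction of a smooth function of the ambient manifold. *)
Definition sheaf (T : Type) := set T -> set (T -> K).

Definition sub_sheaf (T : topologicalType) (V : normedModType K)
    (A : set (chart T V)) (S : set T) : sheaf T :=
  fun U f => forall x, S x -> U x ->
    exists W F, [/\ open W, W x, W `&` S `<=` U, smooth_fun A W F &
                    forall y, W y -> S y -> f y = F y].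

(* ** Vector fields, bivector fields, Poisson structures *)

(* Vector fields and bivector fields are given by their action on functions:
   the bivector [wedge X Y] is X (x) Y - Y (x) X. *)

Definition vfield (T : Type) := (T -> K) -> T -> K.
Definition bivector (T : Type) := (T -> K) -> (T -> K) -> T -> K.

Definition wedge (T : Type) (X Y : vfield T) : bivector T :=
  fun f g x => X f x * Y g x - Y f x * X g x.

Definition prod_bivector (T T' : Type) (p : bivector T) (p' : bivector T') :
    bivector (T * T') :=
  fun f g z => p (fun x => f (x, z.2)) (fun x => g (x, z.2)) z.1 +
               p' (fun y => f (z.1, y)) (fun y => g (z.1, y)) z.2.

(* Closure of local smooth functions under the bracket, bilinearity (the second
   argument by antisymmetry), antisymmetry, Leibniz rule, Jacobi identity. *)
Definition is_poisson (T : Type) (S : set T) (O : sheaf T) (p : bivector T) :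
    Prop :=
  forall (U : set T) (f g h : T -> K), O U f -> O U g -> O U h ->
  [/\ O U (p f g),
      forall (a : K) x, S x -> U x ->
        p (fun y => a * f y + g y) h x = a * p f h x + p g h x,
      forall x, S x -> U x -> p f g x = - p g f x,
      forall x, S x -> U x ->
        p f (fun y => g y * h y) x = p f g x * h x + g x * p f h x &
      forall x, S x -> U x ->
        p f (p g h) x + p g (p h f) x + p h (p f g) x = 0].

(* A morphism of Poisson manifolds; smoothness is expressed by pullback of
   local smooth functions. *)
Record is_poisson_map (T T' : Type)
    (S : set T) (O : sheaf T) (p : bivector T)
    (S' : set T') (O' : sheaf T') (p' : bivector T') (phi : T -> T') : Prop :=
  IsPoissonMap {
    source_poisson : is_poisson S O p;
    target_poisson : is_poisson S' O' p';
    maps_to : forall x, S x -> S' (phi x);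
    pullback_smooth : forall U' f, O' U' f -> O (phi @^-1` U') (f \o phi);
    pullback_bracket : forall U' f g, O' U' f -> O' U' g ->
      forall x, S x -> U' (phi x) -> p (f \o phi) (g \o phi) x = p' f g (phi x)
  }.

End Manifolds.

(* ** Lie groups *)

HB.mixin Record isLieGroup (K : numFieldType) (d : nat) (G : Type)
    of Group G & Topological G := {
  lie_hausdorff : hausdorff_space G;
  lie_second_countable : @second_countable G;
  lie_atlas : set (chart G 'rV[K]_d);
  lie_atlasP : is_atlas lie_atlas;
  lie_mulP : smooth_map (prod_atlas lie_atlas lie_atlas) lie_atlas
               (fun p : G * G => (p.1 * p.2)%g);
  lie_invP : smooth_map lie_atlas lie_atlas (fun x : G => x^-1%g);
  (* a chosen chart at 1; it identifies the tangent space at 1 with K^d *)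
  chart1 : chart G 'rV[K]_d;
  chart1_atlas : lie_atlas chart1;
  chart1_dom : cdom chart1 1%g
}.

#[short(type="lieGroupType")]
HB.structure Definition LieGroup (K : numFieldType) (d : nat) :=
  {G of isLieGroup K d G & Group G & Topological G}.

Definition complexLieGroup (R : realType) (d : nat) := lieGroupType R[i] d.

Section LieAlgebra.
Context {K : numFieldType} {d : nat} (G : lieGroupType K d).

(* The Lie algebra: the tangent space at 1, read in [chart1]. *)
Definition lie_alg := 'rV[K]_d.
Implicit Types u v w : 'rV[K]_d.

(* The differential at 1 of f, applied to the tangent vector v; equally, the
   derivative at s = 0 of f along any curve through 1 with velocity v, such as
   exp(s v). *)
Definition tderive (W : normedModType K) v (f : G -> W) : W :=
  'D_v (f \o cinv (chart1 : chart G _)) (cmap (chart1 : chart G _) 1%g).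

Definition left_inv (W : normedModType K) v (f : G -> W) : G -> W :=
  fun g => tderive v (fun h => f (g * h)%g).

(* The value at 1 of the commutator of left-invariant vector fields: its
   components are obtained by letting it act on the coordinates. *)
Definition lie_bracket v w : 'rV[K]_d :=
  left_inv v (left_inv w (cmap chart1)) 1%g -
  left_inv w (left_inv v (cmap chart1)) 1%g.

Definition Ad (g : G) v : 'rV[K]_d :=
  tderive v (fun h => cmap chart1 (g * h * g^-1)%g).

Definition is_ideal (I : {vspace 'rV[K]_d}) : Prop :=
  forall v w, w \in I -> lie_bracket v w \in I.

(* G is called reductive when its Lie algebra is: the adjoint representation is
   completely reducible. *)
Definition reductive : Prop :=
  forall I : {vspace 'rV[K]_d}, is_ideal I ->
    exists J : {vspace 'rV[K]_d},
      [/\ is_ideal J, (I + J = fullv)%VS & (I :&: J = 0)%VS].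

(* The symmetric bilinear form with Gram matrix Q; v |-> bform Q v v is the
   associated quadratic form. *)
Definition bform (Q : 'M[K]_d) v w : K := (v *m Q *m w^T) 0 0.

Definition nondegenerate_invariant (Q : 'M[K]_d) : Prop :=
  [/\ Q^T = Q, Q \in unitmx &
      forall (g : G) v, bform Q (Ad g v) (Ad g v) = bform Q v v].

Definition orthonormal_basis (Q : 'M[K]_d) (e : 'I_d -> 'rV[K]_d) : Prop :=
  (\matrix_i e i) \in unitmx /\
  forall i j, bform Q (e i) (e j) = (i == j)%:R.

(* Tensors are arrays of coordinates in K^d; transposition of [tens2 v w]
   exchanges the two factors. *)
Definition tens2 v w : 'M[K]_d := v^T *m w.
Definition tens3 u v w : {ffun 'I_d * 'I_d * 'I_d -> K} :=
  [ffun p => u 0 p.1.1 * v 0 p.1.2 * w 0 p.2].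

Definition tensor_of (e : 'I_d -> 'rV[K]_d) (r : 'M[K]_d) : 'M[K]_d :=
  \sum_i \sum_j r i j *: tens2 (e i) (e j).

Definition CYBE (e : 'I_d -> 'rV[K]_d) (r : 'M[K]_d) : Prop :=
  \sum_i \sum_j \sum_k \sum_m (r i j * r k m) *:
    (tens3 (lie_bracket (e i) (e k)) (e j) (e m)        (* [r12, r13] *)
     + tens3 (e i) (lie_bracket (e j) (e k)) (e m)      (* [r12, r23] *)
     + tens3 (e i) (e k) (lie_bracket (e j) (e m)))     (* [r13, r23] *)
  = 0.

Definition symmetric_part_is_casimir (e : 'I_d -> 'rV[K]_d) (r : 'M[K]_d) :
    Prop :=
  2^-1 *: (tensor_of e r + (tensor_of e r)^T) = \sum_i tens2 (e i) (e i).

End LieAlgebra.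

(* ** Graph connections and gauge transformations *)

(* The linear orders of the vertices are given by one relation on the ends;
   it is only used between ends of the same vertex. *)
Record ciliated_fat_graph := CiliatedFatGraph {
  ends : finType;
  vertices : {set {set ends}};
  opp : ends -> ends;
  cilia_lt : rel ends;
  verticesP : finset.partition vertices [set: ends]%SET;
  oppK : involutive opp;
  opp_neq : forall a, opp a != a;
  cilia_irr : forall n, n \in vertices -> {in n, irreflexive cilia_lt};
  cilia_trans : forall n, n \in vertices -> {in n & &, transitive cilia_lt};
  cilia_total : forall n, n \in vertices ->
    {in n &, forall a b, a != b -> cilia_lt a b || cilia_lt b a}
}.

Definition vertex (l : ciliated_fat_graph) :=
  {n : {set ends l} | n \in vertices l}.

Lemma vertex_of_subproof (l : ciliated_fat_graph) (a : ends l) :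
  finset.pblock (vertices l) a \in vertices l.
Proof.
by rewrite finset.pblock_mem // (finset.cover_partition (verticesP l)) inE.
Qed.

Definition vertex_of (l : ciliated_fat_graph) (a : ends l) : vertex l :=
  Sub (finset.pblock (vertices l) a) (vertex_of_subproof a).

(* In this section e is an orthonormal basis of the Lie algebra and r n is the
   matrix of coefficients of the r-matrix of the vertex n in the basis e. *)
Section FockRosly.
Context {K : numFieldType} {d : nat} (G : lieGroupType K d).
Variable l : ciliated_fat_graph.

(* [connections] below is the space of graph connections, a submanifold of
   the manifold of all assignments of group elements to ends. *)
Definition assignments := {ptws ends l -> G}.
Definition gauge_group := {ptws vertex l -> G}.

Definition connections : set assignments :=
  [set A : assignments | forall a, A (opp a) = (A a)^-1%g].

Definition assignments_atlas : set (chart assignments _) :=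
  pow_atlas (lie_atlas : set (chart G _)).
Definition gauge_atlas : set (chart gauge_group _) :=
  pow_atlas (lie_atlas : set (chart G _)).

Definition connections_sheaf : sheaf assignments :=
  sub_sheaf assignments_atlas connections.

Definition source_sheaf : sheaf (assignments * gauge_group)%type :=
  sub_sheaf (prod_atlas assignments_atlas gauge_atlas) (connections `*` setT).

Definition end_flow (a : ends l) (h : G) (A : assignments) : assignments :=
  fun b => if b == a then (A b * h)%g
           else if b == opp a then (h^-1 * A b)%g else A b.

(* X_a = L_a - R_(opp a), as the derivative of [end_flow] along a curve of
   velocity v.  Separately, L_a and R_(opp a) are not tangent to
   [connections]; their difference is, since the flow preserves it. *)
Definition Xfield (a : ends l) (v : 'rV[K]_d) : vfield assignments :=
  fun f A => tderive v (fun h : G => f (end_flow a h A)).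

Definition Lfield (n : vertex l) (v : 'rV[K]_d) : vfield gauge_group :=
  fun f x => tderive v
    (fun h : G => f (fun m => if m == n then (x m * h)%g else x m)).

Definition Rfield (n : vertex l) (v : 'rV[K]_d) : vfield gauge_group :=
  fun f x => tderive v
    (fun h : G => f (fun m => if m == n then (h * x m)%g else x m)).

Variables (e : 'I_d -> 'rV[K]_d) (r : vertex l -> 'M[K]_d).

Definition fock_rosly : bivector assignments := fun f g A =>
  \sum_(n : vertex l)
    (\sum_(a in val n) \sum_(b in val n | cilia_lt a b) \sum_i \sum_j
        r n i j * wedge (Xfield a (e i)) (Xfield b (e j)) f g A
     + 2^-1 * \sum_(a in val n) \sum_i \sum_j
        r n i j * wedge (Xfield a (e i)) (Xfield a (e j)) f g A).

Definition gauge_bivector : bivector gauge_group := fun f g x =>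
  \sum_(n : vertex l) 2^-1 * \sum_i \sum_j
    r n i j * (wedge (Lfield n (e i)) (Lfield n (e j)) f g x
               - wedge (Rfield n (e i)) (Rfield n (e j)) f g x).

Definition gauge_action (p : assignments * gauge_group) : assignments :=
  fun a => ((p.2 (vertex_of (opp a)))^-1 * p.1 a * p.2 (vertex_of a))%g.

End FockRosly.

Arguments connections {K d} G l.
Arguments connections_sheaf {K d} G l.
Arguments source_sheaf {K d} G l.
Arguments fock_rosly {K d} G {l} e r.
Arguments gauge_bivector {K d} G {l} e r.
Arguments gauge_action {K d} G l.

(* Main.v *)
(* Every field that occurs in the bivectors (X_a on connections; L_n and -R_n on
   the gauge group) generates a right action of G on an ambient manifold, and the
   actions of different indices commute.  Write r = 1 + rho in an orthonormal
   basis, with rho antisymmetric.  For the gradients F_a, H_a, M_a of three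
   functions along these actions the bracket becomes a sum over the vertices of
   <rho sum F_a, sum H_b> + sum eps_ab <F_a, H_b>, where eps is the sign of the
   linear order, and the second derivatives in the Jacobi sum only enter through
   commutators.  The classical Yang-Baxter equation says
   <[u, rho v], rho w> + cyclic terms = - <[u, v], w>; together with a quadratic
   identity for the signs it reduces the Jacobi sum to - sum_a <[F_a, H_a], M_a>.
   This vanishes on connections: the action of the opposite end (or -R_n, seen
   from L_n) is the inverse action conjugated by a group element m, hence its
   gradients are - Ad m^-1 of the original ones and the terms cancel in pairs.
   The gauge action turns the gradient of F at an end a into Ad g_[a] F_a, at L_n
   into sum_(a in n) F_a and at -R_n into - Ad g_n of the latter; since Ad is
   orthogonal, the rho-terms of the ends and of -R_n cancel and those of L_n
   remain. *)
Require Import Defs.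
From HB Require Import structures.
From mathcomp Require Import all_boot all_order all_algebra.
From mathcomp Require Import all_classical all_reals all_analysis.
From mathcomp Require Import complex ring lra.

Set Implicit Arguments.
Unset Strict Implicit.
Unset Printing Implicit Defensive.

Import Order.TTheory GRing.Theory Num.Theory.
Import numFieldNormedType.Exports.

Local Open Scope classical_set_scope.
Local Open Scope ring_scope.

(** * Smooth maps between normed spaces *)

(** The wedge in the half-sum over equal ends removes the symmetric part 1 of r, while for a < b it
    survives with the sign of the order: this is the origin of eps. At one vertex, with S the sum of
    the gradients, the Yang-Baxter equation contributes - <[SF, SH], SM> and the sign identity
    contributes the same term with the opposite sign, up to its diagonal, so that only the diagonal
    is left. It is shown to vanish on connections only; therefore functions on connections are
    replaced by local ambient representatives, and the result is independent of them because the
    flows preserve connections. The product with the gauge group is a second instance of the same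
    statement: L_n and -R_n each sit alone at an additional vertex, with rho and -rho. The analytic
    core is the symmetry of second derivatives. The mean value theorem is real, so the symmetry is
    first proved for real parts over R[i]; multiplication by i recovers the rest. Product charts
    take values in pairs and matrices; charts are handled through finitely many scalar functions, so
    that one chain rule serves all models. *)

Section SmoothCalculus.
Context {K : numFieldType}.
Implicit Types V W : normedModType K.

Lemma near0_differentiable V W (f : V -> W) x :
  (\near x, f x = 0) -> differentiable f x.
Proof.
move=> f0; have c0 : continuous (\0 : V -> W) by move=> ?; exact: cvg_cst.
have df : f \o shift x = cst (f x) + (\0 : V -> W) +o_ 0 id.
  apply/eqaddoP => _/posnumP[eps].
  have fx0 := nbhs_singleton f0.
  rewrite !fctE/= in fx0 *.
  have : \forall y \near 0, f (y + x) = 0.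
    by move: f0; rewrite (near_shift 0 x) subr0.
  apply: filterS => y /= fy.
  by rewrite fx0 fy addr0 subrr normr0 mulr_ge0.
have E := diff_unique c0 df.
by apply/diff_locallyP; rewrite E; split.
Qed.

Lemma near_differentiable V W (f g : V -> W) x :
  (\near x, f x = g x) -> differentiable f x -> differentiable g x.
Proof.
move=> fg df; have -> : g = f + (g - f).
  by apply/funext => y; rewrite !fctE addrC subrK.
apply: differentiableD => //; apply: near0_differentiable.
by apply: filterS fg => y fgy; rewrite !fctE fgy subrr.
Qed.

(** Openness of U matters: a derivative at a point of U sees the function on a whole neighbourhood
    of that point. *)
Lemma Cn_on_congr V W n (U : set V) (f g : V -> W) :
  open U -> (forall x, U x -> f x = g x) -> Cn_on n U f -> Cn_on n U g.
Proof.
elim: n f g => [|n IH] f g oU fg /=.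
  move=> cf x Ux; rewrite /prop_for /continuous_at -(fg x Ux).
  apply: cvg_trans (cf x Ux); apply: near_eq_cvg.
  by near=> y; apply/fg; near: y; exact: open_nbhs_nbhs.
have nfg x : U x -> \near x, f x = g x.
  by move=> Ux; near=> y; apply: fg; near: y; exact: open_nbhs_nbhs.
move=> [df Df]; split=> [x Ux|v].
  exact: near_differentiable (nfg x Ux) (df x Ux).
apply: IH (Df v) => // x Ux; apply: near_eq_derive; exact: nfg.
Unshelve. all: by end_near. Qed.

Lemma Cn_on_sub V W n (U U' : set V) (f : V -> W) :
  U' `<=` U -> Cn_on n U f -> Cn_on n U' f.
Proof.
move=> UU'; elim: n f => [|n IH] f /= => [cf x /UU' /cf //|[df Df]].
by split=> [x /UU' /df //|v]; apply: IH.
Qed.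

Lemma Cn_onS V W n (U : set V) (f : V -> W) : Cn_on n.+1 U f -> Cn_on n U f.
Proof.
elim: n f => [|n IH] f /= [df Df].
  by move=> x Ux; apply: differentiable_continuous; exact: df.
by split=> // v; apply: IH; exact: Df.
Qed.

Lemma Cn_on_cst V W n (U : set V) (c : W) : Cn_on n U (fun _ : V => c).
Proof.
elim: n c => [|n IH] c /=; first by move=> x _; exact: cvg_cst.
split=> [x _|v]; first exact: differentiable_cst.
have -> : 'D_v (fun _ : V => c) = fun _ => 0.
  by apply/funext => x; exact: derive_cst.
exact: IH.
Qed.

Lemma Cn_onD V W n (U : set V) (f g : V -> W) : open U ->
  Cn_on n U f -> Cn_on n U g -> Cn_on n U (fun x => f x + g x).
Proof.
move=> oU; elim: n f g => [|n IH] f g /=.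
  by move=> cf cg x Ux; apply: continuousD; [exact: cf|exact: cg].
move=> [df Df] [dg Dg]; split=> [x Ux|v].
  by apply: differentiableD; [exact: df|exact: dg].
apply: Cn_on_congr (IH _ _ (Df v) (Dg v)) => // x Ux.
by rewrite -deriveD //; apply: diff_derivable; [exact: df|exact: dg].
Qed.

Lemma Cn_onM V n (U : set V) (f g : V -> K) : open U ->
  Cn_on n U f -> Cn_on n U g -> Cn_on n U (fun x => f x * g x).
Proof.
move=> oU; elim: n f g => [|n IH] f g.
  by move=> cf cg x Ux; apply: continuousM; [exact: cf|exact: cg].
move=> Cf Cg; have [df Df] := Cf; have [dg Dg] := Cg; split=> [x Ux|v].
  by apply: differentiableM; [exact: df|exact: dg].
(* Each Leibniz term pairs a derivative, of order n, with an undifferentiated factor, which [Cn_onS]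
   lowers to order n. *)
have := Cn_onD oU (IH _ _ (Cn_onS Cf) (Dg v)) (IH _ _ (Cn_onS Cg) (Df v)).
apply: Cn_on_congr => // x Ux.
by rewrite -[LHS]deriveM //; apply: diff_derivable; [exact: df|exact: dg].
Qed.

Lemma Cn_on_sum V W n (U : set V) (I : Type) (s : seq I) (f : I -> V -> W) :
  open U -> (forall i, Cn_on n U (f i)) ->
  Cn_on n U (fun x => \sum_(i <- s) f i x).
Proof.
move=> oU Cf; elim: s => [|i s IH].
  by apply: Cn_on_congr (Cn_on_cst n U (0 : W)) => // x _; rewrite big_nil.
apply: Cn_on_congr (Cn_onD oU (Cf i) IH) => // x _.
by rewrite big_cons.
Qed.

(** The two difference quotients are the same function of the increment, so the limits agree even
    where they are only default values. *)
Lemma derive_affine V V' W (L : {linear V -> V'}) (b : V') (f : V' -> W) x v :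
  'D_v (fun y => f (L y + b)) x = 'D_(L v) f (L x + b).
Proof.
rewrite /derive; apply: (congr1 (fun g => lim (g @ 0^'))).
by apply/funext => t /=; rewrite (linearP L) -!addrA.
Qed.

Lemma Cn_on_affine V V' W n (L : {linear V -> V'}) (b : V') (U : set V')
    (f : V' -> W) : continuous L ->
  Cn_on n U f -> Cn_on n [set x | U (L x + b)] (fun x => f (L x + b)).
Proof.
move=> cL.
have cA : continuous (fun x => L x + b).
  by move=> x; apply: cvgD; [exact: cL|exact: cvg_cst].
have dA x : differentiable (fun x => L x + b) x.
  apply: (@differentiableD _ _ _ L (cst b)); last exact: differentiable_cst.
  exact: linear_differentiable.
elim: n f => [|n IH] f /=.
  by move=> cf x Ux; apply: continuous_comp; [exact: cA|exact: cf].
move=> [df Df]; split=> [x Ux|v].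
  by apply: (differentiable_comp (dA x)); exact: df.
have -> : 'D_v (fun y => f (L y + b)) = fun x => 'D_(L v) f (L x + b).
  by apply/funext => x; rewrite derive_affine.
exact: (IH ('D_(L v) f)).
Qed.

Lemma smooth_on_affine V V' W (L : {linear V -> V'}) (b : V') (U : set V')
    (f : V' -> W) : continuous L -> smooth_on U f ->
  smooth_on [set x | U (L x + b)] (fun x => f (L x + b)).
Proof. by move=> cL sf n; exact: Cn_on_affine. Qed.

Lemma differentiable_frame V W (I : finType) (y : I -> V -> K) (b : I -> W) x :
  (forall k, differentiable (y k) x) ->
  differentiable (fun z => \sum_k y k z *: b k) x.
Proof.
move=> dy; elim: (index_enum I) => [|i s IH].
  by under eq_fun do rewrite big_nil; exact: differentiable_cst.
under eq_fun do rewrite big_cons; apply: differentiableD => //.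
exact: differentiableZl.
Qed.

Lemma derive_frame V W (I : finType) (y : I -> V -> K) (b : I -> W) x v :
  (forall k, differentiable (y k) x) ->
  'D_v (fun z => \sum_k y k z *: b k) x = \sum_k 'D_v (y k) x *: b k.
Proof.
move=> dy; rewrite deriveE; last exact: differentiable_frame.
elim: (index_enum I) => [|i s IH].
  by under eq_fun do rewrite big_nil; rewrite big_nil -deriveE ?derive_cst.
rewrite big_cons -IH.
have ds : differentiable (fun z => \sum_(j <- s) y j z *: b j) x.
  elim: s {IH} => [|j s IH].
    by under eq_fun do rewrite big_nil; exact: differentiable_cst.
  under eq_fun do rewrite big_cons; apply: differentiableD => //.
  exact: differentiableZl.
have -> : (fun z => \sum_(j <- i :: s) y j z *: b j) =
    (fun z => y i z *: b i) + (fun z => \sum_(j <- s) y j z *: b j).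
  by apply/funext => z; rewrite big_cons.
have di : differentiable (fun z => y i z *: b i) x by exact: differentiableZl.
rewrite diffD //; congr (_ + _).
by rewrite diffZl // deriveE.
Qed.

(* No independence of the vectors [b k] is needed, so the coordinates of a
   chart may be any functions through which it factors. *)
Lemma derive_comp_frame V W (I : finType) (y : I -> V -> K) (b : I -> W)
    (f : W -> K) x v :
  (forall k, differentiable (y k) x) ->
  differentiable f (\sum_k y k x *: b k) ->
  'D_v (fun z => f (\sum_k y k z *: b k)) x =
  \sum_k 'D_v (y k) x * 'D_(b k) f (\sum_k y k x *: b k).
Proof.
move=> dy df; have dF := differentiable_frame b dy.
have dfF : differentiable (f \o (fun z => \sum_k y k z *: b k)) x.
  exact: differentiable_comp.
rewrite (deriveE _ dfF) diff_comp //= -(deriveE _ dF) derive_frame //.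
rewrite linear_sum; apply: eq_bigr => k _.
by rewrite linearZZ -deriveE.
Qed.

(** By the chain rule the derivative is a sum of products of a derivative of [y k] with ['D_(b k) f]
    composed with the same frame. The induction therefore runs over f with y and b fixed, and scalar
    values of f keep it within products of scalar functions. *)
Lemma Cn_on_comp V W (I : finType) (y : I -> V -> K) (b : I -> W) n
    (U : set V) (U' : set W) (f : W -> K) : open U ->
  (forall x, U x -> U' (\sum_k y k x *: b k)) ->
  Cn_on n U' f -> (forall k, Cn_on n U (y k)) ->
  Cn_on n U (fun x => f (\sum_k y k x *: b k)).
Proof.
move=> oU UU'; elim: n f => [|n IH] f Cf Cy.
  move=> x Ux; rewrite /prop_for /continuous_at.
  apply: (@continuous_comp _ _ _ (fun x => \sum_k y k x *: b k) f).
    have := @Cn_on_sum _ _ 0 U I (index_enum I) (fun k z => y k z *: b k) oU _.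
    apply=> // k z Uz; apply: cvgZr_tmp; exact: Cy.
  by apply: Cf; exact: UU'.
have [df Df] := Cf.
have dy k x : U x -> differentiable (y k) x by case: (Cy k) => d _ /d.
split=> [x Ux|v].
  apply: (@differentiable_comp _ _ _ _ (fun x => \sum_k y k x *: b k) f).
    by apply: differentiable_frame => k; exact: dy.
  by apply: df; exact: UU'.
apply: (@Cn_on_congr _ _ n U (fun x => \sum_k 'D_v (y k) x *
    'D_(b k) f (\sum_k y k x *: b k))) => //.
  move=> x Ux; rewrite derive_comp_frame // => [k|]; first exact: dy.
  by apply: df; exact: UU'.
apply: Cn_on_sum => // k; apply: Cn_onM => //; first by have [_ ] := Cy k; apply.
by apply: (IH ('D_(b k) f)) => [|j]; [exact: Df|exact: Cn_onS].
Qed.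

Lemma smooth_on_comp V W (I : finType) (y : I -> V -> K) (b : I -> W)
    (U : set V) (U' : set W) (f : W -> K) : open U ->
  (forall x, U x -> U' (\sum_k y k x *: b k)) ->
  smooth_on U' f -> (forall k, smooth_on U (y k)) ->
  smooth_on U (fun x => f (\sum_k y k x *: b k)).
Proof.
by move=> oU UU' sf sy n; apply: Cn_on_comp UU' (sf n) _ => // k; exact: sy.
Qed.

Lemma smooth_on_derive V W (U : set V) (f : V -> W) v :
  smooth_on U f -> smooth_on U ('D_v f).
Proof. by move=> sf n; have [_] := sf n.+1; apply. Qed.

Lemma smooth_on_differentiable V W (U : set V) (f : V -> W) x :
  smooth_on U f -> U x -> differentiable f x.
Proof. by move=> sf; have [+ _] := sf 1; apply. Qed.

Lemma smooth_on_sub V W (U U' : set V) (f : V -> W) :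
  U' `<=` U -> smooth_on U f -> smooth_on U' f.
Proof. by move=> UU' sf n; exact: Cn_on_sub (sf n). Qed.

Lemma smooth_on_congr V W (U : set V) (f g : V -> W) :
  open U -> (forall x, U x -> f x = g x) -> smooth_on U f -> smooth_on U g.
Proof. by move=> oU fg sf n; exact: Cn_on_congr fg (sf n). Qed.

End SmoothCalculus.

(** * Mixed complex derivatives commute *)

(* The abstract field K stands for R[i], with embedding [toC] of the reals and
   real part [re]. *)
Section ComplexSchwarz.
Context {R : realType} {K : numFieldType}.
Variables (toC : {rmorphism R -> K}) (re : K -> R) (im : K).
Hypothesis toC_lt : {mono toC : x y / x < y}.
Hypothesis toC_norm : forall a, `|toC a| = toC `|a|.
Hypothesis pos_toC : forall x, 0 < x -> exists2 k, 0 < k & x = toC k.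
Hypothesis reB : forall x y, re (x - y) = re x - re y.
Hypothesis reM : forall a x, re (toC a * x) = a * re x.
Hypothesis re_norm : forall x, toC `|re x| <= `|x|.
Hypothesis re_eq0 : forall x, re x = 0 -> re (im * x) = 0 -> x = 0.

Local Lemma toC_le : {mono toC : x y / x <= y}.
Proof. by apply: le_mono => x y; rewrite toC_lt. Qed.

Lemma real_dnbhs0 (P : K -> Prop) :
  (\forall h \near 0^', P h) -> \forall s \near (0 : R)^', P (toC s).
Proof.
rewrite !near_withinE => /nbhs_ballP[_ /pos_toC[k k0 ->] kP].
apply/nbhs_ballP; exists k => // s; rewrite /ball /= => sk s0.
apply: kP; last by rewrite fmorph_eq0.
rewrite /ball /= sub0r normrN; rewrite sub0r normrN in sk.
by rewrite toC_norm toC_lt.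
Qed.

(** [re] is additive, commutes with real scalars and does not increase norms; the estimate on the
    difference quotient at real increments thus passes to real parts. *)
Lemma re_derive (V : normedModType K) (phi : V -> K) (a v : V) (t : R) :
  derivable phi (a + toC t *: v) v ->
  is_derive t 1 (fun t => re (phi (a + toC t *: v)))
    (re ('D_v phi (a + toC t *: v))).
Proof.
set y := a + _ => dphi.
suff L : (fun h : R => h^-1 *: (((fun t => re (phi (a + toC t *: v))) \o
    shift t) (h *: 1) - re (phi y))) @ 0^' --> re ('D_v phi y).
  by apply: DeriveDef; [exact: cvgP L|exact: cvg_lim L].
apply/cvgrPdist_lt => e e0.
have eC : 0 < toC e by rewrite -(rmorph0 toC) toC_lt.
have /(_ _ _ eC) := (cvgrPdist_lt _ _).1 dphi.
move/real_dnbhs0; apply: filterS => s /=; rewrite /shift /=.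
have -> : a + toC (s *: 1 + t) *: v = toC s *: v + y.
  by rewrite /y [s *: 1]mulr1 rmorphD scalerDl addrCA.
set z := phi (_ + _) => lt.
rewrite -toC_lt; apply: le_lt_trans lt.
apply: le_trans (re_norm _); rewrite toC_le.
by rewrite [in leRHS]reB -fmorphV [re (_ *: _)]reM reB.
Qed.

Lemma complex_box (V : normedModType K) (P : V -> Prop) (x v w : V) :
  (\forall y \near x, P y) -> exists2 s : R, 0 < s &
  forall a b, 0 <= a <= s -> 0 <= b <= s ->
    P (x + toC a *: v + toC b *: w).
Proof.
move=> /nbhs_ballP[_ /pos_toC[k k0 ->] kP].
(* The summand 1 makes p positive and the final bound strict, also when v and w vanish. *)
have [p p0 pE] : exists2 p, 0 < p & `|v| + `|w| + 1 = toC p.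
  by apply: pos_toC; rewrite ltr_wpDl ?addr_ge0.
exists (k / p) => [|a b /andP[a0 ak] /andP[b0 bk]]; first exact: divr_gt0.
apply: kP; rewrite -ball_normE /= !opprD !addrA subrr add0r.
rewrite -opprD normrN; apply: le_lt_trans (ler_normD _ _) _.
rewrite !normrZ !toC_norm (ger0_norm a0) (ger0_norm b0).
apply: (@le_lt_trans _ _ (toC (k / p) * `|v| + toC (k / p) * `|w|)).
  by rewrite lerD // ler_wpM2r ?toC_le.
rewrite -mulrDr.
apply: (@lt_le_trans _ _ (toC (k / p) * (`|v| + `|w| + 1))).
  by rewrite ltr_pM2l ?ltrDl // -(rmorph0 toC) toC_lt divr_gt0.
by rewrite pE -rmorphM divfK ?lexx // gt_eqF.
Qed.

(** The real mean value theorem along the real segment from a in direction v; it speaks of real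
    parts because the intermediate point for the imaginary part would be another one. *)
Lemma mean_value (V : normedModType K) (phi : V -> K) (a v : V) (s : R) :
  0 < s ->
  (forall t, 0 <= t <= s -> differentiable phi (a + toC t *: v)) ->
  exists2 t, 0 <= t <= s &
    re (phi (a + toC s *: v)) - re (phi a) =
    re ('D_v phi (a + toC t *: v)) * s.
Proof.
move=> s0 dphi.
have drv t : 0 <= t <= s -> is_derive t 1 (fun t => re (phi (a + toC t *: v)))
    (re ('D_v phi (a + toC t *: v))).
  by move=> /dphi d; apply: re_derive; exact: diff_derivable.
have [| |t] := @MVT R (fun t => re (phi (a + toC t *: v)))
  (fun t => re ('D_v phi (a + toC t *: v))) 0 s s0.
- by move=> t /[!in_itv] /= /andP[/ltW t0 /ltW ts]; apply: drv; rewrite t0.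
- apply: derivable_within_continuous => t /[!in_itv] /= tin.
  by have [] := drv t tin.
move=> /[!in_itv] /= /andP[/ltW t0 /ltW ts].
rewrite rmorph0 scale0r addr0 subr0 => E.
by exists t; rewrite ?t0.
Qed.

(* Exchanging v and w does not change the second difference on the left, so that
   the two mixed derivatives take a common real part near x. *)
Lemma second_difference (V : normedModType K) (f : V -> K) (x v w : V) (s : R)
    (U : set V) : 0 < s -> smooth_on U f ->
  (forall a b, 0 <= a <= s -> 0 <= b <= s ->
    U (x + toC a *: v + toC b *: w)) ->
  exists a b, [/\ 0 <= a <= s, 0 <= b <= s &
    re (f (x + toC s *: v + toC s *: w)) - re (f (x + toC s *: v)) -
    (re (f (x + toC s *: w)) - re (f x)) =
    re ('D_w ('D_v f) (x + toC a *: v + toC b *: w)) * s * s].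
Proof.
move=> s0 sf Us.
have s00 : 0 <= (0 : R) <= s by rewrite lexx ltW.
have sss : 0 <= s <= s by rewrite lexx ltW.
have sD := smooth_on_derive v sf.
(* The second difference is the increment of [psi] along v. The mean value theorem applied to [psi]
   along v leaves an increment of ['D_v f] along w, to which it applies again. *)
pose psi y := f (y + toC s *: w) - f y.
have dpsi t : 0 <= t <= s ->
    differentiable psi (x + toC t *: v) /\
    'D_v psi (x + toC t *: v) =
    'D_v f (x + toC t *: v + toC s *: w) - 'D_v f (x + toC t *: v).
  move=> ts.
  have U1 := Us t s ts sss; have U2 := Us t 0 ts s00.
  rewrite rmorph0 scale0r addr0 in U2.
  have d2 := smooth_on_differentiable sf U2.
  have d1 := smooth_on_differentiable sf U1.
  have d3 : differentiable (fun y => f (y + toC s *: w)) (x + toC t *: v).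
    have dA : differentiable (id + cst (toC s *: w) : V -> V) (x + toC t *: v).
      by apply: differentiableD => //; exact: differentiable_cst.
    exact: (differentiable_comp dA).
  split; first exact: differentiableB.
  rewrite [LHS](@deriveB _ _ _ (fun y => f (y + toC s *: w)) f) //;
    [|exact: diff_derivable..].
  by congr (_ - _); rewrite (derive_affine idfun).
have [|a a01] := @mean_value _ psi x v s s0.
  by move=> t /dpsi[].
have [_ ->] := dpsi a a01.
rewrite /psi !reB => ->.
have [|b b01 ->] := @mean_value _ ('D_v f) (x + toC a *: v) w s s0.
  by move=> t ts; apply: (smooth_on_differentiable sD); exact: Us.
by exists a, b.
Qed.

Lemma two_close (p q c c' : R) : `|p - c| < `|p - q| / 2 ->
  `|q - c'| < `|p - q| / 2 -> c = c' -> False.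
Proof.
move=> h1 h2 cc'; rewrite cc' in h1.
have := ler_distD c' p q; rewrite [`|c' - q|]distrC; lra.
Qed.

Lemma derive_comm_re (V : normedModType K) (U : set V) (f : V -> K) x v w :
  open U -> smooth_on U f -> U x ->
  re ('D_v ('D_w f) x) = re ('D_w ('D_v f) x).
Proof.
move=> oU sf Ux; apply/eqP/negPn/negP => neq.
(* Half of the supposed gap: on a small box both mixed derivatives stay within e of their values at
   x, yet they share a value of the real part through the second difference. *)
pose e := `|re ('D_v ('D_w f) x) - re ('D_w ('D_v f) x)| / 2.
have e0 : 0 < e by rewrite divr_gt0 // normr_gt0 subr_eq0.
have e0C : 0 < toC e by rewrite -(rmorph0 toC) toC_lt.
have nearD v1 v2 : \forall y \near x,
    `|re ('D_v1 ('D_v2 f) x) - re ('D_v1 ('D_v2 f) y)| < e.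
  have sD := smooth_on_derive v1 (smooth_on_derive v2 sf).
  have := differentiable_continuous (smooth_on_differentiable sD Ux).
  move=> /cvgrPdist_lt /(_ _ e0C); apply: filterS => y lt.
  by rewrite -toC_lt -reB; exact: le_lt_trans (re_norm _) lt.
have /(complex_box v w) [s s0 Ps] : \forall y \near x, [/\ U y,
    `|re ('D_v ('D_w f) x) - re ('D_v ('D_w f) y)| < e &
    `|re ('D_w ('D_v f) x) - re ('D_w ('D_v f) y)| < e].
  have nU : \forall y \near x, U y by exact: open_nbhs_nbhs.
  by apply: filterS3 nU (nearD v w) (nearD w v) => y; split.
have [|a [b [a01 b01 E1]]] := @second_difference _ f x v w s U s0 sf.
  by move=> a b a01 b01; case: (Ps a b a01 b01).
have [|b' [a' [b01' a01' E2]]] := @second_difference _ f x w v s U s0 sf.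
  by move=> b' a' b01' a01'; rewrite addrAC; case: (Ps a' b' a01' b01').
have [_ _ lt1] := Ps a b a01 b01.
have [_ lt2 _] := Ps a' b' a01' b01'.
rewrite [x + toC a' *: v + _]addrAC in lt2.
have E : re ('D_w ('D_v f) (x + toC a *: v + toC b *: w)) =
         re ('D_v ('D_w f) (x + toC b' *: w + toC a' *: v)).
  have sn0 : s != 0 by rewrite gt_eqF.
  have subACA (p q p' q' : R) : p - q - (p' - q') = p - p' - (q - q') by ring.
  have EE := etrans (esym E1) (etrans (subACA _ _ _ _) _).
  apply: (mulIf sn0); apply: (mulIf sn0); apply: EE.
  by rewrite [x + toC s *: v + _]addrAC; exact: E2.
exact: (two_close lt2 lt1 (esym E)).
Qed.

Let eqr_subr0 (p q : R) : p = q -> p - q = 0.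
Proof. by move=> ->; rewrite subrr. Qed.

(** The real-part statement is applied to f and to [im * f]; by [re_eq0] the two real parts of the
    difference determine it. *)
Lemma derive_comm_abstract (V : normedModType K) (U : set V) (f : V -> K)
    x v w :
  open U -> smooth_on U f -> U x -> 'D_v ('D_w f) x = 'D_w ('D_v f) x.
Proof.
move=> oU sf Ux; apply/eqP; rewrite -subr_eq0; apply/eqP/re_eq0.
  exact: etrans (reB _ _) (eqr_subr0 (derive_comm_re v w oU sf Ux)).
have D z y : U y -> 'D_z (fun y => im * f y) y = im * 'D_z f y.
  move=> Uy; have dd : derivable f y z.
    exact: diff_derivable (smooth_on_differentiable sf Uy).
  exact: (deriveZ im dd).
have DD z z' : 'D_z ('D_z' (fun y => im * f y)) x = im * 'D_z ('D_z' f) x.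
  have dd : derivable ('D_z' f) x z.
    exact: diff_derivable (smooth_on_differentiable (smooth_on_derive z' sf) Ux).
  apply: etrans (deriveZ im dd).
  apply: near_eq_derive; near=> y; apply: D; near: y; exact: open_nbhs_nbhs.
have sg : smooth_on U (fun y => im * f y).
  by move=> n; apply: Cn_onM => //; exact: Cn_on_cst.
have E : im * 'D_v ('D_w f) x - im * 'D_w ('D_v f) x =
    'D_v ('D_w (fun y => im * f y)) x - 'D_w ('D_v (fun y => im * f y)) x.
  exact: (esym (congr2 (fun p q => p - q) (DD v w) (DD w v))).
apply: etrans (congr1 re (etrans (mulrBr _ _ _) E)) _.
exact: etrans (reB _ _) (eqr_subr0 (derive_comm_re v w oU sg Ux)).
Unshelve. all: by end_near. Qed.

End ComplexSchwarz.

(** The property of the scalars on which the Lie theory below rests. It is carried as a hypothesis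
    over a general K and established for R[i]. *)
Definition mixed_derivatives_commute (K : numFieldType) :=
  forall (V : normedModType K) (U : set V) (f : V -> K) x v w,
  open U -> smooth_on U f -> U x -> 'D_v ('D_w f) x = 'D_w ('D_v f) x.

Lemma complex_mixed_derivatives (R : realType) :
  mixed_derivatives_commute R[i].
Proof.
move=> V U f x v w.
apply: (@derive_comm_abstract R _ (real_complex R) (@complex.Re R) 'i%C).
- by move=> a b; rewrite ltcR.
- by move=> a; rewrite normc_def /= expr0n addr0 sqrtr_sqr.
- by case=> a b; rewrite ltcE /= => /andP[/eqP -> a0]; exists a.
- by move=> [a b] [a' b'].
- by move=> a [b c] /=; rewrite mul0r subr0.
- exact: normc_ge_Re.
- by move=> [a b] /= -> /eqP; rewrite mul0r mul1r sub0r oppr_eq0 => /eqP ->.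
Qed.

(** * Manifolds and their smooth maps *)

Section SmoothFunctions.
Context {K : numFieldType}.

Lemma continuous_frame (T : topologicalType) (V : normedModType K) (I : finType)
    (y : I -> T -> K) (b : I -> V) x :
  (forall k, {for x, continuous (y k)}) ->
  {for x, continuous (fun z => \sum_k y k z *: b k)}.
Proof.
move=> cy; rewrite /prop_for /continuous_at.
elim: (index_enum I) => [|i s IH].
  by under eq_fun do rewrite big_nil; rewrite big_nil; exact: cvg_cst.
under eq_fun do rewrite big_cons; rewrite big_cons; apply: cvgD => //.
by apply: cvgZr_tmp; exact: cy.
Qed.

Definition smooth_at (T : topologicalType) (V : normedModType K)
    (A : set (chart T V)) (x : T) (F : T -> K) : Prop :=
  exists W, [/\ open W, W x & smooth_fun A W F].

(** The vectors [b k] are fixed and only the scalar coefficients vary, so that charts in rows, pairs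
    and matrices are treated alike, with no basis of the model space and no vector-valued smooth
    maps. *)
Definition chart_frame (T : topologicalType) (V : normedModType K)
    (A : set (chart T V)) (c : chart T V) (x : T) : Prop :=
  exists (I : finType) (y : I -> T -> K) (b : I -> V),
    (forall k, smooth_at A x (y k)) /\
    forall z, cmap c z = \sum_k y k z *: b k.

(** [manifold_frame] stands in for the smoothness of transition maps. For charts in row vectors it
    follows from [is_atlas], and unlike a statement about bases it passes directly to products and
    powers. *)
Record manifold (T : topologicalType) (V : normedModType K)
    (A : set (chart T V)) : Prop := Manifold {
  manifold_chart : forall c, A c -> is_chart c;
  manifold_cover : forall x, exists2 c, A c & cdom c x;
  manifold_frame : forall c x, A c -> cdom c x -> chart_frame A c x
}.

Section OneManifold.
Context (T : topologicalType) (V : normedModType K) (A : set (chart T V)).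
Hypothesis mA : manifold A.

Lemma chart_image_open (c : chart T V) (U : set T) :
  A c -> open U -> open (cmap c @` (U `&` cdom c)).
Proof.
move=> /(manifold_chart mA)[od oi K1 cm ci] oU.
rewrite openE => _ [x [Ux dx] <-]; rewrite /interior.
have ix : (cmap c @` cdom c) (cmap c x) by exists x.
have : \forall y \near cmap c x, U (cinv c y).
  apply: (ci _ ix); rewrite K1 //; exact: open_nbhs_nbhs.
have : \forall y \near cmap c x, (cmap c @` cdom c) y by exact: open_nbhs_nbhs.
apply: filterS2 => y [z dz <-]; rewrite K1 // => Uz.
by exists z.
Qed.

Lemma smooth_fun_sub (U U' : set T) (F : T -> K) : U' `<=` U ->
  smooth_fun A U F -> smooth_fun A U' F.
Proof.
move=> UU' sF c Ac; apply: smooth_on_sub (sF c Ac).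
by move=> _ [x [Ux dx] <-]; exists x => //; split => //; exact: UU'.
Qed.

Lemma smooth_fun_congr (U : set T) (F F' : T -> K) : open U ->
  (forall x, U x -> F x = F' x) -> smooth_fun A U F -> smooth_fun A U F'.
Proof.
move=> oU FF' sF c Ac; apply: smooth_on_congr (sF c Ac).
  exact: chart_image_open.
move=> _ [x [Ux dx] <-] /=; apply: FF'.
by have [_ _ -> //] := manifold_chart mA Ac.
Qed.

Lemma smooth_fun_continuous (U : set T) (F : T -> K) x : U x ->
  smooth_fun A U F -> {for x, continuous F}.
Proof.
move=> Ux sF; have [c Ac dx] := manifold_cover mA x.
have [od oi K1 cm ci] := manifold_chart mA Ac.
have cF : {for cmap c x, continuous (F \o cinv c)}.
  apply: (sF c Ac 0); by exists x.
have E : F x = (F \o cinv c) (cmap c x) by rewrite /= K1.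
rewrite /prop_for /continuous_at E.
have cc : {for x, continuous ((F \o cinv c) \o cmap c)}.
  by apply: continuous_comp => //; exact: cm.
apply: cvg_trans cc; apply: near_eq_cvg; near=> z => /=; rewrite K1 //.
near: z; exact: open_nbhs_nbhs.
Unshelve. all: by end_near. Qed.

Lemma smooth_fun_comp (W : normedModType K) (I : finType) (y : I -> T -> K)
    (b : I -> W) (U : set T) (U' : set W) (f : W -> K) : open U ->
  (forall x, U x -> U' (\sum_k y k x *: b k)) ->
  smooth_on U' f -> (forall k, smooth_fun A U (y k)) ->
  smooth_fun A U (fun x => f (\sum_k y k x *: b k)).
Proof.
move=> oU UU' sf sy c Ac.
apply: (@smooth_on_comp _ _ _ _ (fun k => y k \o cinv c)) sf _.
- exact: chart_image_open.
- move=> _ [x [Ux dx] <-] /=.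
  by have [_ _ -> // _ _] := manifold_chart mA Ac; exact: UU'.
- by move=> k; exact: sy.
Qed.

Lemma smooth_at_near (x : T) (F : T -> K) :
  smooth_at A x F -> \near x, smooth_at A x F.
Proof.
move=> [U [oU Ux sF]]; near=> z; exists U; split => //.
near: z; exact: open_nbhs_nbhs.
Unshelve. all: by end_near. Qed.

Lemma smooth_at_continuous (x : T) (F : T -> K) :
  smooth_at A x F -> {for x, continuous F}.
Proof. by move=> [U [oU Ux sF]]; exact: smooth_fun_continuous sF. Qed.

Lemma smooth_at_congr (x : T) (F F' : T -> K) :
  (\near x, F x = F' x) -> smooth_at A x F -> smooth_at A x F'.
Proof.
move=> FF' [U [oU Ux sF]].
exists (U `&` [set z | F z = F' z]°); split.
- by apply: openI => //; exact: open_interior.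
- by split => //; exact: FF'.
- apply: (@smooth_fun_congr _ F).
  + by apply: openI => //; exact: open_interior.
  + by move=> z [_ /interior_subset].
  + by apply: smooth_fun_sub sF => z [].
Qed.

Lemma smooth_at_comp (W : normedModType K) (I : finType) (y : I -> T -> K)
    (b : I -> W) (x : T) (U' : set W) (f : W -> K) :
  open U' -> U' (\sum_k y k x *: b k) -> smooth_on U' f ->
  (forall k, smooth_at A x (y k)) ->
  smooth_at A x (fun x => f (\sum_k y k x *: b k)).
Proof.
move=> oU' U'x sf sy.
pose U := [set z | (forall k, smooth_at A z (y k)) /\ U' (\sum_k y k z *: b k)].
have cU : \near x, U x.
  have c1 : \near x, forall k, smooth_at A x (y k).
    by apply: filter_forall => k; exact: smooth_at_near.
  have c2 : \forall z \near x, U' (\sum_k y k z *: b k).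
    have cc := continuous_frame (b := b) (fun k => smooth_at_continuous (sy k)).
    by apply: cc; exact: open_nbhs_nbhs.
  by apply: filterS2 c1 c2 => z; split.
have [V_ VP] := choice sy.
pose S := U° `&` [set z | forall k, V_ k z]°.
have oS : open S by apply: openI; exact: open_interior.
exists S; split => //.
  split; first exact: cU.
  by apply: filter_forall => k; have [? ? _] := VP k; exact: open_nbhs_nbhs.
apply: (@smooth_fun_comp _ _ _ _ _ U') => //.
  by move=> z [/interior_subset[]].
move=> k; have [_ _] := VP k; apply: smooth_fun_sub.
by move=> z [_ /interior_subset /(_ k)].
Unshelve. all: by end_near. Qed.

Lemma smooth_at_cst (x : T) (a : K) : smooth_at A x (fun _ => a).
Proof.
exists setT; split => //; first exact: openT.
by move=> c Ac n; exact: Cn_on_cst.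
Qed.

Lemma smooth_atD (x : T) (F F' : T -> K) :
  smooth_at A x F -> smooth_at A x F' -> smooth_at A x (fun z => F z + F' z).
Proof.
move=> [U [oU Ux sF]] [U' [oU' U'x sF']].
exists (U `&` U'); split => //; first exact: openI.
move=> c Ac n; apply: (Cn_onD (f := F \o cinv c) (g := F' \o cinv c)).
- by apply: chart_image_open => //; exact: openI.
- by apply: (@smooth_fun_sub U _ F _ sF c Ac n) => z [].
- by apply: (@smooth_fun_sub U' _ F' _ sF' c Ac n) => z [].
Qed.

Lemma smooth_atM (x : T) (F F' : T -> K) :
  smooth_at A x F -> smooth_at A x F' -> smooth_at A x (fun z => F z * F' z).
Proof.
move=> [U [oU Ux sF]] [U' [oU' U'x sF']].
exists (U `&` U'); split => //; first exact: openI.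
move=> c Ac n; apply: (Cn_onM (f := F \o cinv c) (g := F' \o cinv c)).
- by apply: chart_image_open => //; exact: openI.
- by apply: (@smooth_fun_sub U _ F _ sF c Ac n) => z [].
- by apply: (@smooth_fun_sub U' _ F' _ sF' c Ac n) => z [].
Qed.

Lemma smooth_at_sum (x : T) (I : Type) (s : seq I) (F : I -> T -> K) :
  (forall i, smooth_at A x (F i)) ->
  smooth_at A x (fun z => \sum_(i <- s) F i z).
Proof.
move=> sF; elim: s => [|i s IH].
  by under eq_fun do rewrite big_nil; exact: smooth_at_cst.
by under eq_fun do rewrite big_cons; exact: smooth_atD.
Qed.

End OneManifold.
End SmoothFunctions.

Lemma open_prod (T T' : topologicalType) (U : set T) (U' : set T') :
  open U -> open U' -> open (U `*` U').
Proof.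
move=> oU oU'; have -> : U `*` U' = fst @^-1` U `&` snd @^-1` U' by [].
apply: openI; first by apply: open_comp oU => z _; apply: cvg_fst.
by apply: open_comp oU' => z _; apply: cvg_snd.
Qed.

Section Coordinates.
Context {K : numFieldType}.
Implicit Types V W : normedModType K.

Lemma Cn_on_linear V W W' (L : {linear W -> W'}) n (U : set V) (f : V -> W) :
  open U -> continuous L -> Cn_on n U f -> Cn_on n U (fun x => L (f x)).
Proof.
move=> oU cL; elim: n f => [|n IH] f /=.
  by move=> cf x Ux; apply: continuous_comp; [exact: cf|exact: cL].
move=> [df Df].
have dL y : differentiable L y by exact: linear_differentiable.
split=> [x Ux|v].
  by apply: differentiable_comp; [exact: df|exact: dL].
apply: Cn_on_congr (IH _ (Df v)) => // x Ux.
have dLf : differentiable (L \o f) x.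
  by apply: differentiable_comp; [exact: df|exact: dL].
rewrite (deriveE _ dLf) diff_comp //=; last exact: df.
by rewrite diff_lin //= -deriveE //; exact: df.
Qed.

Lemma smooth_on_coord V m n (U : set V) (f : V -> 'M[K]_(m, n)) i j :
  open U -> smooth_on U f -> smooth_on U (fun x => f x i j).
Proof.
move=> oU sf k.
have @L : {linear 'M[K]_(m, n) -> K}.
  by exists (fun N : 'M[K]_(_, _) => N i j); do 2![eexists]; do ?[constructor];
     rewrite ?mxE// => ? *; rewrite ?mxE//; move=> ?; rewrite !mxE.
exact: (@Cn_on_linear _ _ _ L k U f oU (@coord_continuous K m n i j) (sf k)).
Qed.

Lemma row_continuous m n (i : 'I_m) : continuous (@row K m n i).
Proof.
move=> M; pose y (j : 'I_n) (N : 'M[K]_(m, n)) := N i j.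
have -> : @row K m n i = fun N => \sum_j y j N *: delta_mx 0 j.
  by apply/funext => N; rewrite [LHS]row_sum_delta; apply: eq_bigr => j _;
    rewrite mxE.
by apply: continuous_frame => j; exact: coord_continuous.
Qed.
End Coordinates.

(** * Smooth maps tested on scalar functions; products and powers of manifolds *)

Section Morphisms.
Context {K : numFieldType}.

(** Smoothness by pullback makes composition immediate and has the same shape as the sheaf condition
    in [is_poisson_map]. *)
Definition morph (T T' : topologicalType) (V V' : normedModType K)
    (A : set (chart T V)) (A' : set (chart T' V')) (h : T -> T') : Prop :=
  continuous h /\
  forall x F, smooth_at A' (h x) F -> smooth_at A x (F \o h).

Lemma morph_comp (T T' T'' : topologicalType) (V V' V'' : normedModType K)
    (A : set (chart T V)) (A' : set (chart T' V')) (A'' : set (chart T'' V''))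
    (h : T -> T') (h' : T' -> T'') :
  morph A A' h -> morph A' A'' h' -> morph A A'' (h' \o h).
Proof.
move=> [ch sh] [ch' sh']; split.
  by move=> x; apply: continuous_comp; [exact: ch|exact: ch'].
by move=> x F sF; exact: (sh x (F \o h') (sh' _ F sF)).
Qed.

Lemma morph_id (T : topologicalType) (V : normedModType K)
    (A : set (chart T V)) : morph A A id.
Proof. by split => // x; exact: cvg_id. Qed.

Section MorphFrame.
Context (T T' : topologicalType) (V V' : normedModType K).
Context (A : set (chart T V)) (A' : set (chart T' V')) (h : T -> T').
Hypothesis mA : manifold A.
Hypothesis mA' : manifold A'.

(** Near h x a function F is [F \o cinv c] applied to the frame of a chart c, so it is enough to
    pull back the scalar coefficients of that frame. *)
Lemma morph_frame : continuous h ->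
  (forall x c, A' c -> cdom c (h x) ->
    exists (I : finType) (y : I -> T' -> K) (b : I -> V'),
      (forall k, smooth_at A x (y k \o h)) /\
      forall z, cmap c z = \sum_k y k z *: b k) ->
  morph A A' h.
Proof.
move=> ch fh; split=> // x F [W [oW Wx sF]].
have [c Ac dx] := manifold_cover mA' (h x).
have [I [y [b [sy cE]]]] := fh x c Ac dx.
have [od oi K1 cm ci] := manifold_chart mA' Ac.
have oU' := chart_image_open mA' Ac oW.
apply: (@smooth_at_congr _ _ _ _ mA _
  (fun z => (F \o cinv c) (\sum_k (y k \o h) z *: b k))).
  have : \forall z \near x, cdom c (h z).
    by apply: (ch x); exact: open_nbhs_nbhs.
  by apply: filterS => z dz /=; rewrite -cE K1.
apply: smooth_at_comp oU' _ (sF c Ac) _ => //.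
by rewrite -cE; exists (h x).
Qed.

End MorphFrame.

Lemma morph_cst (T T' : topologicalType) (V V' : normedModType K)
    (A : set (chart T V)) (A' : set (chart T' V')) (a : T') :
  manifold A -> manifold A' -> morph A A' (fun _ => a).
Proof.
move=> mA mA'; apply: morph_frame => //; first by move=> x; exact: cvg_cst.
move=> x c A'c dc; have [I [y [b [sy cE]]]] := manifold_frame mA' A'c dc.
by exists I, y, b; split => // k; exact: smooth_at_cst.
Qed.

Section Product.
Context (T T' : topologicalType) (V V' : normedModType K).
Context (A : set (chart T V)) (A' : set (chart T' V')).
Hypothesis mA : manifold A.
Hypothesis mA' : manifold A'.

Lemma fst_pull (x : T * T') F :
  smooth_at A x.1 F -> smooth_at (prod_atlas A A') x (F \o fst).
Proof.
move=> [U [oU Ux sF]]; exists (fst @^-1` U); split => //.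
  by apply: open_comp oU => z _; apply: cvg_fst.
move=> _ [c [c' [Ac Ac' ->]]] /=.
have cf : continuous (@fst V V') by move=> z; apply: cvg_fst.
have := @smooth_on_affine K (V * V')%type V K fst 0 _ _ cf (sF c Ac).
have -> : (fun z : V * V' => (F \o cinv c) (z.1 + 0)) =
    (F \o fst) \o (fun q => (cinv c q.1, cinv c' q.2)).
  by apply/funext => z /=; rewrite addr0.
move=> /smooth_on_sub; apply.
move=> _ [z [Uz [dz dz']] <-] /=; rewrite addr0.
by exists z.1.
Qed.

Lemma snd_pull (x : T * T') F :
  smooth_at A' x.2 F -> smooth_at (prod_atlas A A') x (F \o snd).
Proof.
move=> [U [oU Ux sF]]; exists (snd @^-1` U); split => //.
  by apply: open_comp oU => z _; apply: cvg_snd.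
move=> _ [c [c' [Ac Ac' ->]]] /=.
have cf : continuous (@snd V V') by move=> z; apply: cvg_snd.
have := @smooth_on_affine K (V * V')%type V' K snd 0 _ _ cf (sF c' Ac').
have -> : (fun z : V * V' => (F \o cinv c') (z.2 + 0)) =
    (F \o snd) \o (fun q => (cinv c q.1, cinv c' q.2)).
  by apply/funext => z /=; rewrite addr0.
move=> /smooth_on_sub; apply.
move=> _ [z [Uz [dz dz']] <-] /=; rewrite addr0.
by exists z.2.
Qed.

Lemma prod_frame (I I' : finType) (y : I -> T -> K) (y' : I' -> T' -> K)
    (b : I -> V) (b' : I' -> V') (c : chart T V) (c' : chart T' V') :
  (forall z, cmap c z = \sum_k y k z *: b k) ->
  (forall z, cmap c' z = \sum_k y' k z *: b' k) ->
  forall z : T * T', (cmap c z.1, cmap c' z.2) =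
    \sum_(k : I + I')
      match k with inl i => y i \o fst | inr i => y' i \o snd end z *:
      match k with inl i => (b i, 0) | inr i => (0, b' i) end.
Proof.
move=> cE cE' z; rewrite big_sumType /= cE cE'.
rewrite (eq_bigr (fun i => (y i z.1 *: b i, 0))); last first.
  by move=> i _; exact: (congr1 (pair (y i z.1 *: b i)) (scaler0 _ _)).
rewrite [X in _ = _ + X](eq_bigr (fun i => (0, y' i z.2 *: b' i))); last first.
  by move=> i _; exact: (congr1 (fun u => (u, y' i z.2 *: b' i)) (scaler0 _ _)).
by apply/pair_eqP; rewrite /= !raddf_sum /= !big1_eq addr0 add0r !eqxx.
Qed.

Lemma manifold_prod : manifold (prod_atlas A A').
Proof.
split.
- move=> _ [c [c' [Ac Ac' ->]]].
  have [od oi K1 cm ci] := manifold_chart mA Ac.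
  have [od' oi' K1' cm' ci'] := manifold_chart mA' Ac'.
  have imE : [set (cmap c p.1, cmap c' p.2) | p in cdom c `*` cdom c'] =
      (cmap c @` cdom c) `*` (cmap c' @` cdom c').
    apply/seteqP; split=> [_ [[x x'] [/= dx dx'] <-]|[z z'] [/= [x dx <-] [x' dx' <-]]].
      by split; [exists x|exists x'].
    by exists (x, x').
  split => /=.
  + exact: open_prod.
  + by rewrite imE; exact: open_prod.
  + by move=> [x x'] [/= dx dx']; rewrite K1 // K1'.
  + move=> [x x'] [/= dx dx']; apply: cvg_pair => /=.
      by apply: (@cvg_comp _ _ _ fst (cmap c)); [apply: cvg_fst|exact: cm].
    by apply: (@cvg_comp _ _ _ snd (cmap c')); [apply: cvg_snd|exact: cm'].
  + move=> [z z'] [[x x'] [/= dx dx'] [<- <-]].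
    have iz : (cmap c @` cdom c) (cmap c x) by exists x.
    have iz' : (cmap c' @` cdom c') (cmap c' x') by exists x'.
    apply: cvg_pair => /=.
      by apply: (@cvg_comp _ _ _ fst (cinv c)); [apply: cvg_fst|exact: ci].
    by apply: (@cvg_comp _ _ _ snd (cinv c')); [apply: cvg_snd|exact: ci'].
- move=> [x x']; have [c Ac dx] := manifold_cover mA x.
  have [c' Ac' dx'] := manifold_cover mA' x'.
  eexists; first by exists c, c'; split; last reflexivity.
  by split.
- move=> _ [x x'] [c [c' [Ac Ac' ->]]] /= [/= dx dx'].
  have [I [y [b [sy cE]]]] := manifold_frame mA Ac dx.
  have [I' [y' [b' [sy' cE']]]] := manifold_frame mA' Ac' dx'.
  eexists; eexists; eexists; split; last exact: (prod_frame cE cE').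
  by case=> k; [exact: fst_pull|exact: snd_pull].
Qed.

Lemma morph_fst : morph (prod_atlas A A') A fst.
Proof. by split=> [x|x F]; [apply: cvg_fst|exact: fst_pull]. Qed.

Lemma morph_snd : morph (prod_atlas A A') A' snd.
Proof. by split=> [x|x F]; [apply: cvg_snd|exact: snd_pull]. Qed.

End Product.

Lemma morph_pair (S T T' : topologicalType) (W V V' : normedModType K)
    (B : set (chart S W)) (A : set (chart T V)) (A' : set (chart T' V'))
    (h : S -> T) (h' : S -> T') :
  manifold B -> manifold A -> manifold A' -> morph B A h -> morph B A' h' ->
  morph B (prod_atlas A A') (fun x => (h x, h' x)).
Proof.
move=> mB mA mA' [ch sh] [ch' sh'].
apply: (morph_frame mB (manifold_prod mA mA')).
  by move=> x; apply: cvg_pair; [exact: ch|exact: ch'].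
move=> x _ [c [c' [Ac Ac' ->]]] /= [/= dx dx'].
have [I [y [b [sy cE]]]] := manifold_frame mA Ac dx.
have [I' [y' [b' [sy' cE']]]] := manifold_frame mA' Ac' dx'.
eexists; eexists; eexists; split; last exact: (prod_frame cE cE').
by case=> k; [exact: (sh x _ (sy k))|exact: (sh' x _ (sy' k))].
Qed.

End Morphisms.

Lemma ptws_continuous (S T : topologicalType) (I : eqType)
    (f : S -> {ptws I -> T}) (x : S) :
  (forall i, {for x, continuous (fun z => f z i)}) -> {for x, continuous f}.
Proof.
move=> cf; apply/cvg_sup => i Q /= [_ [[B oB <-] Bfx] BQ].
by apply: filterS BQ _; apply: (cf i); exact: open_nbhs_nbhs.
Qed.

Section Powers.
Context {K : numFieldType} (I : finType) (T : topologicalType) (d : nat).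
Context (A : set (chart T 'rV[K]_d)).
Hypothesis mA : manifold A.

Lemma eval_continuous (i : I) : continuous (fun z : {ptws I -> T} => z i).
Proof. exact: (@proj_continuous I (fun=> T) i). Qed.

Lemma chart_coord_smooth c x j : A c -> cdom c x ->
  smooth_at A x (fun z => cmap c z 0 j).
Proof.
move=> Ac dx; have [J [y [b [sy cE]]]] := manifold_frame mA Ac dx.
have -> : (fun z => cmap c z 0 j) = (fun z => \sum_k y k z * b k 0 j).
  by apply/funext => z; rewrite cE summxE; apply: eq_bigr => k _; rewrite mxE.
apply: smooth_at_sum => // k; apply: smooth_atM => //; exact: smooth_at_cst.
Qed.

Lemma eval_pull (i : I) (x : {ptws I -> T}) F :
  smooth_at A (x i) F -> smooth_at (@pow_atlas K I T d A) x (fun z => F (z i)).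
Proof.
move=> [U [oU Ux sF]]; exists ((fun z : {ptws I -> T} => z i) @^-1` U); split => //.
  by apply: open_comp oU => z _; exact: eval_continuous.
move=> _ [k Ak ->] /=.
have := @smooth_on_affine K 'M[K]_(#|I|, d) 'rV_d K (row (enum_rank i)) 0 _ _
  (@row_continuous K _ _ (enum_rank i)) (sF (k i) (Ak i)).
have -> : (fun M : 'M[K]_(#|I|, d) => (F \o cinv (k i)) (row (enum_rank i) M + 0)) =
    (fun z => F (z i)) \o (fun M i => cinv (k i) (row (enum_rank i) M)).
  by apply/funext => z /=; rewrite addr0.
move=> /smooth_on_sub; apply.
move=> _ [z [Uz dz] <-] /=; rewrite addr0.
exists (z i); first by split; [exact: Uz|exact: dz].
by apply/rowP => j; rewrite !mxE enum_rankK.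
Qed.

Lemma morph_eval (i : I) : morph (@pow_atlas K I T d A) A (fun z => z i).
Proof. by split=> [|x F]; [exact: eval_continuous|exact: eval_pull]. Qed.

Lemma pow_frame (k : I -> chart T 'rV[K]_d) (z : {ptws I -> T}) :
  cmap (pow_chart k) z = \sum_(p : 'I_#|I| * 'I_d)
    cmap (k (enum_val p.1)) (z (enum_val p.1)) 0 p.2 *: delta_mx p.1 p.2.
Proof.
rewrite [LHS]matrix_sum_delta pair_big /=; apply: eq_bigr => -[a j] _ /=.
by rewrite mxE.
Qed.

(** Finiteness of the index set makes domains and images of the product charts open: they are finite
    intersections of preimages under evaluations and rows. *)
Lemma manifold_pow : manifold (@pow_atlas K I T d A).
Proof.
have frame k (x : {ptws I -> T}) : (forall i, A (k i)) ->
    (forall i, cdom (k i) (x i)) -> forall p : 'I_#|I| * 'I_d,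
    smooth_at (@pow_atlas K I T d A) x
      (fun z => cmap (k (enum_val p.1)) (z (enum_val p.1)) 0 p.2).
  move=> Ak dx p.
  apply: (@eval_pull (enum_val p.1) x (fun z => cmap (k (enum_val p.1)) z 0 p.2)).
  exact: chart_coord_smooth.
split.
- move=> _ [k Ak ->].
  have kc i := manifold_chart mA (Ak i).
  have K1 (x : {ptws I -> T}) : (forall i, cdom (k i) (x i)) ->
      cinv (pow_chart k) (cmap (pow_chart k) x) = x.
    move=> dx; apply/funext => i /=; have [_ _ K1 _ _] := kc i.
    rewrite -[RHS]K1 //; congr (cinv _ _); apply/rowP => j.
    by rewrite !mxE enum_rankK.
  have rowE (x : {ptws I -> T}) i :
      row (enum_rank i) (cmap (pow_chart k) x) = cmap (k i) (x i).
    by apply/rowP => j; rewrite !mxE enum_rankK.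
  split.
  + rewrite openE => x dx.
    have near_dom i : \forall z \near x, cdom (k i) (z i).
      have [od _ _ _ _] := kc i.
      exact: (@eval_continuous i x (cdom (k i)) (open_nbhs_nbhs (conj od (dx i)))).
    have H : \forall z \near x, forall i, cdom (k i) (z i).
      exact: (@filter_forall _ _ (fun i (z : {ptws I -> T}) => cdom (k i) (z i))
        (nbhs x) _ near_dom).
    exact: H.
  + have -> : cmap (pow_chart k) @` cdom (pow_chart k) =
        [set M | forall i, (cmap (k i) @` cdom (k i)) (row (enum_rank i) M)].
      apply/seteqP; split=> [_ [x dx <-] i|M iM].
        by rewrite rowE; exists (x i).
      have iM' i : exists t, cdom (k i) t /\ cmap (k i) t = row (enum_rank i) M.
        by case: (iM i) => t; exists t.
      have [x xP] := choice iM'.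
      exists x => [i|]; first by case: (xP i).
      apply/row_matrixP => a; rewrite -(enum_valK a) rowE.
      by case: (xP (enum_val a)).
    rewrite openE => M iM.
    have near_im i : \forall N \near M,
        (cmap (k i) @` cdom (k i)) (row (enum_rank i) N).
      have [_ oi _ _ _] := kc i.
      exact: (@row_continuous K _ _ (enum_rank i) M (cmap (k i) @` cdom (k i))
        (open_nbhs_nbhs (conj oi (iM i)))).
    have H : \forall N \near M, forall i,
        (cmap (k i) @` cdom (k i)) (row (enum_rank i) N).
      exact: (@filter_forall _ _ (fun i (N : 'M[K]_(#|I|, d)) =>
        (cmap (k i) @` cdom (k i)) (row (enum_rank i) N)) (nbhs M) _ near_im).
    exact: H.
  + by move=> x dx; exact: K1.
  + move=> x dx.
    have -> : cmap (pow_chart k) = fun z => \sum_(p : 'I_#|I| * 'I_d)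
      cmap (k (enum_val p.1)) (z (enum_val p.1)) 0 p.2 *: delta_mx p.1 p.2.
      by apply/funext => z; exact: pow_frame.
    apply: continuous_frame => p.
    apply: (@continuous_comp _ _ _ (fun z : {ptws I -> T} => z (enum_val p.1))
      (fun z => cmap (k (enum_val p.1)) z 0 p.2)).
      exact: eval_continuous.
    exact: (smooth_at_continuous mA (chart_coord_smooth _ (Ak _) (dx _))).
  + move=> M iM; apply: ptws_continuous => i /=.
    apply: (@continuous_comp _ _ _ (row (enum_rank i)) (cinv (k i))).
      exact: row_continuous.
    have [_ _ _ _ ci] := kc i; apply: ci.
    by case: iM => x dx <-; rewrite rowE; exists (x i).
- move=> x; have cov i : exists c, A c /\ cdom c (x i).
    by case: (manifold_cover mA (x i)) => c; exists c.
  have [k kP] := choice cov.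
  exists (pow_chart k); last by move=> i; case: (kP i).
  by exists k => // i; case: (kP i).
- move=> _ x [k Ak ->] dx; eexists; eexists; eexists.
  by split; [exact: (frame k x Ak dx)|exact: pow_frame].
Qed.

Lemma morph_ptws (S : topologicalType) (W : normedModType K)
    (B : set (chart S W)) (h : S -> {ptws I -> T}) :
  manifold B -> (forall i, morph B A (fun z => h z i)) ->
  morph B (@pow_atlas K I T d A) h.
Proof.
move=> mB hm; apply: (morph_frame mB manifold_pow).
  by move=> x; apply: ptws_continuous => i; have [ch _] := hm i; exact: ch.
move=> x _ [k Ak ->] dx; eexists; eexists; eexists.
split; last exact: pow_frame.
move=> p; have [_ sh] := hm (enum_val p.1).
apply: (sh x (fun z => cmap (k (enum_val p.1)) z 0 p.2)).
exact: chart_coord_smooth.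
Qed.

End Powers.

Section RowManifolds.
Context {K : numFieldType} {d : nat}.

(** The frame consists of the coordinates of the chart itself; read in another chart they are
    coordinates of a transition map. *)
Lemma manifold_atlas (T : topologicalType) (A : set (chart T 'rV[K]_d)) :
  is_atlas A -> manifold A.
Proof.
move=> [cA covA trA]; split => // c x Ac dx.
exists 'I_d, (fun j z => cmap c z 0 j), (fun j => delta_mx 0 j).
split=> [j|z]; last exact: row_sum_delta.
have [od _ _ _ _] := cA c Ac.
exists (cdom c); split => // c' Ac'.
apply: (@smooth_on_coord _ _ _ _ _ (cmap c \o cinv c')).
  have [od' oi' K1' cm' ci'] := cA c' Ac'.
  rewrite openE => _ [z [dz dz'] <-]; rewrite /interior.
  have iz : (cmap c' @` cdom c') (cmap c' z) by exists z.
  have : \forall y \near cmap c' z, cdom c (cinv c' y).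
    by apply: (ci' _ iz); rewrite K1' //; exact: open_nbhs_nbhs.
  have : \forall y \near cmap c' z, (cmap c' @` cdom c') y.
    exact: open_nbhs_nbhs.
  by apply: filterS2 => y [t dt <-]; rewrite K1' // => dct; exists t.
by rewrite setIC; exact: trA.
Qed.

Lemma smooth_map_morph (T T' : topologicalType) (V : normedModType K)
    (A : set (chart T V)) (A' : set (chart T' 'rV[K]_d)) (h : T -> T') :
  manifold A -> manifold A' -> smooth_map A A' h -> morph A A' h.
Proof.
move=> mA mA' [ch sh]; apply: (morph_frame mA mA') => // x c A'c dc.
exists 'I_d, (fun j z => cmap c z 0 j), (fun j => delta_mx 0 j).
split=> [j|z]; last exact: row_sum_delta.
have [od _ _ _ _] := manifold_chart mA' A'c.
have oh : open (h @^-1` cdom c) by apply: open_comp od => z _; exact: ch.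
exists (h @^-1` cdom c); split => //.
move=> c' Ac'; apply: (@smooth_on_coord _ _ _ _ _ (cmap c \o h \o cinv c')).
  have H := chart_image_open mA Ac' oh. apply: H.
by rewrite setIC; exact: sh.
Qed.

End RowManifolds.

(** * Derivatives along tangent vectors of a Lie group *)

Section Slices.
Context {K : numFieldType} {V V' W : normedModType K}.

Definition inject_left (v : V) : V * V' := (v, 0).
Definition inject_right (v : V') : V * V' := (0, v).

Lemma inject_left_linear : linear inject_left.
Proof.
move=> a u v; apply: (congr1 (pair (a *: u + v))).
by rewrite /= scaler0 addr0.
Qed.
Lemma inject_right_linear : linear inject_right.
Proof.
move=> a u v; apply: (congr1 (fun w => (w, a *: u + v))).
by rewrite /= scaler0 addr0.
Qed.
HB.instance Definition _ :=
  GRing.isLinear.Build K V (V * V')%type _ inject_left inject_left_linear.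
HB.instance Definition _ :=
  GRing.isLinear.Build K V' (V * V')%type _ inject_right inject_right_linear.

Lemma inject_left_continuous : continuous inject_left.
Proof. by move=> x; apply: cvg_pair; [exact: cvg_id|exact: cvg_cst]. Qed.
Let inject_leftD (y : V) (z : V') : inject_left y + (0, z) = (y, z).
Proof. by apply/pair_eqP; rewrite /= addr0 add0r !eqxx. Qed.
Let inject_rightD (y : V) (z : V') : inject_right z + (y, 0) = (y, z).
Proof. by apply/pair_eqP; rewrite /= addr0 add0r !eqxx. Qed.

Lemma derive_slice_left (f : V * V' -> W) v y z :
  'D_v (fun y => f (y, z)) y = 'D_(v, 0) f (y, z).
Proof.
have := derive_affine inject_left (0, z) f y v.
rewrite inject_leftD => <-; congr ('D_v _ y).
by apply/funext => t; rewrite inject_leftD.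
Qed.

Lemma derive_slice_right (f : V * V' -> W) v y z :
  'D_v (fun z => f (y, z)) z = 'D_(0, v) f (y, z).
Proof.
have := derive_affine inject_right (y, 0) f z v.
rewrite inject_rightD => <-; congr ('D_v _ z).
by apply/funext => t; rewrite inject_rightD.
Qed.

Lemma smooth_on_slice_left (U : set (V * V')) (f : V * V' -> W) z :
  smooth_on U f -> smooth_on [set y | U (y, z)] (fun y => f (y, z)).
Proof.
move=> sf; have := smooth_on_affine (0, z) inject_left_continuous sf.
have -> : (fun y => f (inject_left y + (0, z))) = fun y => f (y, z).
  by apply/funext => y; rewrite inject_leftD.
have -> // : [set y | U (inject_left y + (0, z))] = [set y | U (y, z)].
by apply/seteqP; split=> y; rewrite /= inject_leftD.
Qed.

End Slices.

Section TangentDerivatives.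
Context {K : numFieldType} {d : nat} (G : lieGroupType K d).
Local Notation AG := (lie_atlas : set (chart G _)).
Local Notation c1 := (chart1 : chart G _).
Local Notation z0 := (cmap c1 1%g).
Implicit Types (f g : G -> K) (u v w : 'rV[K]_d).

Lemma manifold_lie : manifold AG.
Proof. exact: manifold_atlas lie_atlasP. Qed.

Let c1A : AG c1 := chart1_atlas.

Lemma cinv_chart1 : cinv c1 z0 = 1%g.
Proof.
have [_ _ K1 _ _] := manifold_chart manifold_lie c1A.
exact: K1 chart1_dom.
Qed.

Lemma near_cinv1 (P : G -> Prop) : (\forall h \near (1%g : G), P h) ->
  \forall y \near z0, P (cinv c1 y).
Proof.
move=> nP; have [_ _ K1 _ ci] := manifold_chart manifold_lie c1A.
have iz : (cmap c1 @` cdom c1) z0 by exists 1%g => //; exact: chart1_dom.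
by apply: (ci _ iz); rewrite cinv_chart1.
Qed.

Lemma near_cmap1 (P : 'rV[K]_d -> Prop) : (\forall y \near z0, P y) ->
  \forall h \near (1%g : G), P (cmap c1 h).
Proof.
have [_ _ _ cm _] := manifold_chart manifold_lie c1A.
exact: (cm _ chart1_dom).
Qed.

Lemma near_chart1_dom : \forall h \near (1%g : G), cdom c1 h.
Proof.
have [od _ _ _ _] := manifold_chart manifold_lie c1A.
by apply: open_nbhs_nbhs; split => //; exact: chart1_dom.
Qed.

Lemma tderive_near (W : normedModType K) v (f g : G -> W) :
  (\forall h \near 1%g, f h = g h) -> tderive v f = tderive v g.
Proof.
by move=> fg; apply: near_eq_derive; exact: (@near_cinv1 (fun h => f h = g h)).
Qed.

Lemma chart1_smooth f : smooth_at AG 1%g f ->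
  exists U, [/\ open U, U z0 & smooth_on U (f \o cinv c1)].
Proof.
move=> [U [oU U1 sf]]; exists (cmap c1 @` (U `&` cdom c1)); split.
- exact: (chart_image_open manifold_lie c1A oU).
- by exists 1%g => //; split => //; exact: chart1_dom.
- exact: sf.
Qed.

Lemma chart1_differentiable f : smooth_at AG 1%g f ->
  differentiable (f \o cinv c1) z0.
Proof.
by move=> /chart1_smooth[U [oU Uz sf]]; exact: smooth_on_differentiable sf Uz.
Qed.

Lemma tderive_linear f (a : K) u v : smooth_at AG 1%g f ->
  tderive (a *: u + v) f = a * tderive u f + tderive v f.
Proof.
move=> /chart1_differentiable df.
by rewrite /tderive !(deriveE _ df) linearP.
Qed.

Lemma tderiveD v f g : smooth_at AG 1%g f -> smooth_at AG 1%g g ->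
  tderive v (fun h => f h + g h) = tderive v f + tderive v g.
Proof.
move=> /chart1_differentiable df /chart1_differentiable dg.
exact: (deriveD (diff_derivable (v := v) df) (diff_derivable dg)).
Qed.

Lemma tderiveM v f g : smooth_at AG 1%g f -> smooth_at AG 1%g g ->
  tderive v (fun h => f h * g h) = tderive v f * g 1%g + f 1%g * tderive v g.
Proof.
move=> /chart1_differentiable df /chart1_differentiable dg.
have := deriveM (diff_derivable (v := v) df) (diff_derivable dg).
move=> /= E; apply: etrans E _.
rewrite /= cinv_chart1 addrC; congr (_ + _).
exact: mulrC.
Qed.

Lemma tderive_cst v (a : K) : tderive v (fun _ : G => a) = 0.
Proof. exact: derive_cst. Qed.

Lemma tderiveZ v (a : K) f : smooth_at AG 1%g f ->
  tderive v (fun h => a * f h) = a * tderive v f.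
Proof.
move=> sf; apply: etrans (tderiveM v (smooth_at_cst AG 1%g a) sf) _.
by rewrite tderive_cst mul0r add0r.
Qed.

Lemma tderive_sum (I : Type) (s : seq I) v (f : I -> G -> K) :
  (forall i, smooth_at AG 1%g (f i)) ->
  tderive v (fun h => \sum_(i <- s) f i h) = \sum_(i <- s) tderive v (f i).
Proof.
move=> sf; elim: s => [|i s IH].
  by under eq_fun do rewrite big_nil; rewrite tderive_cst big_nil.
under eq_fun do rewrite big_cons; rewrite big_cons -IH; apply: tderiveD => //.
exact: (smooth_at_sum manifold_lie).
Qed.

(** In a product chart the derivative along v is the partial derivative ['D_(0, v)] restricted to
    the slice through the coordinates of 1, hence smooth in the parameter. *)
Lemma tderive_smooth (T : topologicalType) (V : normedModType K)
    (A : set (chart T V)) (x : T) v (F : T * G -> K) : manifold A ->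
  smooth_at (prod_atlas A AG) (x, 1%g) F ->
  smooth_at A x (fun y => tderive v (fun h => F (y, h))).
Proof.
move=> mA [U [oU Ux sF]].
exists [set y | U (y, 1%g)]; split => //.
  apply: (@open_comp _ _ (fun y => (y, 1%g)) U) => // y _.
  by apply: cvg_pair; [exact: cvg_id|exact: cvg_cst].
move=> c Ac; have [_ _ K1 _ _] := manifold_chart mA Ac.
have pc : prod_atlas A AG (Chart (cdom c `*` cdom c1)
              (fun p => (cmap c p.1, cmap c1 p.2))
              (fun q => (cinv c q.1, cinv c1 q.2))) by exists c, c1.
have := smooth_on_slice_left z0 (smooth_on_derive (0, v) (sF _ pc)).
move=> /smooth_on_sub sD n.
have E : (fun y => tderive v (fun h => F (y, h))) \o cinv c =
    fun y => 'D_(0, v) (F \o (fun q : V * 'rV_d => (cinv c q.1, cinv c1 q.2)))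
       (y, z0).
  by apply/funext => y; rewrite /= -derive_slice_right.
rewrite E; apply: sD => _ [y [Uy dy] <-] /=.
by exists (y, 1%g) => //; split => //; split => //; exact: chart1_dom.
Qed.

Local Notation A2 := (prod_atlas AG AG).

Let c2 : chart (G * G)%type ('rV[K]_d * 'rV[K]_d)%type :=
  Chart (cdom c1 `*` cdom c1) (fun p => (cmap c1 p.1, cmap c1 p.2))
        (fun q => (cinv c1 q.1, cinv c1 q.2)).

Lemma chart11_smooth (H : G * G -> K) : smooth_at A2 (1%g, 1%g) H ->
  exists U, [/\ open U, U (z0, z0) & smooth_on U (H \o cinv c2)].
Proof.
move=> [U [oU U1 sH]]; have A2c : A2 c2 by exists c1, c1.
exists (cmap c2 @` (U `&` cdom c2)); split.
- exact: (chart_image_open (manifold_prod manifold_lie manifold_lie) A2c oU).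
- by exists (1%g, 1%g) => //; split => //; split; exact: chart1_dom.
- exact: sH.
Qed.

(** The differential of the diagonal sends v to (v, v) = (v, 0) + (0, v). This is the product rule
    for expressions in which the group variable occurs twice, such as [h * h^-1] or
    [h * k * h^-1]. *)
Lemma tderive_diag v (H : G * G -> K) : smooth_at A2 (1%g, 1%g) H ->
  tderive v (fun h => H (h, h)) =
  tderive v (fun h => H (h, 1%g)) + tderive v (fun h => H (1%g, h)).
Proof.
move=> /chart11_smooth[U [oU Uz sH]].
have dH := smooth_on_differentiable sH Uz.
have -> : tderive v (fun h => H (h, 1%g)) = 'D_(v, 0) (H \o cinv c2) (z0, z0).
  by rewrite -derive_slice_left /tderive /= cinv_chart1.
have -> : tderive v (fun h => H (1%g, h)) = 'D_(0, v) (H \o cinv c2) (z0, z0).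
  by rewrite -derive_slice_right /tderive /= cinv_chart1.
rewrite !(deriveE _ dH) -linearD.
have dd : differentiable (fun z : 'rV[K]_d => (z, z)) z0.
  by apply: differentiable_pair.
have dHd := differentiable_comp dd dH.
rewrite /tderive (_ : _ \o cinv c1 = (H \o cinv c2) \o (fun z => (z, z))) //.
rewrite (deriveE _ dHd) diff_comp //= diff_pair //=.
have -> : (v, 0) + (0, v) = (v, v) :> 'rV[K]_d * 'rV[K]_d.
  by apply/pair_eqP; rewrite /= addr0 add0r !eqxx.
by rewrite !diff_val.
Qed.

(** In the product chart both sides are mixed derivatives in the directions (v, 0) and (0, w). *)
Lemma tderive_swap v w (H : G * G -> K) : mixed_derivatives_commute K ->
  smooth_at A2 (1%g, 1%g) H ->
  tderive v (fun h => tderive w (fun k => H (h, k))) =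
  tderive w (fun k => tderive v (fun h => H (h, k))).
Proof.
move=> comm /chart11_smooth[U [oU Uz sH]].
have -> : tderive v (fun h => tderive w (fun k => H (h, k))) =
    'D_(v, 0) ('D_(0, w) (H \o cinv c2)) (z0, z0).
  apply: (etrans _ (derive_slice_left ('D_(0, w) (H \o cinv c2)) v z0 z0)).
  apply: (congr1 (fun F : 'rV[K]_d -> K => 'D_v F z0)).
  by apply/funext => y; exact: (derive_slice_right (H \o cinv c2) w y z0).
have -> : tderive w (fun k => tderive v (fun h => H (h, k))) =
    'D_(0, w) ('D_(v, 0) (H \o cinv c2)) (z0, z0).
  apply: (etrans _ (derive_slice_right ('D_(v, 0) (H \o cinv c2)) w z0 z0)).
  apply: (congr1 (fun F : 'rV[K]_d -> K => 'D_w F z0)).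
  by apply/funext => y; exact: (derive_slice_left (H \o cinv c2) v z0 y).
exact: comm oU sH Uz.
Qed.

End TangentDerivatives.

Lemma smooth_at_pull (K : numFieldType) (T T' : topologicalType)
    (V V' : normedModType K) (A : set (chart T V)) (A' : set (chart T' V'))
    (h : T -> T') x y F :
  morph A A' h -> h x = y -> smooth_at A' y F -> smooth_at A x (fun z => F (h z)).
Proof. by move=> [_ sh] <-; exact: sh. Qed.

Section LieCalculus.
Context {K : numFieldType} {d : nat} (G : lieGroupType K d).
Local Notation AG := (lie_atlas : set (chart G _)).
Local Notation c1 := (chart1 : chart G _).
Local Notation z0 := (cmap c1 1%g).
Local Notation A2 := (prod_atlas AG AG).
Hypothesis comm : mixed_derivatives_commute K.
Implicit Types (f g : G -> K) (u v w : 'rV[K]_d).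

Let mG : manifold AG := manifold_lie G.
Let mG2 : manifold A2 := manifold_prod mG mG.

Lemma morphM (T : topologicalType) (V : normedModType K)
    (B : set (chart T V)) (h h' : T -> G) : manifold B ->
  morph B AG h -> morph B AG h' -> morph B AG (fun x => (h x * h' x)%g).
Proof.
move=> mB mh mh'; have := smooth_map_morph mG2 mG lie_mulP.
exact: (morph_comp (morph_pair mB mG mG mh mh')).
Qed.

Lemma morphV (T : topologicalType) (V : normedModType K)
    (B : set (chart T V)) (h : T -> G) :
  morph B AG h -> morph B AG (fun x => (h x)^-1%g).
Proof. by move=> mh; exact: morph_comp mh (smooth_map_morph mG mG lie_invP). Qed.

Lemma morph_conj (m : G) : morph AG AG (fun h => (m * h * m^-1)%g).
Proof.
by apply: morphM => //; [apply: morphM => //|]; 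
  [exact: morph_cst|exact: morph_id|exact: morph_cst].
Qed.

Lemma smooth_mul f : smooth_at AG 1%g f ->
  smooth_at A2 (1%g, 1%g) (fun p => f (p.1 * p.2)%g).
Proof.
apply: smooth_at_pull; last exact: mulg1.
exact: (smooth_map_morph mG2 mG lie_mulP).
Qed.

(** Differentiation of the constant [f (h * h^-1)] by [tderive_diag]. *)
Lemma tderive_inv v f : smooth_at AG 1%g f ->
  tderive v (fun h => f h^-1%g) = - tderive v f.
Proof.
move=> sf.
have sH : smooth_at A2 (1%g, 1%g) (fun p => f (p.1 * p.2^-1)%g).
  apply: (smooth_at_pull (A' := AG) (y := 1%g)) sf; last by rewrite /= invg1 mulg1.
  apply: morphM => //; first exact: morph_fst.
  by apply: morphV; exact: morph_snd.
have := tderive_diag v sH; rewrite /=.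
have -> : (fun h => f (h * h^-1)%g) = fun _ => f 1%g.
  by apply/funext => h; rewrite mulgV.
have -> : (fun h => f (h * 1^-1)%g) = f.
  by apply/funext => h; rewrite invg1 mulg1.
have -> : (fun h => f (1 * h^-1)%g) = fun h => f h^-1%g.
  by apply/funext => h; rewrite mul1g.
by rewrite tderive_cst => /esym/eqP; rewrite addrC addr_eq0 => /eqP.
Qed.

Definition chart1_coord (j : 'I_d) : G -> K := fun h => cmap c1 h 0 j.
Local Notation x_ := chart1_coord.

Lemma chart1_coord_smooth j : smooth_at AG 1%g (x_ j).
Proof. exact: (chart_coord_smooth mG j chart1_atlas chart1_dom). Qed.

Lemma tderive_coord v (F : G -> 'rV[K]_d) j :
  (forall j, smooth_at AG 1%g (fun h => F h 0 j)) ->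
  tderive v F 0 j = tderive v (fun h => F h 0 j).
Proof.
move=> sF.
have dF j' := chart1_differentiable (sF j').
have E : F \o cinv c1 = fun z => \sum_j F (cinv c1 z) 0 j *: delta_mx 0 j.
  by apply/funext => z; exact: row_sum_delta.
have := @derive_frame K 'rV_d 'rV_d 'I_d (fun j z => F (cinv c1 z) 0 j)
  (fun j => delta_mx 0 j) z0 v dF.
rewrite -E => E'.
have -> : tderive v F = \sum_i tderive v (fun h => F h 0 i) *: delta_mx 0 i by [].
rewrite summxE (bigD1 j) //= big1 => [|i ij].
  by rewrite !mxE !eqxx mulr1 addr0.
by rewrite !mxE eq_sym (negbTE ij) andbF mulr0.
Qed.

Lemma tderive_chart1_coord v j : tderive v (x_ j) = v 0 j.
Proof.
rewrite -(@tderive_coord v (cmap c1) j) => [|i]; last exact: chart1_coord_smooth.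
have [od oi K1 cm ci] := manifold_chart mG chart1_atlas.
suff -> : tderive v (cmap c1) = v by [].
have : \forall z \near z0, (cmap c1 \o cinv c1) z = z.
  have iz : (cmap c1 @` cdom c1) z0 by exists 1%g => //; exact: chart1_dom.
  have : \forall z \near z0, (cmap c1 @` cdom c1) z by exact: open_nbhs_nbhs.
  by apply: filterS => _ [h dh <-] /=; rewrite K1.
move=> nE; have E := @near_eq_derive K _ _ (cmap c1 \o cinv c1) id z0 v nE.
exact: etrans E (derive_id z0 v).
Qed.

(** The coordinates of [chart1] separate tangent vectors. Identities between vectors, such as those
    for [Ad] and the bracket, can thus be checked as identities between derivations. *)
Lemma tangent_eq u v :
  (forall f, smooth_at AG 1%g f -> tderive u f = tderive v f) -> u = v.
Proof.
move=> uv; apply/rowP => j; rewrite -!tderive_chart1_coord.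
exact/uv/chart1_coord_smooth.
Qed.

Lemma chart1_frame h : cmap c1 h = \sum_j x_ j h *: delta_mx 0 j.
Proof. exact: row_sum_delta. Qed.

Lemma tderive_coords u f : smooth_at AG 1%g f ->
  tderive u f = \sum_j u 0 j * tderive (delta_mx 0 j) f.
Proof.
move=> /chart1_differentiable df.
rewrite /tderive {1}(row_sum_delta u) (deriveE _ df) linear_sum.
by apply: eq_bigr => j _; rewrite linearZ /= -deriveE.
Qed.

Lemma tderive_comp_coords (F : G -> G) (m : G) f v : F 1%g = m ->
  (forall j, differentiable (x_ j \o F \o cinv c1) z0) ->
  (\forall h \near (1%g : G), cdom c1 (F h)) ->
  differentiable (f \o cinv c1) (cmap c1 m) ->
  tderive v (f \o F) = \sum_j tderive v (x_ j \o F) *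
    'D_(delta_mx 0 j) (f \o cinv c1) (cmap c1 m).
Proof.
move=> <- dF nF df; have [_ _ K1 _ _] := manifold_chart mG chart1_atlas.
have E : cmap c1 (F 1%g) =
    \sum_j (x_ j \o F \o cinv c1) z0 *: delta_mx 0 j.
  by rewrite {1}chart1_frame /= cinv_chart1.
rewrite E in df *.
apply: etrans _ (derive_comp_frame v dF df).
apply: near_eq_derive.
have := near_cinv1 nF; apply: filterS => z dz /=.
by rewrite -chart1_frame K1.
Qed.

(** A map fixing 1 pushes v forward to its derivative in the chart; for conjugation this vector is
    [Ad m v]. *)
Lemma tderive_chain f (F : G -> G) v : smooth_at AG 1%g f ->
  morph AG AG F -> F 1%g = 1%g ->
  tderive v (f \o F) = tderive (tderive v (cmap c1 \o F)) f.
Proof.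
move=> sf mF F1.
have sx j : smooth_at AG 1%g (x_ j \o F).
  exact: smooth_at_pull mF F1 (chart1_coord_smooth j).
rewrite (tderive_comp_coords v F1) => [|j||].
- rewrite (tderive_coords _ sf); apply: eq_bigr => j _.
  by rewrite tderive_coord.
- exact: chart1_differentiable.
- have [cF _] := mF; apply: (cF 1%g); rewrite F1; exact: near_chart1_dom.
- exact: chart1_differentiable.
Qed.

End LieCalculus.

(** * The Lie bracket as a commutator of derivations *)

Section LieBracket.
Context {K : numFieldType} {d : nat} (G : lieGroupType K d).
Local Notation AG := (lie_atlas : set (chart G _)).
Local Notation c1 := (chart1 : chart G _).
Local Notation z0 := (cmap c1 1%g).
Local Notation A2 := (prod_atlas AG AG).
Local Notation x_ := (chart1_coord (G := G)).
Hypothesis comm : mixed_derivatives_commute K.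
Implicit Types (f g : G -> K) (u v w : 'rV[K]_d).

Let mG : manifold AG := manifold_lie G.
Let mG2 : manifold A2 := manifold_prod mG mG.

Lemma near_smooth_mull f : smooth_at AG 1%g f ->
  \forall h \near (1%g : G), smooth_at AG 1%g (fun k => f (h * k)%g).
Proof.
move=> /smooth_at_near; apply: filterS => h sf.
apply: smooth_at_pull (mulg1 h) sf.
by apply: morphM => //; [exact: morph_cst|exact: morph_id].
Qed.

Lemma tderive_mul_smooth w f : smooth_at AG 1%g f ->
  smooth_at AG 1%g (fun h => tderive w (fun k => f (h * k)%g)).
Proof.
move=> sf.
exact: (@tderive_smooth K d G G _ AG 1%g w (fun p => f (p.1 * p.2)%g) mG
  (smooth_mul sf)).
Qed.

Let twice v w f := tderive v (fun h : G => tderive w (fun k : G => f (h * k)%g)).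

Lemma lie_bracket_coord v w j :
  lie_bracket G v w 0 j = twice v w (x_ j) - twice w v (x_ j).
Proof.
have step a b : left_inv a (left_inv b (cmap c1)) 1%g 0 j = twice a b (x_ j).
  have E i : \forall h \near (1%g : G), left_inv b (cmap c1) (1 * h)%g 0 i =
      tderive b (fun k => x_ i (h * k)%g).
    have N : \forall h \near (1%g : G), forall i',
        smooth_at AG 1%g (fun k => x_ i' (h * k)%g).
      exact: (@filter_forall _ _
        (fun i' h => smooth_at AG 1%g (fun k => x_ i' (h * k)%g)) (nbhs 1%g) _
        (fun i' => near_smooth_mull (chart1_coord_smooth G i'))).
    apply: filterS N => h sx; rewrite mul1g.
    exact: (@tderive_coord K d G b (fun k => cmap c1 (h * k)%g) i sx).
  have S i : smooth_at AG 1%g (fun h => left_inv b (cmap c1) (1 * h)%g 0 i).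
    have E' : \forall h \near (1%g : G), tderive b (fun k => x_ i (h * k)%g) =
        left_inv b (cmap c1) (1 * h)%g 0 i.
      by apply: filterS (E i) => h Eh; exact: esym Eh.
    exact: (smooth_at_congr mG E'
      (tderive_mul_smooth b (chart1_coord_smooth G i))).
  apply: etrans (@tderive_coord K d G a
    (fun h => left_inv b (cmap c1) (1 * h)%g) j S) _.
  exact: tderive_near (E j).
have subE (p q : 'rV[K]_d) : (p - q) 0 j = p 0 j - q 0 j by rewrite !mxE.
exact: etrans (subE _ _) (congr2 (fun p q => p - q) (step v w) (step w v)).
Qed.

(** The bracket is defined by its action on the coordinates of one chart only. For a general f the
    chain rule gives [twice a c f] as the sum of [twice a c (x_ j)] times the partial derivatives of
    f, plus a second derivative ['D_c ('D_a Phi)]; the latter is symmetric and drops out of the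
    commutator. *)
Lemma tderive_lie_bracket v w f : smooth_at AG 1%g f ->
  twice v w f - twice w v f = tderive (lie_bracket G v w) f.
Proof.
move=> sf; have [U [oU Uz sPhi]] := chart1_smooth sf.
set Phi := f \o cinv c1 in sPhi.
pose b j : 'rV[K]_d := delta_mx 0 j.
pose D j : G -> K := fun h => 'D_(b j) Phi (cmap c1 h).
have sD j : smooth_at AG 1%g (D j).
  have E : D j = fun h => 'D_(b j) Phi (\sum_i x_ i h *: delta_mx 0 i).
    by apply/funext => h; rewrite /D chart1_frame.
  rewrite E; apply: (smooth_at_comp mG oU _ (smooth_on_derive (b j) sPhi)).
    by rewrite -chart1_frame.
  by move=> k; exact: chart1_coord_smooth.
have first a : \forall h \near (1%g : G), tderive a (fun k => f (h * k)%g) =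
    \sum_j tderive a (fun k => x_ j (h * k)%g) * D j h.
  have N1 : \forall h \near (1%g : G), forall i',
      smooth_at AG 1%g (fun k => x_ i' (h * k)%g).
    exact: (@filter_forall _ _
      (fun i' h => smooth_at AG 1%g (fun k => x_ i' (h * k)%g)) (nbhs 1%g) _
      (fun i' => near_smooth_mull (chart1_coord_smooth G i'))).
  have N2 : \forall h \near (1%g : G), U (cmap c1 h).
    by apply: near_cmap1; exact: open_nbhs_nbhs.
  have N3 : \forall h \near (1%g : G), cdom c1 h by exact: near_chart1_dom.
  have [od _ _ _ _] := manifold_chart mG chart1_atlas.
  apply: filterS3 N1 N2 N3 => h sx Uh dh.
  have [cm _] : morph AG AG (fun k => (h * k)%g).
    by apply: morphM => //; [exact: morph_cst|exact: morph_id].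
  apply: (@tderive_comp_coords K d G (fun k => (h * k)%g) h f a (mulg1 h)).
  - by move=> j; exact: (chart1_differentiable (sx j)).
  - by apply: (cm 1%g); rewrite mulg1; exact: open_nbhs_nbhs.
  - exact: smooth_on_differentiable sPhi Uh.
have sW a j : smooth_at AG 1%g (fun h => tderive a (fun k => x_ j (h * k)%g)).
  exact/tderive_mul_smooth/chart1_coord_smooth.
have second a c : twice a c f =
    \sum_j (twice a c (x_ j) * D j 1%g + c 0 j * 'D_a ('D_(b j) Phi) z0).
  apply: etrans (tderive_near a (first c)) _.
  apply: etrans (tderive_sum _ _ (fun j => smooth_atM mG (sW c j) (sD j))) _.
  apply: eq_bigr => j _.
  have EM := tderiveM a (sW c j) (sD j).
  refine (etrans EM _); clear EM.
  have W1 : tderive c (fun k => x_ j (1 * k)%g) = c 0 j.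
    apply: etrans _ (tderive_chart1_coord G c j).
    by apply: (congr1 (tderive c)); apply/funext => k; rewrite mul1g.
  apply: (congr2 (fun p q => _ + p * q) W1).
  apply: near_eq_derive.
  have [od oi K1 cm ci] := manifold_chart mG chart1_atlas.
  have iz : (cmap c1 @` cdom c1) z0 by exists 1%g => //; exact: chart1_dom.
  have : \forall z \near z0, (cmap c1 @` cdom c1) z by exact: open_nbhs_nbhs.
  by apply: filterS => _ [h dh <-]; rewrite /D /= K1.
(* Symmetry of second derivatives moves ['D_a] inside, after which the sum over coordinates
   reassembles the direction c. *)
have sym (a c : 'rV[K]_d) : \sum_j c 0 j * 'D_a ('D_(b j) Phi) z0 = 'D_c ('D_a Phi) z0.
  have dD := smooth_on_differentiable (smooth_on_derive a sPhi) Uz.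
  have E : 'D_c ('D_a Phi) z0 = \sum_j c 0 j * 'D_(b j) ('D_a Phi) z0.
    rewrite {1}(row_sum_delta c) (deriveE _ dD) linear_sum.
    by apply: eq_bigr => j _; rewrite linearZ /= -deriveE.
  apply: etrans _ (esym E); apply: eq_bigr => j _; apply: congr1.
  exact: comm oU sPhi Uz.
have fin (a c : 'rV[K]_d) : twice a c f = \sum_j twice a c (x_ j) * D j 1%g + 'D_c ('D_a Phi) z0.
  by apply: etrans (second a c) _; rewrite big_split /= sym.
have symF : 'D_v ('D_w Phi) z0 = 'D_w ('D_v Phi) z0 by exact: comm oU sPhi Uz.
have calc (p q r r' : K) : r = r' -> p + r' - (q + r) = p - q.
  by move=> ->; rewrite opprD addrACA subrr addr0.
apply: etrans (congr2 (fun p q => p - q) (fin v w) (fin w v)) _.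
apply: etrans (calc _ _ _ _ symF) _.
apply: etrans _ (esym (tderive_coords _ sf)).
rewrite -sumrB; apply: eq_bigr => j _.
by rewrite lie_bracket_coord mulrBl.
Qed.

End LieBracket.

(** * The adjoint action and the invariance of the form *)

Section AdjointAction.
Context {K : numFieldType} {d : nat} (G : lieGroupType K d).
Local Notation AG := (lie_atlas : set (chart G _)).
Local Notation c1 := (chart1 : chart G _).
Local Notation A2 := (prod_atlas AG AG).
Local Notation x_ := (chart1_coord (G := G)).
Local Notation br := (lie_bracket G).
Hypothesis comm : mixed_derivatives_commute K.
Implicit Types (f g : G -> K) (u v w : 'rV[K]_d) (m : G).

Let mG : manifold AG := manifold_lie G.
Let mG2 : manifold A2 := manifold_prod mG mG.

Let twice v w f := tderive v (fun h : G => tderive w (fun k : G => f (h * k)%g)).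

Lemma conj_smooth m f : smooth_at AG 1%g f ->
  smooth_at AG 1%g (fun h => f (m * h * m^-1)%g).
Proof. by apply: smooth_at_pull (morph_conj m) _; rewrite mulg1 mulgV. Qed.

Lemma tderive_conj m v f : smooth_at AG 1%g f ->
  tderive v (fun h => f (m * h * m^-1)%g) = tderive (Ad m v) f.
Proof.
move=> sf; apply: (tderive_chain v sf (morph_conj m)).
by rewrite mulg1 mulgV.
Qed.

Lemma Ad1 v : Ad (1%g : G) v = v.
Proof.
apply: (@tangent_eq _ _ G) => f sf; rewrite -tderive_conj //.
by congr tderive; apply/funext => h; rewrite mul1g invg1 mulg1.
Qed.

Lemma Ad_linear m (a : K) v w : Ad m (a *: v + w) = a *: Ad m v + Ad m w.
Proof.
apply: (@tangent_eq _ _ G) => f sf; have sc := conj_smooth m sf.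
by rewrite tderive_linear // -!tderive_conj // tderive_linear.
Qed.

Lemma lie_bracket_antisym v w : br v w = - br w v.
Proof. by rewrite /lie_bracket opprB. Qed.

Lemma lie_bracket_linearl (a : K) u v w :
  br (a *: u + v) w = a *: br u w + br v w.
Proof.
apply: (@tangent_eq _ _ G) => f sf; have sT := tderive_mul_smooth _ sf.
apply: etrans (esym (tderive_lie_bracket comm _ _ sf)) _.
rewrite (tderive_linear a u v (sT w)).
have E : tderive w (fun h : G => tderive (a *: u + v) (fun k : G => f (h * k)%g)) =
    a * twice w u f + twice w v f.
  apply: (@etrans _ _ (tderive w (fun h : G =>
    a * tderive u (fun k => f (h * k)%g) + tderive v (fun k => f (h * k)%g)))).
    apply: tderive_near; have := near_smooth_mull sf.
    by apply: filterS => h sh; exact: tderive_linear.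
  apply: etrans (tderiveD w (smooth_atM mG (smooth_at_cst AG _ a) (sT u)) (sT v)) _.
  by apply: (congr1 (fun p => p + _)); exact: tderiveZ (sT u).
apply: etrans (congr1 (fun p => _ - p) E) _.
apply: etrans _ (esym (tderive_linear a (br u w) (br v w) sf)).
have calc (p q r s : K) : a * p + q - (a * r + s) = a * (p - r) + (q - s) by ring.
apply: etrans (calc _ _ _ _) _.
exact: (congr2 (fun p q => a * p + q) (tderive_lie_bracket comm u w sf)
  (tderive_lie_bracket comm v w sf)).
Qed.

(** Conjugation by m is a group automorphism, so it carries [twice a b] to
    [twice (Ad m a) (Ad m b)]. *)
Lemma Ad_lie_bracket m v w : Ad m (br v w) = br (Ad m v) (Ad m w).
Proof.
have half a b f : smooth_at AG 1%g f ->
    twice a b (fun h => f (m * h * m^-1)%g) = twice (Ad m a) (Ad m b) f.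
  move=> sf.
  have sg := tderive_mul_smooth (Ad m b) sf.
  apply: etrans _ (tderive_conj m a sg).
  apply: tderive_near.
  have N : \forall h \near (1%g : G),
      smooth_at AG 1%g (fun k => f (m * h * m^-1 * k)%g).
    have [cm _] := morph_conj m.
    have := near_smooth_mull sf.
    rewrite -{1}(mulgV m) -{1}(mulg1 m) => Nf.
    exact: (cm 1%g _ Nf).
  apply: filterS N => h sh; apply: etrans _ (tderive_conj m b sh).
  apply: (congr1 (tderive b)); apply/funext => k; congr f.
  by rewrite !mulgA mulgVK.
apply: (@tangent_eq _ _ G) => f sf.
apply: etrans (esym (tderive_conj m _ sf)) _.
apply: etrans (esym (tderive_lie_bracket comm _ _ (conj_smooth m sf))) _.
apply: etrans _ (tderive_lie_bracket comm _ _ sf).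
exact: (congr2 (fun p q => p - q) (half v w f sf) (half w v f sf)).
Qed.

(** The derivative of Ad at 1 is ad, in weak form: after the two derivatives are exchanged, the one
    in h acts on both outer factors of [h * k * h^-1] and produces the two halves of the
    commutator. *)
Lemma tderive_conj_orbit x u f : smooth_at AG 1%g f ->
  smooth_at AG 1%g (fun h : G => tderive u (fun k => f (h * k * h^-1)%g)) /\
  tderive x (fun h : G => tderive u (fun k => f (h * k * h^-1)%g)) =
  tderive (br x u) f.
Proof.
move=> sf.
have sH : smooth_at A2 (1%g, 1%g) (fun p => f (p.1 * p.2 * p.1^-1)%g).
  apply: (smooth_at_pull (A' := AG) (y := 1%g)) sf.
    apply: morphM => //; [apply: morphM => //|apply: morphV];
      by [exact: morph_fst|exact: morph_snd].
  by rewrite /= mulg1 invg1 mulg1.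
split; first exact: (@tderive_smooth K d G G _ AG 1%g u
  (fun p => f (p.1 * p.2 * p.1^-1)%g) mG sH).
apply: etrans (tderive_swap x u comm sH) _ => /=.
have sA : smooth_at AG 1%g (fun k => tderive x (fun h => f (h * k)%g)).
  apply: (@tderive_smooth K d G G _ AG 1%g x (fun p => f (p.2 * p.1)%g) mG).
  apply: (smooth_at_pull (A' := AG) (y := 1%g)) sf; last by rewrite /= mulg1.
  by apply: morphM => //; [exact: morph_snd|exact: morph_fst].
have sB := tderive_mul_smooth x sf.
(* For fixed k the derivative in h is split by [tderive_diag]; the factor [h^-1] contributes with a
   minus sign, after which h stands on the right of k. *)
have E : \forall k \near (1%g : G), tderive x (fun h => f (h * k * h^-1)%g) =
    tderive x (fun h => f (h * k)%g) + -1 * tderive x (fun h => f (k * h)%g).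
  have N : \forall k \near (1%g : G), smooth_at AG k f by exact: smooth_at_near.
  apply: filterS N => k sfk.
  have s2 : smooth_at A2 (1%g, 1%g) (fun p => f (p.1 * k * p.2^-1)%g).
    apply: (smooth_at_pull (A' := AG) (y := k)) sfk.
      apply: morphM => //; last by apply: morphV; exact: morph_snd.
      by apply: morphM => //; [exact: morph_fst|exact: morph_cst].
    by rewrite /= mul1g invg1 mulg1.
  have s1 : smooth_at AG 1%g (fun h => f (k * h)%g).
    apply: (smooth_at_pull (A' := AG) (y := k)) sfk; last exact: mulg1.
    by apply: morphM => //; [exact: morph_cst|exact: morph_id].
  apply: etrans (tderive_diag x s2) _ => /=.
  have E1 : tderive x (fun h => f (h * k * 1^-1)%g) =
      tderive x (fun h => f (h * k)%g).
    by apply: (congr1 (tderive x)); apply/funext => h; rewrite invg1 mulg1.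
  have E2 : tderive x (fun h => f (1 * k * h^-1)%g) =
      -1 * tderive x (fun h => f (k * h)%g).
    rewrite mulN1r; apply: etrans _ (tderive_inv x s1).
    by apply: (congr1 (tderive x)); apply/funext => h; rewrite mul1g.
  exact: (congr2 (fun p q => p + q) E1 E2).
apply: etrans (tderive_near u E) _.
apply: etrans (tderiveD u sA (smooth_atM mG (smooth_at_cst AG _ (-1)) sB)) _.
apply: etrans _ (tderive_lie_bracket comm x u sf).
apply: congr2; last by apply: etrans (tderiveZ u (-1) sB) _; rewrite mulN1r.
exact: (esym (tderive_swap x u comm (smooth_mul sf))).
Qed.

Lemma Ad_coord h u j :
  Ad h u 0 j = tderive u (fun k : G => x_ j (h * k * h^-1)%g).
Proof.
apply: (@tderive_coord K d G u (fun k => cmap c1 (h * k * h^-1)%g) j) => i.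
exact: (conj_smooth h (chart1_coord_smooth G i)).
Qed.

Lemma tderive_Ad x u j :
  smooth_at AG 1%g (fun h => Ad h u 0 j) /\
  tderive x (fun h : G => Ad h u 0 j) = br x u 0 j.
Proof.
have -> : (fun h : G => Ad h u 0 j) =
    fun h => tderive u (fun k => x_ j (h * k * h^-1)%g).
  by apply/funext => h; exact: Ad_coord.
have [s E] := tderive_conj_orbit x u (chart1_coord_smooth G j).
by split=> //; apply: etrans E (tderive_chart1_coord G _ j).
Qed.

Section InvariantForm.
Variable Q : 'M[K]_d.
Hypothesis invQ : nondegenerate_invariant G Q.

Lemma bformE u v : bform Q u v = \sum_i \sum_j (u 0 i * Q i j) * v 0 j.
Proof.
rewrite /bform mxE exchange_big /=; apply: eq_bigr => j _.
by rewrite !mxE mulr_suml.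
Qed.

Lemma bform_linearl (a : K) u v w :
  bform Q (a *: u + v) w = a * bform Q u w + bform Q v w.
Proof. by rewrite /bform !mulmxDl -!scalemxAl !mxE. Qed.

Lemma bformC u v : bform Q u v = bform Q v u.
Proof.
have [QT _ _] := invQ.
rewrite /bform -[in LHS](trmxK (u *m Q *m v^T)) mxE.
by rewrite !trmx_mul trmxK QT mulmxA.
Qed.

Lemma bform_linearr (a : K) u v w :
  bform Q w (a *: u + v) = a * bform Q w u + bform Q w v.
Proof. by rewrite !(bformC w) bform_linearl. Qed.

(** Polarization: invariance is assumed for the quadratic form, and 2 is cancelled in characteristic
    0. *)
Lemma bform_Ad m u v : bform Q (Ad m u) (Ad m v) = bform Q u v.
Proof.
have [_ _ inv] := invQ.
have := inv m (1 *: u + v); rewrite Ad_linear !bform_linearl !bform_linearr !inv.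
rewrite !mul1r (bformC v) (bformC (Ad m v)).
rewrite !addrA => /addIr; rewrite -!addrA => /addrI.
rewrite -!mulr2n => /eqP; rewrite -subr_eq0 -mulrnBl -mulr_natl mulf_eq0.
by rewrite pnatr_eq0 /= subr_eq0 => /eqP.
Qed.

(** Derivative at h = 1 of the constant function [bform Q (Ad h u) (Ad h w)]. *)
Lemma bform_ad_invariant x u w : bform Q (br x u) w + bform Q u (br x w) = 0.
Proof.
have E : tderive x (fun h : G => bform Q (Ad h u) (Ad h w)) = 0.
  have -> : (fun h : G => bform Q (Ad h u) (Ad h w)) = fun=> bform Q u w.
    by apply/funext => h; exact: bform_Ad.
  exact: tderive_cst.
have sA v i := (tderive_Ad x v i).1; have dA v i := (tderive_Ad x v i).2.
have s1 i j : smooth_at AG 1%g (fun h => Ad h u 0 i * Q i j).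
  by apply: smooth_atM => //; exact: smooth_at_cst.
have F : tderive x (fun h : G => bform Q (Ad h u) (Ad h w)) =
    \sum_i \sum_j ((br x u 0 i * Q i j) * w 0 j + (u 0 i * Q i j) * br x w 0 j).
  have -> : (fun h : G => bform Q (Ad h u) (Ad h w)) =
      fun h => \sum_i \sum_j (Ad h u 0 i * Q i j) * Ad h w 0 j.
    by apply/funext => h; exact: bformE.
  have s2 i j := smooth_atM mG (s1 i j) (sA w j).
  apply: etrans (tderive_sum _ _ (fun i => smooth_at_sum mG _ (s2 i))) _.
  apply: eq_bigr => i _; apply: etrans (tderive_sum _ _ (s2 i)) _.
  apply: eq_bigr => j _; apply: etrans (tderiveM x (s1 i j) (sA w j)) _.
  have E1 : tderive x (fun h : G => Ad h u 0 i * Q i j) = br x u 0 i * Q i j.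
    apply: etrans (tderiveM x (sA u i) (smooth_at_cst AG _ (Q i j))) _.
    by rewrite tderive_cst mulr0 addr0; apply: (congr1 (fun p => p * _)); exact: dA.
  apply: congr2; last by rewrite Ad1; apply: congr1; exact: dA.
  by rewrite Ad1; exact: (congr1 (fun p => p * w 0 j) E1).
apply: etrans _ (etrans (esym F) E).
rewrite !bformE -big_split /=; apply: eq_bigr => i _.
by rewrite big_split.
Qed.

End InvariantForm.
End AdjointAction.

(** * The invariant three-form and the Yang-Baxter equation *)

Section InvariantTrilinear.
Context {K : numFieldType} {d : nat} (G : lieGroupType K d).
Local Notation AG := (lie_atlas : set (chart G _)).
Local Notation br := (lie_bracket G).
Hypothesis comm : mixed_derivatives_commute K.
Variable Q : 'M[K]_d.
Hypothesis invQ : nondegenerate_invariant G Q.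
Local Notation B := (bform Q).
Implicit Types (u v w : 'rV[K]_d) (m : G).

Lemma Ad_mul m m' v : Ad (m * m')%g v = Ad m (Ad m' v).
Proof.
apply: (@tangent_eq _ _ G) => f sf.
apply: etrans (esym (tderive_conj (m * m')%g v sf)) _.
apply: etrans _ (tderive_conj m _ sf).
apply: etrans _ (tderive_conj m' _ (conj_smooth m sf)).
by apply: (congr1 (tderive v)); apply/funext => h; rewrite invgM !mulgA.
Qed.

Lemma AdK m : cancel (Ad m) (Ad m^-1%g).
Proof. by move=> v; rewrite -Ad_mul mulVg Ad1. Qed.

Lemma bform_Ad_adjoint m u v : B (Ad m u) v = B u (Ad m^-1%g v).
Proof. by rewrite -(bform_Ad invQ m^-1%g) AdK. Qed.

(** The Cartan three-form. It is alternating and invariant under [Ad]; all Jacobi obstructions are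
    expressed through it. *)
Definition tri u v w : K := B (br u v) w.

Lemma tri_linear1 (a : K) u u' v w :
  tri (a *: u + u') v w = a * tri u v w + tri u' v w.
Proof. by rewrite /tri (lie_bracket_linearl G comm) bform_linearl. Qed.

Lemma tri_linear3 (a : K) u v w w' :
  tri u v (a *: w + w') = a * tri u v w + tri u v w'.
Proof. by rewrite /tri (bform_linearr invQ). Qed.

Lemma triC12 u v w : tri u v w = - tri v u w.
Proof.
rewrite /tri lie_bracket_antisym -scaleN1r -[_ *: _]addr0 bform_linearl mulN1r.
by rewrite {2}/bform mul0mx mul0mx mxE addr0.
Qed.

Lemma triC23 u v w : tri u v w = - tri u w v.
Proof.
apply/eqP; rewrite -addr_eq0 /tri [X in _ + X](bformC invQ).
by rewrite (bform_ad_invariant comm invQ).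
Qed.

Lemma tri_cycle u v w : tri u v w = tri v w u.
Proof. by rewrite triC12 triC23 opprK. Qed.

(** The left side is what the commutator terms of a Jacobi sum produce, with primes for Hamiltonian
    components; the right side has the arguments in the fixed order used by the Yang-Baxter
    equation. *)
Lemma tri_nested_terms u v w u' v' w' :
  - tri u' w' v + - tri v' u' w + - tri w' v' u =
  tri u v' w' + tri u' v w' + tri u' v' w.
Proof.
rewrite (triC23 u' w' v) (triC12 v' u' w) (triC12 w' v' u) (tri_cycle u v' w').
by move: tri => t; ring.
Qed.

Lemma tri_linear2 (a : K) u v v' w :
  tri u (a *: v + v') w = a * tri u v w + tri u v' w.
Proof. by rewrite tri_cycle tri_linear1 -!(tri_cycle u). Qed.

Lemma triD1 u u' v w : tri (u + u') v w = tri u v w + tri u' v w.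
Proof. by rewrite -[u]scale1r tri_linear1 mul1r scale1r. Qed.
Lemma triD2 u v v' w : tri u (v + v') w = tri u v w + tri u v' w.
Proof. by rewrite -[v]scale1r tri_linear2 mul1r scale1r. Qed.
Lemma triD3 u v w w' : tri u v (w + w') = tri u v w + tri u v w'.
Proof. by rewrite -[w]scale1r tri_linear3 mul1r scale1r. Qed.

Lemma tri01 v w : tri 0 v w = 0.
Proof. by apply: (addrI (tri 0 v w)); rewrite -triD1 !addr0. Qed.
Lemma triZ1 a u v w : tri (a *: u) v w = a * tri u v w.
Proof. by rewrite -[a *: u]addr0 tri_linear1 tri01 addr0. Qed.
Lemma triZ2 a u v w : tri u (a *: v) w = a * tri u v w.
Proof. by rewrite tri_cycle triZ1 -tri_cycle. Qed.
Lemma triZ3 a u v w : tri u v (a *: w) = a * tri u v w.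
Proof. by rewrite -tri_cycle triZ1 tri_cycle. Qed.

Lemma triN1 u v w : tri (- u) v w = - tri u v w.
Proof. by rewrite -scaleN1r triZ1 mulN1r. Qed.
Lemma triN2 u v w : tri u (- v) w = - tri u v w.
Proof. by rewrite -scaleN1r triZ2 mulN1r. Qed.
Lemma triN3 u v w : tri u v (- w) = - tri u v w.
Proof. by rewrite -scaleN1r triZ3 mulN1r. Qed.

Lemma tri_sum1 (I : Type) (s : seq I) (P : pred I) (x : I -> 'rV[K]_d) v w :
  tri (\sum_(i <- s | P i) x i) v w = \sum_(i <- s | P i) tri (x i) v w.
Proof.
apply: (big_morph (fun u => tri u v w)); last exact: tri01.
by move=> u u'; exact: triD1.
Qed.
Lemma tri_sum2 (I : Type) (s : seq I) (P : pred I) (x : I -> 'rV[K]_d) v w :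
  tri w (\sum_(i <- s | P i) x i) v = \sum_(i <- s | P i) tri w (x i) v.
Proof. by rewrite tri_cycle tri_sum1; apply: eq_bigr => i _; rewrite -tri_cycle. Qed.
Lemma tri_sum3 (I : Type) (s : seq I) (P : pred I) (x : I -> 'rV[K]_d) v w :
  tri v w (\sum_(i <- s | P i) x i) = \sum_(i <- s | P i) tri v w (x i).
Proof. by rewrite -tri_cycle tri_sum1; apply: eq_bigr => i _; rewrite tri_cycle. Qed.

Lemma tri_Ad m u v w : tri (Ad m u) (Ad m v) (Ad m w) = tri u v w.
Proof. by rewrite /tri -(Ad_lie_bracket comm) (bform_Ad invQ). Qed.

Lemma bformD1 u u' w : B (u + u') w = B u w + B u' w.
Proof. by rewrite -[u]scale1r bform_linearl mul1r scale1r. Qed.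
Lemma bform01 w : B 0 w = 0.
Proof. by apply: (addrI (B 0 w)); rewrite -bformD1 !addr0. Qed.
Lemma bformZ1 a u w : B (a *: u) w = a * B u w.
Proof. by rewrite -[a *: u]addr0 bform_linearl bform01 addr0. Qed.
Lemma bform_sum1 (I : Type) (s : seq I) (P : pred I) (x : I -> 'rV[K]_d) w :
  B (\sum_(i <- s | P i) x i) w = \sum_(i <- s | P i) B (x i) w.
Proof.
by apply: (big_morph (fun u => B u w)); [move=> u u'; exact: bformD1|exact: bform01].
Qed.
Lemma bform_sum2 (I : Type) (s : seq I) (P : pred I) (x : I -> 'rV[K]_d) w :
  B w (\sum_(i <- s | P i) x i) = \sum_(i <- s | P i) B w (x i).
Proof.
by rewrite (bformC invQ) bform_sum1; apply: eq_bigr => i _; rewrite (bformC invQ).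
Qed.

Variable e : 'I_d -> 'rV[K]_d.
Hypothesis onb : orthonormal_basis Q e.

Lemma bform_onb i j : B (e i) (e j) = (i == j)%:R.
Proof. by have [_] := onb. Qed.

Lemma orthonormal_expand v : v = \sum_i B v (e i) *: e i.
Proof.
have [uE Eo] := onb; pose E : 'M[K]_d := \matrix_i e i.
have spanE : v = \sum_i (v *m invmx E) 0 i *: e i.
  rewrite -[LHS](mulmxKV uE) -[\matrix_i (e i)]/E mulmx_sum_row.
  by apply: eq_bigr => i _; rewrite rowK.
rewrite {1}spanE; apply: eq_bigr => i _; congr (_ *: _).
rewrite {2}spanE bform_sum1 (bigD1 i) //= big1 => [|j ji].
  by rewrite bformZ1 Eo eqxx mulr1 addr0.
by rewrite bformZ1 Eo (negbTE ji) mulr0.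
Qed.

Lemma tensor_ofE (r : 'M[K]_d) :
  tensor_of e r = (\matrix_i e i)^T *m r *m (\matrix_i e i).
Proof.
apply/matrixP => p q; rewrite /tensor_of summxE !mxE.
under eq_bigr do rewrite summxE.
under [RHS]eq_bigr do rewrite !mxE mulr_suml.
rewrite exchange_big /=; apply: eq_bigr => j _; apply: eq_bigr => i _.
by rewrite !mxE big_ord1 !mxE mulrA [r i j * _]mulrC.
Qed.

(** With E the matrix of basis vectors, the condition reads E^T (r + r^T)/2 E = E^T E, and E cancels
    on both sides. *)
Lemma symmetric_part_antisym (r : 'M[K]_d) :
  symmetric_part_is_casimir e r -> forall i j, (r - 1%:M) i j = - (r - 1%:M) j i.
Proof.
have [uE _] := onb; rewrite /symmetric_part_is_casimir.
have -> : \sum_i tens2 (e i) (e i) = tensor_of e 1%:M.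
  apply: eq_bigr => i _; rewrite (bigD1 i) //= big1 => [|j ji].
    by rewrite mxE eqxx scale1r addr0.
  by rewrite mxE eq_sym (negbTE ji) scale0r.
rewrite !tensor_ofE !trmx_mul trmxK !mulmxA -mulmxDl -mulmxDr.
set E := \matrix_i e i in uE *; move=> H i j.
have {H} : 2^-1 *: (r + r^T) = 1%:M.
  apply: (@row_full_inj _ _ _ _ E^T); first by rewrite row_full_unit unitmx_tr.
  apply: (@row_free_inj _ _ _ _ E); first by rewrite row_free_unit.
  by rewrite -scalemxAr -scalemxAl.
move=> /(congr1 (fun M : 'M[K]_d => M i j)); rewrite !mxE => H.
have := congr1 (fun x => 2 * x) H; rewrite mulVKf ?pnatr_eq0 // => H2.
rewrite [j == i]eq_sym; apply/eqP; rewrite -addr_eq0; apply/eqP.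
by rewrite addrACA H2; ring.
Qed.

(** The tensor r as an endomorphism, by contraction of its first factor with u through the form. The
    transpose of r contracts the second factor. *)
Definition hat (r : 'M[K]_d) u := \sum_i \sum_j (r i j * B u (e i)) *: e j.

Lemma bform_hat r u k : B (hat r u) (e k) = \sum_i r i k * B u (e i).
Proof.
rewrite /hat bform_sum1; apply: eq_bigr => i _.
rewrite bform_sum1 (bigD1 k) //= big1 => [|j jk].
  by rewrite bformZ1 bform_onb eqxx mulr1 addr0.
by rewrite bformZ1 bform_onb (negbTE jk) mulr0.
Qed.

End InvariantTrilinear.

Section YangBaxter.
Context {K : numFieldType} {d : nat} (G : lieGroupType K d).
Local Notation br := (lie_bracket G).
Hypothesis comm : mixed_derivatives_commute K.
Variable Q : 'M[K]_d.
Hypothesis invQ : nondegenerate_invariant G Q.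
Variable e : 'I_d -> 'rV[K]_d.
Hypothesis onb : orthonormal_basis Q e.
Local Notation B := (bform Q).
Local Notation tri := (tri G Q).
Local Notation hat := (hat Q e).
Implicit Types (u v w : 'rV[K]_d).

(** The linear functional [c] pairs a three-tensor with u, v, w; [q z] holds the coefficients of the
    functional defined by z through the form. *)
Lemma CYBE_contract (r : 'M[K]_d) u v w : CYBE G e r ->
  \sum_i \sum_j \sum_k \sum_m (r i j * r k m) *
    (B (br (e i) (e k)) u * B (e j) v * B (e m) w
     + B (e i) u * B (br (e j) (e k)) v * B (e m) w
     + B (e i) u * B (e k) v * B (br (e j) (e m)) w) = 0.
Proof.
move=> cybe.
pose q (z : 'rV[K]_d) i := (Q *m z^T) i 0.
have BE a z : B a z = \sum_i a 0 i * q z i by rewrite /bform -mulmxA mxE.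
pose c (T : {ffun 'I_d * 'I_d * 'I_d -> K}) :=
  \sum_i \sum_j \sum_k T (i, j, k) * (q u i * q v j * q w k).
have cD T T' : c (T + T') = c T + c T'.
  rewrite /c -big_split; apply: eq_bigr => i _; rewrite -big_split.
  apply: eq_bigr => j _; rewrite -big_split; apply: eq_bigr => k _.
  by rewrite ffunE mulrDl.
have cZ a (T : {ffun 'I_d * 'I_d * 'I_d -> K}) : c (a *: T) = a * c T.
  rewrite /c mulr_sumr; apply: eq_bigr => i _; rewrite mulr_sumr.
  apply: eq_bigr => j _; rewrite mulr_sumr; apply: eq_bigr => k _.
  by rewrite ffunE; exact: esym (mulrA _ _ _).
have c0 : c 0 = 0 by apply: (addrI (c 0)); rewrite -cD !addr0.
have cT a b a' : c (tens3 a b a') = B a u * B b v * B a' w.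
  rewrite /c !BE mulr_suml mulr_suml; apply: eq_bigr => i _.
  rewrite [X in _ = X * _]mulr_sumr mulr_suml; apply: eq_bigr => j _.
  rewrite mulr_sumr; apply: eq_bigr => k _.
  by rewrite ffunE /=; ring.
have := congr1 c cybe; rewrite c0 => E; apply: etrans _ E.
rewrite (big_morph c cD c0); apply: eq_bigr => i _.
rewrite (big_morph c cD c0); apply: eq_bigr => j _.
rewrite (big_morph c cD c0); apply: eq_bigr => k _.
rewrite (big_morph c cD c0); apply: eq_bigr => m _.
by rewrite cZ !cD !cT.
Qed.

(** The modified classical Yang-Baxter equation, contracted with three vectors. Its right side is
    the trace left by the invariant symmetric part of r. *)
Definition modified_CYBE (rho : 'M[K]_d) := forall u v w,
  tri u (hat rho v) (hat rho w) + tri (hat rho u) v (hat rho w) +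
  tri (hat rho u) (hat rho v) w = - tri u v w.

Lemma hat_trE (r : 'M[K]_d) u : hat r^T u = \sum_i \sum_j (r i j * B u (e j)) *: e i.
Proof.
rewrite /hat exchange_big; apply: eq_bigr => i _; apply: eq_bigr => j _.
by rewrite mxE.
Qed.

Lemma hatD (r r' : 'M[K]_d) u : hat (r + r') u = hat r u + hat r' u.
Proof.
rewrite /hat -big_split; apply: eq_bigr => i _; rewrite -big_split.
by apply: eq_bigr => j _; rewrite mxE mulrDl scalerDl.
Qed.

Lemma hatN (r : 'M[K]_d) u : hat (- r) u = - hat r u.
Proof.
rewrite /hat -sumrN; apply: eq_bigr => i _; rewrite -sumrN.
by apply: eq_bigr => j _; rewrite mxE mulNr scaleNr.
Qed.

Lemma hat1 u : hat 1%:M u = u.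
Proof.
rewrite [RHS](orthonormal_expand onb); apply: eq_bigr => i _.
rewrite (bigD1 i) //= big1 => [|j ji]; first by rewrite mxE eqxx mul1r addr0.
by rewrite mxE eq_sym (negbTE ji) mul0r scale0r.
Qed.

(** Contraction gives <[r^T v, r^T w], u> + <[r u, r^T w], v> + <[r u, r v], w> = 0. With r = 1 +
    rho and r^T = 1 - rho the terms of degree one in rho cancel, those of degree zero add up to one
    <[u, v], w>, and those of degree two form the left side. *)
Lemma modified_CYBE_of_CYBE (r : 'M[K]_d) :
  symmetric_part_is_casimir e r -> CYBE G e r -> modified_CYBE (r - 1%:M).
Proof.
move=> sr cybe u v w; set rho := r - 1%:M.
have anti := symmetric_part_antisym onb sr.
have rE : r = 1%:M + rho by rewrite addrC subrK.
rewrite -/rho in anti; clearbody rho.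
have rT : r^T = 1%:M - rho.
  rewrite rE linearD /= trmx1; congr (_ + _).
  by apply/matrixP => i j; rewrite [LHS]mxE [RHS]mxE; exact: anti.
have := CYBE_contract u v w cybe.
have T1 : \sum_i \sum_j \sum_k \sum_m (r i j * r k m) *
    (B (br (e i) (e k)) u * B (e j) v * B (e m) w) =
    tri (hat r^T v) (hat r^T w) u.
  rewrite !hat_trE (tri_sum1 G comm); apply: eq_bigr => i _.
  rewrite (tri_sum1 G comm); apply: eq_bigr => j _.
  rewrite (triZ1 G comm) (tri_sum2 comm invQ) mulr_sumr; apply: eq_bigr => k _.
  rewrite (tri_sum2 comm invQ) mulr_sumr; apply: eq_bigr => m _.
  rewrite (triZ2 comm invQ) /tri (bformC invQ v) (bformC invQ w); ring.
have T2 : \sum_i \sum_j \sum_k \sum_m (r i j * r k m) *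
    (B (e i) u * B (br (e j) (e k)) v * B (e m) w) =
    tri (hat r u) (hat r^T w) v.
  rewrite hat_trE /hat (tri_sum1 G comm); apply: eq_bigr => i _.
  rewrite (tri_sum1 G comm); apply: eq_bigr => j _.
  rewrite (triZ1 G comm) (tri_sum2 comm invQ) mulr_sumr; apply: eq_bigr => k _.
  rewrite (tri_sum2 comm invQ) mulr_sumr; apply: eq_bigr => m _.
  rewrite (triZ2 comm invQ) /tri (bformC invQ u) (bformC invQ w); ring.
have T3 : \sum_i \sum_j \sum_k \sum_m (r i j * r k m) *
    (B (e i) u * B (e k) v * B (br (e j) (e m)) w) =
    tri (hat r u) (hat r v) w.
  rewrite /hat (tri_sum1 G comm); apply: eq_bigr => i _.
  rewrite (tri_sum1 G comm); apply: eq_bigr => j _.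
  rewrite (triZ1 G comm) (tri_sum2 comm invQ) mulr_sumr; apply: eq_bigr => k _.
  rewrite (tri_sum2 comm invQ) mulr_sumr; apply: eq_bigr => m _.
  rewrite (triZ2 comm invQ) /tri (bformC invQ u) (bformC invQ v); ring.
have split3 : \sum_i \sum_j \sum_k \sum_m (r i j * r k m) *
    (B (br (e i) (e k)) u * B (e j) v * B (e m) w
     + B (e i) u * B (br (e j) (e k)) v * B (e m) w
     + B (e i) u * B (e k) v * B (br (e j) (e m)) w) =
    tri (hat r^T v) (hat r^T w) u + tri (hat r u) (hat r^T w) v +
    tri (hat r u) (hat r v) w.
  rewrite -T1 -T2 -T3 -!big_split; apply: eq_bigr => i _.
  rewrite -!big_split; apply: eq_bigr => j _.
  rewrite -!big_split; apply: eq_bigr => k _.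
  rewrite -!big_split; apply: eq_bigr => m _.
  by rewrite /= !mulrDr.
rewrite split3 rT rE !hatD !hatN !hat1.
move: (hat rho u) (hat rho v) (hat rho w) => u' v' w'.
rewrite !(triD1 G comm, triD2 comm invQ, triD3 invQ).
rewrite !(triN1 G comm, triN2 comm invQ).
rewrite -!(tri_cycle comm invQ u).
rewrite ![tri _ w v](triC23 comm invQ) ![tri _ w' v](triC23 comm invQ).
move: (tri u v w) (tri u v w') (tri u v' w) (tri u v' w') (tri u' v w)
  (tri u' v w') (tri u' v' w) (tri u' v' w') => p1 p2 p3 p4 p5 p6 p7 p8 H.
apply/eqP; rewrite -addr_eq0; apply/eqP; rewrite -[RHS]H; ring.
Qed.

End YangBaxter.

Lemma sum_delta2 (K : pzRingType) (J : finType) (P : pred J) (X : J -> J -> K) a :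
  P a -> \sum_(b | P b) \sum_(c | P c) ((a == b) && (b == c))%:R * X b c = X a a.
Proof.
move=> Pa; rewrite (bigD1 a) //= (bigD1 a) //= !eqxx mul1r.
rewrite big1 => [|c /andP[_ ca]]; last by rewrite eq_sym (negbTE ca) mul0r.
rewrite big1 ?addr0 // => b /andP[_ ba]; rewrite big1 // => c _.
by rewrite eq_sym (negbTE ba) mul0r.
Qed.

(** * The Jacobi sum at a single vertex *)

Section NodeJacobi.
Context {K : numFieldType} {d : nat} (G : lieGroupType K d).
Hypothesis comm : mixed_derivatives_commute K.
Variable Q : 'M[K]_d.
Hypothesis invQ : nondegenerate_invariant G Q.
Variable e : 'I_d -> 'rV[K]_d.
Local Notation tri := (tri G Q).
Local Notation hat := (hat Q e).

Lemma hat_sum (I : Type) (s : seq I) (P : pred I) (x : I -> 'rV[K]_d) r :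
  hat r (\sum_(i <- s | P i) x i) = \sum_(i <- s | P i) hat r (x i).
Proof.
apply: (big_morph (hat r)) => [u v|].
  rewrite /hat -big_split; apply: eq_bigr => i _; rewrite -big_split.
  by apply: eq_bigr => j _; rewrite bformD1 mulrDr scalerDl.
by rewrite /hat big1 // => i _; rewrite big1 // => j _; rewrite bform01 mulr0 scale0r.
Qed.

Variables (J : finType) (P : pred J) (eps : J -> J -> K) (rho : 'M[K]_d).
Hypothesis cybe : modified_CYBE G Q e rho.
Hypothesis eps_anti : forall a b, P a -> P b -> eps a b = - eps b a.
(* Off the diagonal this holds for the signs of a linear order: among a, b and c
   the products for the least and the greatest are 1, the third is -1. *)
Hypothesis eps3 : forall a b c, P a -> P b -> P c ->
  eps b a * eps c a + eps a b * eps c b + eps a c * eps b c =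
  1 - ((a == b) && (b == c))%:R.

(** The component at a of the Hamiltonian vector field of a function with gradient F: the
    contraction of F with the first slot of the bivector, whence the order [eps b a]. *)
Definition node_gradient (F : J -> 'rV[K]_d) (a : J) : 'rV[K]_d :=
  \sum_(b | P b) (hat rho (F b) + eps b a *: F b).

Let E (F : J -> 'rV[K]_d) a := \sum_(b | P b) eps b a *: F b.
Let S (F : J -> 'rV[K]_d) := \sum_(b | P b) F b.

Let node_gradientE F a : node_gradient F a = hat rho (S F) + E F a.
Proof. by rewrite /node_gradient big_split /= /S hat_sum. Qed.

(** The terms of degree one in [eps] cancel after an exchange of the two summation indices, by
    [eps_anti]. *)
Let cross F H (w : 'rV[K]_d) :
  \sum_(a | P a) tri (F a) (E H a) w + \sum_(a | P a) tri (E F a) (H a) w = 0.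
Proof.
have T1 : \sum_(a | P a) tri (F a) (E H a) w =
    \sum_(a | P a) \sum_(b | P b) eps b a * tri (F a) (H b) w.
  apply: eq_bigr => a Pa; rewrite (tri_sum2 comm invQ); apply: eq_bigr => b Pb.
  exact: triZ2.
have T2 : \sum_(b | P b) tri (E F b) (H b) w =
    \sum_(a | P a) \sum_(b | P b) eps a b * tri (F a) (H b) w.
  rewrite exchange_big; apply: eq_bigr => b Pb.
  rewrite (tri_sum1 G comm); apply: eq_bigr => a Pa; exact: triZ1.
apply: etrans (congr2 (fun p q => p + q) T1 T2) _.
rewrite -big_split big1 // => a Pa.
rewrite -big_split /= big1 // => b Pb.
by rewrite -mulrDl eps_anti // addNr mul0r.
Qed.

(** All three terms of degree two in [eps] are sums of tri (F a) (H b) (M c) over the same triples;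
    their coefficients add up to the left side of [eps3]. *)
Let triple (F H M : J -> 'rV[K]_d) :
  \sum_(a | P a) (tri (F a) (E H a) (E M a) + tri (E F a) (H a) (E M a) +
    tri (E F a) (E H a) (M a)) =
  tri (S F) (S H) (S M) - \sum_(a | P a) tri (F a) (H a) (M a).
Proof.
have T1 : \sum_(a | P a) tri (F a) (E H a) (E M a) =
    \sum_(a | P a) \sum_(b | P b) \sum_(c | P c)
      (eps b a * eps c a) * tri (F a) (H b) (M c).
  apply: eq_bigr => a Pa; rewrite (tri_sum2 comm invQ); apply: eq_bigr => b Pb.
  rewrite (tri_sum3 comm invQ); apply: eq_bigr => c Pc.
  by rewrite (triZ2 comm invQ) (triZ3 comm invQ) mulrA.
have T2 : \sum_(b | P b) tri (E F b) (H b) (E M b) =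
    \sum_(a | P a) \sum_(b | P b) \sum_(c | P c)
      (eps a b * eps c b) * tri (F a) (H b) (M c).
  rewrite exchange_big; apply: eq_bigr => b Pb.
  rewrite (tri_sum1 G comm); apply: eq_bigr => a Pa.
  rewrite (tri_sum3 comm invQ); apply: eq_bigr => c Pc.
  by rewrite (triZ1 G comm) (triZ3 comm invQ) mulrA.
have T3 : \sum_(c | P c) tri (E F c) (E H c) (M c) =
    \sum_(a | P a) \sum_(b | P b) \sum_(c | P c)
      (eps a c * eps b c) * tri (F a) (H b) (M c).
  under [RHS]eq_bigr do rewrite exchange_big.
  rewrite exchange_big; apply: eq_bigr => c Pc.
  rewrite (tri_sum1 G comm); apply: eq_bigr => a Pa.
  rewrite (tri_sum2 comm invQ); apply: eq_bigr => b Pb.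
  by rewrite (triZ1 G comm) (triZ2 comm invQ) mulrA.
rewrite !big_split.
apply: etrans (congr2 (fun p q => p + q) (congr2 (fun p q => p + q) T1 T2) T3) _.
rewrite -!big_split.
rewrite [in RHS]/S (tri_sum1 G comm) -sumrB; apply: eq_bigr => a Pa.
rewrite -!big_split (tri_sum2 comm invQ).
rewrite -(@sum_delta2 _ _ P (fun b c => tri (F a) (H b) (M c)) a Pa).
rewrite -sumrB; apply: eq_bigr => b Pb.
rewrite -!big_split (tri_sum3 comm invQ) -sumrB; apply: eq_bigr => c Pc.
move: (tri _ _ _) => t.
by rewrite /= -!mulrDl eps3 // mulrBl mul1r.
Qed.

Let split10 (x1 x2 x3 x4 x5 x6 x7 x8 x9 x10 : J -> K) :
  \sum_(a | P a) (x1 a + x2 a + x3 a + (x4 a + x5 a) + (x6 a + x7 a) -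
     (x8 a + x9 a) + x10 a) =
  (\sum_(a | P a) x1 a + \sum_(a | P a) x2 a + \sum_(a | P a) x3 a) +
  (\sum_(a | P a) x4 a + \sum_(a | P a) x5 a) +
  (\sum_(a | P a) x6 a + \sum_(a | P a) x7 a) -
  (\sum_(a | P a) x8 a + \sum_(a | P a) x9 a) + \sum_(a | P a) x10 a.
Proof. by rewrite !big_split /= sumrN !big_split. Qed.

(** Expansion by the degree in [eps]: degree zero is - tri (S F) (S H) (S M) by the modified
    Yang-Baxter equation, degree one vanishes by [cross], and degree two is tri (S F) (S H) (S M)
    minus the diagonal by [triple]. *)
Lemma node_jacobi (F H M : J -> 'rV[K]_d) :
  \sum_(a | P a) (tri (F a) (node_gradient H a) (node_gradient M a) +
    tri (node_gradient F a) (H a) (node_gradient M a) +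
    tri (node_gradient F a) (node_gradient H a) (M a)) =
  - \sum_(a | P a) tri (F a) (H a) (M a).
Proof.
set tF := hat rho (S F); set tH := hat rho (S H); set tM := hat rho (S M).
have expand a : tri (F a) (node_gradient H a) (node_gradient M a) +
    tri (node_gradient F a) (H a) (node_gradient M a) +
    tri (node_gradient F a) (node_gradient H a) (M a) =
    (tri (F a) tH tM + tri tF (H a) tM + tri tF tH (M a)) +
    (tri (F a) (E H a) tM + tri (E F a) (H a) tM) +
    (tri (H a) (E M a) tF + tri (E H a) (M a) tF) -
    (tri (F a) (E M a) tH + tri (E F a) (M a) tH) +
    (tri (F a) (E H a) (E M a) + tri (E F a) (H a) (E M a) +
      tri (E F a) (E H a) (M a)).
  rewrite !node_gradientE -/tF -/tH -/tM.
  rewrite !(triD1 G comm, triD2 comm invQ, triD3 invQ).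
  rewrite -!(tri_cycle comm invQ tF).
  rewrite (triC23 comm invQ _ (E M a) tH) (triC23 comm invQ _ (M a) tH).
  by move: tri => T; ring.
apply: etrans (eq_bigr _ (fun a _ => expand a)) _.
apply: etrans (split10 _ _ _ _ _ _ _ _ _ _) _.
have C0 : \sum_(a | P a) tri (F a) tH tM + \sum_(a | P a) tri tF (H a) tM +
    \sum_(a | P a) tri tF tH (M a) = - tri (S F) (S H) (S M).
  have C1 := esym (tri_sum1 G comm Q (index_enum J) P F tH tM).
  have C2 := esym (tri_sum2 comm invQ (index_enum J) P H tM tF).
  have C3 := esym (tri_sum3 comm invQ (index_enum J) P M tF tH).
  apply: etrans (congr2 (fun p q => p + q) (congr2 (fun p q => p + q) C1 C2) C3) _.
  exact: cybe.
have collapse (p q r s t t' m : K) : p = - t -> q = 0 -> r = 0 -> s = 0 ->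
    t' = t - m -> p + q + r - s + t' = - m.
  by move=> -> -> -> -> ->; ring.
exact: collapse C0 (cross F H tM) (cross H M tF) (cross F M tH) (triple F H M).
Qed.

End NodeJacobi.

(** * Bivectors built from commuting actions *)

Section JacobiCommutators.
Context {K : comPzRingType} {P : finType}.
Variable pi : P -> P -> K.
Hypothesis pi_anti : forall p q, pi p q = - pi q p.

Lemma sum4_perm (phi : P -> P -> P -> P -> K) :
  \sum_a \sum_b \sum_c \sum_d phi a b c d =
  \sum_c \sum_d \sum_b \sum_a phi a b c d.
Proof.
under eq_bigr do rewrite exchange_big /=.
rewrite exchange_big; apply: eq_bigr => c _.
under eq_bigr do rewrite exchange_big /=.
rewrite exchange_big; apply: eq_bigr => d _.
exact: exchange_big.
Qed.

(* [f2 q r] stands for the second derivative of f, first along r, then along q,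
   so that [nested f g g2 h h2] is the bracket of f with the bracket of g and h.
   In the cyclic sum only commutators of derivatives survive. *)
Definition nested (f g : P -> K) (g2 : P -> P -> K) (h : P -> K)
    (h2 : P -> P -> K) : K :=
  \sum_p \sum_q pi p q * f p *
    \sum_r \sum_s pi r s * (g2 q r * h s + g r * h2 q s).

Definition commutators (f : P -> K) (g2 : P -> P -> K) (h : P -> K) : K :=
  \sum_q \sum_r (\sum_p pi p q * f p) * (\sum_s pi r s * h s) *
    (g2 q r - g2 r q).

Let X (f : P -> K) (g2 : P -> P -> K) (h : P -> K) :=
  \sum_p \sum_q \sum_r \sum_s pi p q * pi r s * f p * h s * g2 q r.
Let Y (f g : P -> K) (h2 : P -> P -> K) :=
  \sum_p \sum_q \sum_r \sum_s pi p q * pi r s * f p * g r * h2 q s.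

Let nestedE f g g2 h h2 : nested f g g2 h h2 = X f g2 h + Y f g h2.
Proof.
rewrite /X /Y -big_split; apply: eq_bigr => p _.
rewrite -big_split; apply: eq_bigr => q _.
rewrite mulr_sumr -big_split; apply: eq_bigr => r _.
rewrite mulr_sumr -big_split; apply: eq_bigr => s _.
by rewrite /=; ring.
Qed.

(** Second derivatives of g occur in {f, {g, h}} and in {h, {f, g}}. Renaming indices in the latter
    and using [pi_anti] once gives the former with transposed [g2] and opposite sign. *)
Let commutatorsE f g2 h : commutators f g2 h = X f g2 h + Y h f g2.
Proof.
have YE : Y h f g2 =
    \sum_p \sum_q \sum_r \sum_s - (pi p q * pi r s * f p * h s * g2 r q).
  rewrite /Y sum4_perm; apply: eq_bigr => p _; apply: eq_bigr => q _.
  apply: eq_bigr => r _; apply: eq_bigr => s _.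
  by rewrite (pi_anti s r); ring.
have C : commutators f g2 h = \sum_p \sum_q \sum_r \sum_s
    pi p q * pi r s * f p * h s * (g2 q r - g2 r q).
  rewrite exchange_big /=; apply: eq_bigr => q _; rewrite exchange_big /=.
  apply: eq_bigr => r _; rewrite -mulrA mulr_suml; apply: eq_bigr => p _.
  rewrite mulr_suml mulr_sumr; apply: eq_bigr => s _.
  by ring.
rewrite C YE /X -big_split; apply: eq_bigr => p _.
rewrite -big_split; apply: eq_bigr => q _.
rewrite -big_split; apply: eq_bigr => r _.
rewrite -big_split; apply: eq_bigr => s _.
by rewrite /=; ring.
Qed.

Lemma jacobi_commutators f f2 g g2 h h2 :
  nested f g g2 h h2 + nested g h h2 f f2 + nested h f f2 g g2 =
  commutators f g2 h + commutators g h2 f + commutators h f2 g.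
Proof. by rewrite !nestedE !commutatorsE; ring. Qed.

End JacobiCommutators.

Section FlowFields.
Context {K : numFieldType} {d : nat} (G : lieGroupType K d).
Hypothesis comm : mixed_derivatives_commute K.
Local Notation AG := (lie_atlas : set (chart G _)).
Local Notation A2 := (prod_atlas AG AG).
Context (T : topologicalType) (V : normedModType K) (A : set (chart T V)).
Hypothesis mA : manifold A.
Let mG : manifold AG := manifold_lie G.

(** The order in [flowM] is that of right translations, whose generators are the left-invariant
    fields; this makes v |-> field a homomorphism without a sign. *)
Record right_flow (Phi : G -> T -> T) : Prop := RightFlow {
  flow_morph : morph (prod_atlas A AG) A (fun p => Phi p.2 p.1);
  flow1 : forall x, Phi 1%g x = x;
  flowM : forall h k x, Phi (h * k)%g x = Phi k (Phi h x)
}.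

Definition flow_field (Phi : G -> T -> T) (v : 'rV[K]_d) : vfield T :=
  fun f x => tderive v (fun h => f (Phi h x)).

Section OneFlow.
Variable Phi : G -> T -> T.
Hypothesis fPhi : right_flow Phi.
Implicit Types (f g : T -> K) (v w : 'rV[K]_d).

Lemma morph_flow_orbit x : morph AG A (Phi^~ x).
Proof.
have m : morph AG (prod_atlas A AG) (fun h => (x, h)).
  by apply: morph_pair => //; [exact: morph_cst|exact: morph_id].
exact: (morph_comp m (flow_morph fPhi)).
Qed.

Lemma flow_smooth x f : smooth_at A x f -> smooth_at AG 1%g (fun h => f (Phi h x)).
Proof. exact: (smooth_at_pull (morph_flow_orbit x) (flow1 fPhi x)). Qed.

Lemma flow_pair_smooth x f : smooth_at A x f ->
  smooth_at (prod_atlas A AG) (x, 1%g) (fun p => f (Phi p.2 p.1)).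
Proof.
move=> sf; apply: (@smooth_at_pull K _ _ _ _ _ A (fun p : T * G => Phi p.2 p.1)
  (x, 1%g) x f (flow_morph fPhi) _ sf).
exact: flow1.
Qed.

Lemma flow_field_smooth v x f : smooth_at A x f ->
  smooth_at A x (flow_field Phi v f).
Proof.
move=> sf; exact: (@tderive_smooth K d G T V A x v (fun p => f (Phi p.2 p.1)) mA
  (flow_pair_smooth sf)).
Qed.

Lemma near_flow x (W : T -> Prop) : (\near x, W x) ->
  \forall h \near (1%g : G), W (Phi h x).
Proof.
move=> nW; have [cP _] := morph_flow_orbit x.
by apply: (cP 1%g); rewrite (flow1 fPhi).
Qed.

(** A flow that preserves S is tangent to it, so its derivative at a point of S only sees the
    restriction to S. *)
Lemma flow_field_agree (S : set T) v x f g : (forall h x, S x -> S (Phi h x)) ->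
  S x -> (\forall y \near x, S y -> f y = g y) ->
  flow_field Phi v f x = flow_field Phi v g x.
Proof.
move=> SP Sx fg; apply: tderive_near.
by have := near_flow fg; apply: filterS => h; apply; exact: SP.
Qed.

Lemma flow_fieldD v x f g : smooth_at A x f -> smooth_at A x g ->
  flow_field Phi v (fun y => f y + g y) x =
  flow_field Phi v f x + flow_field Phi v g x.
Proof. by move=> /flow_smooth sf /flow_smooth sg; exact: tderiveD. Qed.

Lemma flow_fieldM v x f g : smooth_at A x f -> smooth_at A x g ->
  flow_field Phi v (fun y => f y * g y) x =
  flow_field Phi v f x * g x + f x * flow_field Phi v g x.
Proof.
move=> /flow_smooth sf /flow_smooth sg.
by apply: etrans (tderiveM v sf sg) _; rewrite (flow1 fPhi).
Qed.

Lemma flow_fieldZ v x (a : K) f : smooth_at A x f ->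
  flow_field Phi v (fun y => a * f y) x = a * flow_field Phi v f x.
Proof. by move=> /flow_smooth sf; exact: tderiveZ. Qed.

Lemma flow_field_sum (I : Type) (s : seq I) v x (f : I -> T -> K) :
  (forall i, smooth_at A x (f i)) ->
  flow_field Phi v (fun y => \sum_(i <- s) f i y) x =
  \sum_(i <- s) flow_field Phi v (f i) x.
Proof. by move=> sf; apply: tderive_sum => i; exact: flow_smooth. Qed.

Lemma flow_field_linear (a : K) v w x f : smooth_at A x f ->
  flow_field Phi (a *: v + w) f x =
  a * flow_field Phi v f x + flow_field Phi w f x.
Proof. by move=> /flow_smooth sf; exact: tderive_linear. Qed.

(** By [flowM] the iterated derivative along the flow is the iterated left-invariant derivative at 1
    of the function h |-> f (Phi h x). *)
Lemma flow_field_bracket v w x f : smooth_at A x f ->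
  flow_field Phi v (flow_field Phi w f) x -
  flow_field Phi w (flow_field Phi v f) x =
  flow_field Phi (lie_bracket G v w) f x.
Proof.
move=> /flow_smooth sf; apply: etrans _ (tderive_lie_bracket comm v w sf).
have E a b : flow_field Phi a (flow_field Phi b f) x =
    tderive a (fun h : G => tderive b (fun k : G => f (Phi (h * k)%g x))).
  apply: (congr1 (tderive a)); apply/funext => h.
  by apply: (congr1 (tderive b)); apply/funext => k; rewrite (flowM fPhi).
exact: (congr2 (fun p q => p - q) (E v w) (E w v)).
Qed.

End OneFlow.

Lemma flow_field_comm (Phi Psi : G -> T -> T) v w x f :
  right_flow Phi -> right_flow Psi ->
  (forall h k x, Phi h (Psi k x) = Psi k (Phi h x)) -> smooth_at A x f ->
  flow_field Phi v (flow_field Psi w f) x =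
  flow_field Psi w (flow_field Phi v f) x.
Proof.
move=> fPhi fPsi PP sf.
have sH : smooth_at A2 (1%g, 1%g) (fun p => f (Psi p.2 (Phi p.1 x))).
  apply: (smooth_at_pull (A' := A) (y := x)) sf; last first.
    by rewrite /= (flow1 fPhi) (flow1 fPsi).
  have m : morph A2 (prod_atlas A AG) (fun p => (Phi p.1 x, p.2)).
    apply: (morph_pair (manifold_prod mG mG) mA mG); last exact: morph_snd.
    exact: morph_comp (morph_fst AG AG) (morph_flow_orbit fPhi x).
  exact: morph_comp m (flow_morph fPsi).
apply: etrans (tderive_swap v w comm sH) _.
apply: (congr1 (tderive w)); apply/funext => k.
by apply: (congr1 (tderive v)); apply/funext => h; rewrite PP.
Qed.

End FlowFields.

(** * The bracket of a family of commuting flows and its Jacobi sum *)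

Section FlowPoisson.
Context {K : numFieldType} {d : nat} (G : lieGroupType K d).
Hypothesis comm : mixed_derivatives_commute K.
Variable Q : 'M[K]_d.
Hypothesis invQ : nondegenerate_invariant G Q.
Variable e : 'I_d -> 'rV[K]_d.
Hypothesis onb : orthonormal_basis Q e.
Context (T : topologicalType) (V : normedModType K) (A : set (chart T V)).
Hypothesis mA : manifold A.
Local Notation tri := (tri G Q).
Local Notation B := (bform Q).

Context (J I : finType) (Phi : J -> G -> T -> T) (N : J -> I).
Variables (rho : I -> 'M[K]_d) (eps : J -> J -> K).

Definition vertex_signs : Prop :=
  (forall a b, N a = N b -> eps a b = - eps b a) /\
  (forall a b c, N a = N b -> N b = N c ->
    eps b a * eps c a + eps a b * eps c b + eps a c * eps b c =
    1 - ((a == b) && (b == c))%:R).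

Hypothesis fPhi : forall a, right_flow A (Phi a).
Hypothesis Phi_comm : forall a b h k x, a != b ->
  Phi a h (Phi b k x) = Phi b k (Phi a h x).
Hypothesis rho_anti : forall n i j, rho n i j = - rho n j i.
Hypothesis cybe : forall n, modified_CYBE G Q e (rho n).
Hypothesis signs : vertex_signs.

Local Notation Z a v := (flow_field (Phi a) v).

Definition gradient (f : T -> K) (x : T) (a : J) : 'rV[K]_d :=
  \sum_i Z a (e i) f x *: e i.

Definition frame_field (p : J * 'I_d) : vfield T := Z p.1 (e p.2).

(** The bivector as an antisymmetric matrix in the frame of all fields, coupling only ends of one
    vertex; [eps] times the identity is what remains of the symmetric part of r. *)
Definition flow_coef (p q : J * 'I_d) : K :=
  if N p.1 == N q.1 then rho (N p.1) p.2 q.2 + eps p.1 q.1 * (p.2 == q.2)%:R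
  else 0.

Definition flow_bivector : bivector T := fun f g x =>
  \sum_p \sum_q flow_coef p q * frame_field p f x * frame_field q g x.

Lemma flow_coef_anti p q : flow_coef p q = - flow_coef q p.
Proof.
rewrite /flow_coef eq_sym; case: eqP => [Nqp|_]; last by rewrite oppr0.
have [anti _] := signs.
by rewrite Nqp rho_anti (anti p.1) // mulNr opprD [p.2 == _]eq_sym.
Qed.

Lemma flow_field_gradient a v f x : smooth_at A x f ->
  Z a v f x = B v (gradient f x a).
Proof.
move=> sf; have L c u w := flow_field_linear mA (fPhi a) c u w sf.
have Z0 : Z a 0 f x = 0.
  have := L 1 0 0; rewrite scale1r addr0 mul1r => E.
  by apply: (addrI (Z a 0 f x)); rewrite addr0 -E.
have ZZ c u : Z a (c *: u) f x = c * Z a u f x.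
  by have := L c u 0; rewrite Z0 !addr0.
have ZD : {morph (fun v => Z a v f x) : u w / u + w}.
  by move=> u w; have := L 1 u w; rewrite scale1r mul1r.
rewrite {1}(orthonormal_expand onb v) (big_morph _ ZD Z0).
rewrite /gradient (bform_sum2 invQ); apply: eq_bigr => i _.
rewrite ZZ (bformC invQ v (_ *: _)) bformZ1 mulrC.
by rewrite (bformC invQ (e i)).
Qed.

Lemma frame_field_smooth p x f : smooth_at A x f ->
  smooth_at A x (frame_field p f).
Proof. by move=> sf; exact: (flow_field_smooth mA (fPhi p.1) _ sf). Qed.

Lemma flow_bivector_smooth x f g : smooth_at A x f -> smooth_at A x g ->
  smooth_at A x (flow_bivector f g).
Proof.
move=> sf sg; apply: (smooth_at_sum mA) => p; apply: (smooth_at_sum mA) => q.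
apply: (smooth_atM mA); last exact: frame_field_smooth.
by apply: (smooth_atM mA); [exact: smooth_at_cst|exact: frame_field_smooth].
Qed.

Lemma frame_field_bivector q g h x : smooth_at A x g -> smooth_at A x h ->
  frame_field q (flow_bivector g h) x =
  \sum_r \sum_s flow_coef r s *
    (frame_field q (frame_field r g) x * frame_field s h x +
     frame_field r g x * frame_field q (frame_field s h) x).
Proof.
move=> sg sh; have fq := fPhi q.1.
have sr r := frame_field_smooth r sg.
have ss s := frame_field_smooth s sh.
have srs r s : smooth_at A x (fun y => flow_coef r s * frame_field r g y).
  by apply: (smooth_atM mA) => //; exact: smooth_at_cst.
have s2 r s := smooth_atM mA (srs r s) (ss s).
apply: etrans (flow_field_sum mA fq _ _ (fun r => smooth_at_sum mA _ (s2 r))) _.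
apply: eq_bigr => r _; apply: etrans (flow_field_sum mA fq _ _ (s2 r)) _.
apply: eq_bigr => s _; apply: etrans (flow_fieldM mA fq _ (srs r s) (ss s)) _.
have E : flow_field (Phi q.1) (e q.2)
    (fun y => flow_coef r s * frame_field r g y) x =
    flow_coef r s * frame_field q (frame_field r g) x.
  exact: (flow_fieldZ mA fq _ _ (sr r)).
apply: etrans (congr1 (fun p => p * _ + _) E) _.
by rewrite mulrDr !mulrA.
Qed.

Lemma flow_bivector_nested f g h x : smooth_at A x g -> smooth_at A x h ->
  flow_bivector f (flow_bivector g h) x =
  nested flow_coef (fun p => frame_field p f x)
    (fun p => frame_field p g x) (fun p q => frame_field p (frame_field q g) x)
    (fun p => frame_field p h x) (fun p q => frame_field p (frame_field q h) x).
Proof.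
move=> sg sh; apply: eq_bigr => p _; apply: eq_bigr => q _.
exact: (congr1 (fun z => flow_coef p q * frame_field p f x * z)
  (frame_field_bivector q sg sh)).
Qed.

(** Fields of different flows commute, those of one flow close into the Lie algebra; the invariant
    form writes the result through the gradient. *)
Lemma frame_field_commutator q r g x : smooth_at A x g ->
  frame_field q (frame_field r g) x - frame_field r (frame_field q g) x =
  (q.1 == r.1)%:R * tri (e q.2) (e r.2) (gradient g x q.1).
Proof.
move=> sg; case: q r => [a i] [b j] /=; rewrite /frame_field /=.
have [<-|ab] := eqVneq a b.
  apply: etrans (flow_field_bracket comm mA (fPhi a) _ _ sg) _.
  by rewrite mul1r; exact: flow_field_gradient.
rewrite mul0r; apply/eqP; rewrite subr_eq0; apply/eqP.
apply: (flow_field_comm comm mA) => // h k y; exact: Phi_comm.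
Qed.

Definition vertex_gradient f x a : 'rV[K]_d :=
  node_gradient Q e [pred b | N b == N a] eps (rho (N a)) (gradient f x) a.

Lemma bform_gradient f x a i : B (gradient f x a) (e i) = Z a (e i) f x.
Proof.
rewrite bform_sum1 (bigD1 i) //= big1 => [|j ji].
  by rewrite bformZ1 (bform_onb onb) eqxx mulr1 addr0.
by rewrite bformZ1 (bform_onb onb) (negbTE ji) mulr0.
Qed.

Lemma vertex_gradient_coord f x a i :
  \sum_p flow_coef p (a, i) * frame_field p f x = B (vertex_gradient f x a) (e i).
Proof.
rewrite /vertex_gradient /node_gradient bform_sum1.
rewrite -(pair_bigA _ (fun b j => flow_coef (b, j) (a, i) * frame_field (b, j) f x)).
rewrite [RHS]big_mkcond /=; apply: eq_bigr => b _.
rewrite /flow_coef /=; case: eqP => [<-|_]; last first.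
  by rewrite big1 // => j _; rewrite mul0r.
rewrite bformD1 (bform_hat onb) bformZ1 bform_gradient.
under eq_bigr do rewrite mulrDl.
rewrite big_split /=; congr (_ + _).
  by apply: eq_bigr => j _; rewrite bform_gradient.
rewrite (bigD1 i) //= big1 => [|j ji]; first by rewrite eqxx mulr1 addr0.
by rewrite (negbTE ji) mulr0 mul0r.
Qed.

(** Contracting the coefficients with df and dh gives Hamiltonian components. The one contracted
    through the second slot is brought to the first by antisymmetry, hence the sign. *)
Lemma flow_commutators f g h x : smooth_at A x g ->
  commutators flow_coef (fun p => frame_field p f x)
    (fun p q => frame_field p (frame_field q g) x) (fun p => frame_field p h x) =
  - \sum_a tri (vertex_gradient f x a) (vertex_gradient h x a) (gradient g x a).
Proof.
move=> sg; rewrite /commutators.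
have right (r : J * 'I_d) : \sum_s flow_coef r s * frame_field s h x =
    - B (vertex_gradient h x r.1) (e r.2).
  rewrite -vertex_gradient_coord -sumrN; apply: eq_bigr => s _.
  by rewrite flow_coef_anti mulNr; case: r.
have left (q : J * 'I_d) : \sum_p flow_coef p q * frame_field p f x =
    B (vertex_gradient f x q.1) (e q.2).
  by rewrite -vertex_gradient_coord; case: q.
transitivity (\sum_(q : J * 'I_d) \sum_(r : J * 'I_d)
  B (vertex_gradient f x q.1) (e q.2) * - B (vertex_gradient h x r.1) (e r.2) *
  ((q.1 == r.1)%:R * tri (e q.2) (e r.2) (gradient g x q.1))).
  apply: eq_bigr => q _; apply: eq_bigr => r _.
  by rewrite left right (frame_field_commutator q r sg).
rewrite -sumrN -(pair_bigA _ (fun a i => \sum_(r : J * 'I_d)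
  B (vertex_gradient f x a) (e i) * - B (vertex_gradient h x r.1) (e r.2) *
  ((a == r.1)%:R * tri (e i) (e r.2) (gradient g x a)))) /=.
apply: eq_bigr => a _.
have EF := orthonormal_expand onb (vertex_gradient f x a).
have EH := orthonormal_expand onb (vertex_gradient h x a).
rewrite [in RHS]EF (tri_sum1 G comm) -sumrN; apply: eq_bigr => i _.
rewrite (triZ1 G comm) [in RHS]EH (tri_sum2 comm invQ) -mulrN -sumrN mulr_sumr.
rewrite -(pair_bigA _ (fun b j =>
  B (vertex_gradient f x a) (e i) * - B (vertex_gradient h x b) (e j) *
  ((a == b)%:R * tri (e i) (e j) (gradient g x a)))) /=.
rewrite (bigD1 a) //= [X in _ + X]big1 => [|b ba]; last first.
  by rewrite big1 // => j _; rewrite eq_sym (negbTE ba) mul0r mulr0.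
rewrite addr0; apply: eq_bigr => j _.
by rewrite eqxx mul1r (triZ2 comm invQ) -mulrA mulNr.
Qed.

Lemma flow_bivector_jacobi f g h x :
  smooth_at A x f -> smooth_at A x g -> smooth_at A x h ->
  flow_bivector f (flow_bivector g h) x + flow_bivector g (flow_bivector h f) x +
  flow_bivector h (flow_bivector f g) x =
  - \sum_a tri (gradient f x a) (gradient g x a) (gradient h x a).
Proof.
move=> sf sg sh.
have E1 := flow_bivector_nested f sg sh.
have E2 := flow_bivector_nested g sh sf.
have E3 := flow_bivector_nested h sf sg.
apply: etrans (congr2 (fun p q => p + q) (congr2 (fun p q => p + q) E1 E2) E3) _.
apply: etrans (jacobi_commutators flow_coef_anti _ _ _ _ _ _) _.
have C1 := flow_commutators f h sg.
have C2 := flow_commutators g f sh.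
have C3 := flow_commutators h g sf.
apply: etrans (congr2 (fun p q => p + q) (congr2 (fun p q => p + q) C1 C2) C3) _.
have [anti trip] := signs.
pose X a := tri (gradient f x a) (gradient g x a) (gradient h x a).
pose Y a := tri (gradient f x a) (vertex_gradient g x a) (vertex_gradient h x a) +
  tri (vertex_gradient f x a) (gradient g x a) (vertex_gradient h x a) +
  tri (vertex_gradient f x a) (vertex_gradient g x a) (gradient h x a).
(* The sum splits over vertices, since [vertex_gradient] at an end only involves gradients at ends
   of the same vertex. *)
have node n : \sum_(a | N a == n) Y a = - \sum_(a | N a == n) X a.
  have NJ := @node_jacobi K d G comm Q invQ e J [pred a | N a == n] eps (rho n)
    (cybe n) _ _ (gradient f x) (gradient g x) (gradient h x).
  apply: etrans _ (NJ _ _) => /=.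
  - by apply: eq_bigr => a /eqP Na; rewrite /Y /vertex_gradient Na.
  - by move=> a b /eqP Na /eqP Nb; apply: anti; rewrite Na.
  - by move=> a b c /eqP Na /eqP Nb /eqP Nc; apply: trip; rewrite ?Na ?Nb.
have P1 (W : J -> K) : \sum_a W a = \sum_(n : I) \sum_(a | N a == n) W a.
  exact: (partition_big N xpredT).
have tot : \sum_a Y a = - \sum_a X a.
  rewrite (P1 Y) (P1 X) -sumrN; apply: eq_bigr => n _; exact: node.
have sum3 (X1 X2 X3 W : J -> K) : (forall a, - X1 a + - X2 a + - X3 a = W a) ->
    - (\sum_a X1 a) + - (\sum_a X2 a) + - (\sum_a X3 a) = \sum_a W a.
  by move=> XW; rewrite -!sumrN -!big_split; apply: eq_bigr => a _; exact: XW.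
apply: etrans _ tot; apply: sum3 => a.
exact: (tri_nested_terms comm invQ).
Qed.

End FlowPoisson.

(** * From ambient functions to functions on a subset *)

Section LocalRepresentatives.
Context {K : numFieldType} (T : topologicalType) (V : normedModType K).
Context (A : set (chart T V)) (S : set T).

(** The pointwise form of a section of [sub_sheaf]: an ambient smooth function that agrees with f on
    S near x. *)
Definition represents (x : T) (f F : T -> K) : Prop :=
  smooth_at A x F /\ \forall y \near x, S y -> f y = F y.

Lemma represents_near x f F :
  represents x f F -> \forall y \near x, represents y f F.
Proof.
move=> [/smooth_at_near sF /nbhs_interior fF].
by apply: filterS2 sF fF => y sy fy; split.
Qed.

Lemma sub_sheaf_represents U f x : sub_sheaf A S U f -> S x -> U x ->
  exists2 F, represents x f F & \forall y \near x, S y -> U y.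
Proof.
move=> Of Sx Ux; have [W [F [oW Wx WU sF fF]]] := Of x Sx Ux.
have nW : \forall y \near x, W y by exact: open_nbhs_nbhs.
exists F; last by apply: filterS nW => y Wy Sy; exact: WU.
split; first by exists W.
by apply: filterS nW => y; exact: fF.
Qed.

Lemma represents_sub_sheaf U f : manifold A ->
  (forall x, S x -> U x -> exists2 F, represents x f F &
    \forall y \near x, S y -> U y) -> sub_sheaf A S U f.
Proof.
move=> mA Hf x Sx Ux; have [F [[W [oW Wx sF]] fF] SU] := Hf x Sx Ux.
pose W' := W `&` ([set y | S y -> f y = F y]° `&` [set y | S y -> U y]°).
exists W', F; split.
- by apply: openI => //; apply: openI; exact: open_interior.
- by split => //; split.
- by move=> y [[_ [_ /interior_subset SUy]] Sy]; exact: SUy.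
- by apply: smooth_fun_sub sF => y [].
- by move=> y [_ [/interior_subset fFy _]] Sy; exact: fFy.
Qed.

End LocalRepresentatives.

Section SheafPoisson.
Context {K : numFieldType} {d : nat} (G : lieGroupType K d).
Hypothesis comm : mixed_derivatives_commute K.
Variable Q : 'M[K]_d.
Hypothesis invQ : nondegenerate_invariant G Q.
Variable e : 'I_d -> 'rV[K]_d.
Hypothesis onb : orthonormal_basis Q e.
Context (T : topologicalType) (V : normedModType K) (A : set (chart T V)).
Hypothesis mA : manifold A.
Context (J I : finType) (Phi : J -> G -> T -> T) (N : J -> I).
Variables (rho : I -> 'M[K]_d) (eps : J -> J -> K).
Hypothesis fPhi : forall a, right_flow A (Phi a).
Hypothesis Phi_comm : forall a b h k x, a != b ->
  Phi a h (Phi b k x) = Phi b k (Phi a h x).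
Hypothesis rho_anti : forall n i j, rho n i j = - rho n j i.
Hypothesis cybe : forall n, modified_CYBE G Q e (rho n).
Hypothesis signs : vertex_signs N eps.

Local Notation FB := (flow_bivector e Phi N rho eps).
Local Notation fld p := (frame_field e Phi p).
Local Notation cf := (flow_coef N rho eps).

Lemma flow_bivector_linear (a : K) f g h x :
  smooth_at A x f -> smooth_at A x g -> smooth_at A x h ->
  FB (fun y => a * f y + g y) h x = a * FB f h x + FB g h x.
Proof.
move=> sf sg sh; rewrite /flow_bivector mulr_sumr -big_split.
apply: eq_bigr => p _; rewrite mulr_sumr -big_split; apply: eq_bigr => q _ /=.
have E : fld p (fun y => a * f y + g y) x = a * fld p f x + fld p g x.
  have saf := smooth_atM mA (smooth_at_cst A x a) sf.
  apply: etrans (flow_fieldD mA (fPhi p.1) _ saf sg) _.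
  apply: (congr1 (fun z => z + _)); exact: (flow_fieldZ mA (fPhi p.1) _ a sf).
apply: etrans (congr1 (fun z => cf p q * z * fld q h x) E) _.
move: (fld p f x) (fld p g x) (fld q h x) => t t' t''.
by rewrite mulrDr mulrDl mulrCA !mulrA.
Qed.

Lemma flow_bivector_anti f g x : FB f g x = - FB g f x.
Proof.
rewrite /flow_bivector -sumrN exchange_big; apply: eq_bigr => q _.
rewrite -sumrN; apply: eq_bigr => p _.
rewrite (flow_coef_anti rho_anti signs).
move: (fld p f x) (fld q g x) => t t'.
by rewrite !mulNr mulrAC.
Qed.

Lemma flow_bivector_leibniz f g h x : smooth_at A x g -> smooth_at A x h ->
  FB f (fun y => g y * h y) x = FB f g x * h x + g x * FB f h x.
Proof.
move=> sg sh; rewrite /flow_bivector mulr_suml mulr_sumr -big_split.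
apply: eq_bigr => p _; rewrite mulr_suml mulr_sumr -big_split.
apply: eq_bigr => q _ /=.
have E := flow_fieldM mA (fPhi q.1) (e q.2) sg sh.
apply: etrans (congr1 (fun z => cf p q * fld p f x * z) E) _.
rewrite -/(fld q g) -/(fld q h).
move: (fld p f x) (fld q g x) (fld q h x) => t t' t''.
by rewrite mulrDr !mulrA [g x * _ * _ * _]mulrC !mulrA; congr (_ + _); ring.
Qed.

Variables (S : set T) (pb : @bivector K T).
Hypothesis pbE : forall x f g F H, S x -> represents A S x f F ->
  represents A S x g H -> pb f g x = FB F H x.
Hypothesis gradient_tri : forall x f g h, S x ->
  smooth_at A x f -> smooth_at A x g -> smooth_at A x h ->
  \sum_a tri G Q (gradient e Phi f x a) (gradient e Phi g x a)
    (gradient e Phi h x a) = 0.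

(** Representatives at x remain representatives at nearby points, where [pbE] applies again; this
    permits iterated brackets to be computed on representatives. *)
Lemma represents_bracket x f g F H : represents A S x f F ->
  represents A S x g H -> represents A S x (pb f g) (FB F H).
Proof.
move=> rf rg; split.
  exact: (flow_bivector_smooth e mA N rho eps fPhi rf.1 rg.1).
apply: filterS2 (represents_near rf) (represents_near rg) => y rfy rgy Sy.
exact: pbE.
Qed.

(** Every identity is transported to representatives at the given point. The ambient Jacobi sum is
    minus the sum of the three-forms of the gradients, and [gradient_tri] removes it at points of
    S. *)
Lemma local_poisson : is_poisson S (sub_sheaf A S) pb.
Proof.
move=> U f g h Of Og Oh; split.
- apply: (represents_sub_sheaf mA) => x Sx Ux.
  have [F rf SU] := sub_sheaf_represents Of Sx Ux.
  have [H rg _] := sub_sheaf_represents Og Sx Ux.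
  by exists (FB F H) => //; exact: represents_bracket.
- move=> a x Sx Ux.
  have [F rf _] := sub_sheaf_represents Of Sx Ux.
  have [H rg _] := sub_sheaf_represents Og Sx Ux.
  have [M rh _] := sub_sheaf_represents Oh Sx Ux.
  have rl : represents A S x (fun y => a * f y + g y) (fun y => a * F y + H y).
    split.
      apply: (smooth_atD mA); last by case: rg.
      by apply: (smooth_atM mA); [exact: smooth_at_cst|case: rf].
    by apply: filterS2 rf.2 rg.2 => y fy gy Sy; rewrite fy ?gy.
  rewrite (pbE Sx rl rh) (pbE Sx rf rh) (pbE Sx rg rh).
  by apply: flow_bivector_linear; [case: rf|case: rg|case: rh].
- move=> x Sx Ux.
  have [F rf _] := sub_sheaf_represents Of Sx Ux.
  have [H rg _] := sub_sheaf_represents Og Sx Ux.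
  by rewrite (pbE Sx rf rg) (pbE Sx rg rf); exact: flow_bivector_anti.
- move=> x Sx Ux.
  have [F rf _] := sub_sheaf_represents Of Sx Ux.
  have [H rg _] := sub_sheaf_represents Og Sx Ux.
  have [M rh _] := sub_sheaf_represents Oh Sx Ux.
  have rm : represents A S x (fun y => g y * h y) (fun y => H y * M y).
    split; first by apply: (smooth_atM mA); [case: rg|case: rh].
    by apply: filterS2 rg.2 rh.2 => y gy hy Sy; rewrite gy ?hy.
  rewrite (pbE Sx rf rm) (pbE Sx rf rg) (pbE Sx rf rh).
  rewrite (nbhs_singleton rg.2 Sx) (nbhs_singleton rh.2 Sx).
  by apply: flow_bivector_leibniz; [case: rg|case: rh].
- move=> x Sx Ux.
  have [F rf _] := sub_sheaf_represents Of Sx Ux.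
  have [H rg _] := sub_sheaf_represents Og Sx Ux.
  have [M rh _] := sub_sheaf_represents Oh Sx Ux.
  rewrite (pbE Sx rf (represents_bracket rg rh)).
  rewrite (pbE Sx rg (represents_bracket rh rf)).
  rewrite (pbE Sx rh (represents_bracket rf rg)).
  have J0 := gradient_tri Sx rf.1 rg.1 rh.1.
  apply: etrans (flow_bivector_jacobi comm invQ onb mA fPhi Phi_comm rho_anti
    cybe signs rf.1 rg.1 rh.1) _.
  by rewrite J0 oppr0.
Qed.

End SheafPoisson.

(** * Gradients along flows and their transformation rules *)

Section FlowGradients.
Context {K : numFieldType} {d : nat} (G : lieGroupType K d).
Hypothesis comm : mixed_derivatives_commute K.
Variable Q : 'M[K]_d.
Hypothesis invQ : nondegenerate_invariant G Q.
Variable e : 'I_d -> 'rV[K]_d.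
Hypothesis onb : orthonormal_basis Q e.
Context (T : topologicalType) (V : normedModType K) (A : set (chart T V)).
Hypothesis mA : manifold A.
Context (J I : finType) (Phi : J -> G -> T -> T) (N : J -> I).
Variables (rho : I -> 'M[K]_d) (eps : J -> J -> K).
Hypothesis fPhi : forall a, right_flow A (Phi a).
Local Notation AG := (lie_atlas : set (chart G _)).
Local Notation A2 := (prod_atlas AG AG).
Local Notation tri := (tri G Q).
Local Notation B := (bform Q).
Local Notation FB := (flow_bivector e Phi N rho eps).
Local Notation grad := (gradient e Phi).
Local Notation cf := (flow_coef N rho eps).
Let mG : manifold AG := manifold_lie G.

(** The adjoint of [Ad m] for the invariant form is [Ad m^-1]; this is how inverses enter the
    gradient formulas. *)
Lemma frame_sum_Ad (m : G) (u : 'rV[K]_d) :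
  \sum_i B (Ad m (e i)) u *: e i = Ad m^-1%g u.
Proof.
rewrite [RHS](orthonormal_expand onb); apply: eq_bigr => i _.
by rewrite (bform_Ad_adjoint invQ) (bformC invQ).
Qed.

Lemma inverse_flow_field (S : set T) (Psi : G -> T -> T) v x f F :
  right_flow A Psi -> (forall h y, S y -> S (Psi h y)) -> S x ->
  represents A S x f F ->
  tderive v (fun h => f (Psi h^-1%g x)) = - flow_field Psi v F x.
Proof.
move=> fPsi SPsi Sx [sF fF].
have sP := flow_smooth mA fPsi sF.
apply: etrans _ (tderive_inv v sP); apply: tderive_near.
have [cV _] : morph AG AG (fun h => h^-1%g) by apply: morphV; exact: morph_id.
have N1 := near_flow mA fPsi fF.
have : \forall h \near (1%g : G), S (Psi h^-1%g x) ->
    f (Psi h^-1%g x) = F (Psi h^-1%g x).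
  apply: (cV 1%g (fun h => S (Psi h x) -> f (Psi h x) = F (Psi h x))).
  by rewrite invg1.
by apply: filterS => h; apply; exact: SPsi.
Qed.

Lemma conj_inverse_field (Psi Psi' : G -> T -> T) (m : G) v x f :
  right_flow A Psi ->
  (forall h, Psi' h x = Psi (m * h^-1 * m^-1)%g x) -> smooth_at A x f ->
  flow_field Psi' v f x = - flow_field Psi (Ad m v) f x.
Proof.
move=> fF PP sf; have sP := flow_smooth mA fF sf.
apply: (@etrans _ _ (tderive v (fun h => f (Psi (m * h^-1 * m^-1)%g x)))).
  by apply: (congr1 (tderive v)); apply/funext => h; rewrite PP.
apply: etrans (tderive_inv v (conj_smooth m sP)) _.
exact: (congr1 -%R (tderive_conj m v sP)).
Qed.

(** The inverse contributes the sign, the conjugation contributes [Ad m] on directions and hence its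
    adjoint on gradients. *)
Lemma gradient_conj_inverse a b (m : G) x f :
  (forall h, Phi b h x = Phi a (m * h^-1 * m^-1)%g x) -> smooth_at A x f ->
  grad f x b = - Ad m^-1%g (grad f x a).
Proof.
move=> PP sf; rewrite -frame_sum_Ad -sumrN; apply: eq_bigr => i _.
rewrite -scaleNr; apply: (congr1 (fun c => c *: e i)).
apply: etrans (conj_inverse_field (e i) (fPhi a) PP sf) _.
apply: congr1; exact: (flow_field_gradient invQ onb mA fPhi a _ sf).
Qed.

(** The three-form is cubic and [Ad]-invariant, so it is odd under - Ad; reindexing along [sigma]
    shows the sum to be its own negative. *)
Lemma gradient_involution_tri (sigma : J -> J) (m : J -> G) x f g h :
  involutive sigma ->
  (forall a k, Phi (sigma a) k x = Phi a (m a * k^-1 * (m a)^-1)%g x) ->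
  smooth_at A x f -> smooth_at A x g -> smooth_at A x h ->
  \sum_a tri (grad f x a) (grad g x a) (grad h x a) = 0.
Proof.
move=> sK PP sf sg sh; set X := fun a => tri (grad f x a) (grad g x a) (grad h x a).
have XN a : X (sigma a) = - X a.
  rewrite /X (gradient_conj_inverse (PP a) sf) (gradient_conj_inverse (PP a) sg).
  rewrite (gradient_conj_inverse (PP a) sh).
  by rewrite (triN1 G comm) (triN2 comm invQ) (triN3 comm invQ) opprK (tri_Ad comm invQ).
have E : \sum_a X a = - \sum_a X a.
  rewrite {1}(reindex_inj (can_inj sK)) -sumrN.
  by apply: eq_bigr => a _; exact: XN.
apply/eqP; move/eqP: E; rewrite -addr_eq0 -mulr2n -mulr_natl mulf_eq0.
by rewrite pnatr_eq0.
Qed.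

(** All flows of s are run with one common group element, as a gauge transformation at a vertex does
    with the ends there. *)
Definition flow_seq (s : seq J) (h : G) (x : T) : T :=
  foldr (fun a => Phi a h) x s.

Lemma morph_flow_seq (s : seq J) x : morph AG A (fun h => flow_seq s h x).
Proof.
elim: s => [|a s IH]; first exact: morph_cst.
have m : morph AG (prod_atlas A AG) (fun h => (flow_seq s h x, h)).
  by apply: morph_pair => //; exact: morph_id.
exact: (morph_comp m (flow_morph (fPhi a))).
Qed.

Lemma flow_seq1 (s : seq J) x : flow_seq s 1%g x = x.
Proof. by elim: s => //= a s ->; exact: flow1 (fPhi a) x. Qed.

(** Each step splits off one flow by [tderive_diag]: the head moves while the tail stays at 1, and
    conversely. *)
Lemma flow_seq_field (s : seq J) v x f : smooth_at A x f ->
  flow_field (flow_seq s) v f x = \sum_(a <- s) flow_field (Phi a) v f x.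
Proof.
move=> sf; elim: s => [|a s IH]; first by rewrite big_nil; exact: (@tderive_cst K d G v (f x)).
rewrite big_cons -IH.
have sH : smooth_at A2 (1%g, 1%g) (fun p => f (Phi a p.1 (flow_seq s p.2 x))).
  apply: (smooth_at_pull (A' := A) (y := x)) sf; last first.
    by rewrite /= flow_seq1 (flow1 (fPhi a)).
  have m : morph A2 (prod_atlas A AG) (fun p => (flow_seq s p.2 x, p.1)).
    apply: (morph_pair (manifold_prod mG mG) mA mG); last exact: morph_fst.
    exact: morph_comp (morph_snd AG AG) (morph_flow_seq s x).
  exact: morph_comp m (flow_morph (fPhi a)).
apply: etrans (tderive_diag v sH) _ => /=; apply: congr2.
  by apply: (congr1 (tderive v)); apply/funext => h; rewrite flow_seq1.
by apply: (congr1 (tderive v)); apply/funext => h; rewrite (flow1 (fPhi a)).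
Qed.

Lemma flow_bivector_agree (S : set T) x f g F H :
  (forall a h y, S y -> S (Phi a h y)) -> S x ->
  represents A S x f F -> represents A S x g H -> FB f g x = FB F H x.
Proof.
move=> SP Sx [_ fF] [_ gH].
have E (k k' : T -> K) p : (\forall y \near x, S y -> k y = k' y) ->
    frame_field e Phi p k x = frame_field e Phi p k' x.
  by move=> kk'; exact: (flow_field_agree mA (fPhi p.1) (e p.2) (SP p.1) Sx kk').
apply: eq_bigr => p _; apply: eq_bigr => q _.
exact: (congr2 (fun z z' => cf p q * z * z') (E _ _ p fF) (E _ _ q gH)).
Qed.

Definition vertex_pairing (n : I) (F H : J -> 'rV[K]_d) : K :=
  B (hat Q e (rho n) (\sum_(a | N a == n) F a)) (\sum_(a | N a == n) H a) +
  \sum_(a | N a == n) \sum_(b | N b == n) eps a b * B (F a) (H b).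

Lemma flow_bivector_pairs f g x : FB f g x =
  \sum_a \sum_b \sum_i \sum_j
    cf (a, i) (b, j) * flow_field (Phi a) (e i) f x * flow_field (Phi b) (e j) g x.
Proof.
rewrite /flow_bivector.
rewrite -(pair_bigA _ (fun a i => \sum_(q : J * 'I_d) cf (a, i) q *
  frame_field e Phi (a, i) f x * frame_field e Phi q g x)) /=.
apply: eq_bigr => a _; rewrite [RHS]exchange_big; apply: eq_bigr => i _.
by rewrite -(pair_bigA _ (fun b j => cf (a, i) (b, j) *
  frame_field e Phi (a, i) f x * frame_field e Phi (b, j) g x)).
Qed.

(** Since [rho] depends on the vertex alone, its part factors through the sums of gradients over a
    vertex, while the sign part stays a double sum. *)
Lemma flow_bivector_gradient f g x :
  FB f g x = \sum_n vertex_pairing n (grad f x) (grad g x).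
Proof.
rewrite flow_bivector_pairs.
pose c a b := B (hat Q e (rho (N a)) (grad f x a)) (grad g x b) +
  eps a b * B (grad f x a) (grad g x b).
have E a b : \sum_i \sum_j
    cf (a, i) (b, j) * flow_field (Phi a) (e i) f x * flow_field (Phi b) (e j) g x =
    if N b == N a then c a b else 0.
  rewrite /flow_coef /= eq_sym; case: eqP => _; last first.
    by rewrite big1 // => i _; rewrite big1 // => j _; rewrite !mul0r.
  rewrite /c (orthonormal_expand onb (grad g x b)) !(bform_sum2 invQ).
  rewrite mulr_sumr -big_split exchange_big; apply: eq_bigr => j _ /=.
  have Z2 u (k : K) : B u (k *: e j) = k * B u (e j).
    by rewrite (bformC invQ) bformZ1 (bformC invQ).
  rewrite !Z2 (bform_hat onb) !(bform_gradient onb).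
  transitivity (\sum_i (rho (N a) i j * flow_field (Phi a) (e i) f x +
      eps a b * ((i == j)%:R * flow_field (Phi a) (e i) f x)) *
      flow_field (Phi b) (e j) g x).
    by apply: eq_bigr => i _; rewrite mulrDl -!mulrA.
  rewrite -mulr_suml big_split /= -mulr_sumr.
  have -> : \sum_i (i == j)%:R * flow_field (Phi a) (e i) f x =
      flow_field (Phi a) (e j) f x.
    rewrite (bigD1 j) //= big1 => [|i ij]; first by rewrite eqxx mul1r addr0.
    by rewrite (negbTE ij) mul0r.
  have -> : \sum_i rho (N a) i j * flow_field (Phi a) (e i) f x =
      \sum_i rho (N a) i j * B (grad f x a) (e i).
    by apply: eq_bigr => i _; rewrite (bform_gradient onb).
  move: (\sum_i _) (flow_field _ _ _ _) (flow_field _ _ _ _) => p q r.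
  ring.
under eq_bigr => a _ do under eq_bigr => b _ do rewrite E.
rewrite (partition_big N xpredT) //=; apply: eq_bigr => n _.
rewrite /vertex_pairing hat_sum bform_sum1 -big_split /=.
apply: eq_bigr => a /eqP Na; rewrite -big_mkcond /= Na (bform_sum2 invQ) -big_split /=.
by rewrite /c Na.
Qed.

End FlowGradients.

(** * Graph connections *)

Section LinearOrderSigns.
Context {K : comPzRingType} (J : finType) (lt : rel J) (D : {set J}).
Hypothesis irr : {in D, irreflexive lt}.
Hypothesis trans : {in D & &, transitive lt}.
Hypothesis total : {in D &, forall a b, a != b -> lt a b || lt b a}.

Let sgn a b : K := (lt a b)%:R - (lt b a)%:R.

Let asym a b : a \in D -> b \in D -> lt a b -> lt b a = false.
Proof.
move=> Da Db ab; apply/negP => ba.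
by have := irr Da; rewrite (trans Db Da Da ab ba).
Qed.

Let sgnP a b : a \in D -> b \in D -> a != b ->
  (lt a b /\ (sgn a b = 1 /\ sgn b a = -1)) \/
  (lt b a /\ (sgn a b = -1 /\ sgn b a = 1)).
Proof.
move=> Da Db ab; have /orP[h|h] := total Da Db ab; [left|right];
  by rewrite /sgn h asym // subr0 sub0r.
Qed.

Lemma linear_order_signs a b c : a \in D -> b \in D -> c \in D ->
  sgn b a * sgn c a + sgn a b * sgn c b + sgn a c * sgn b c =
  1 - ((a == b) && (b == c))%:R.
Proof.
move=> Da Db Dc; have s0 x : sgn x x = 0 by rewrite /sgn subrr.
have [<-|ab] := eqVneq a b; have [<-|bc] := eqVneq _ c.
- by rewrite !s0 !mul0r !addr0 subrr.
- rewrite s0 !mul0r !add0r subr0.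
  by have [[_ [-> _]]|[_ [-> _]]] := sgnP Da Dc bc; ring.
- rewrite s0 !mulr0 !addr0 subr0.
  by have [[_ [_ ->]]|[_ [_ ->]]] := sgnP Da Db ab; ring.
have [ac|ac] := eqVneq a c.
  rewrite -ac !s0 mulr0 add0r mul0r addr0 subr0.
  by have [[_ [-> _]]|[_ [-> _]]] := sgnP Da Db ab; ring.
(* Of the eight sign patterns for distinct a, b, c, six are linear orders and are settled by
   computation; the two cyclic ones contradict transitivity. *)
have [[lab [-> ->]]|[lba [-> ->]]] := sgnP Da Db ab;
have [[lbc [-> ->]]|[lcb [-> ->]]] := sgnP Db Dc bc;
have [[lac [-> ->]]|[lca [-> ->]]] := sgnP Da Dc ac; rewrite /= ?subr0; try by ring.
- by have := trans Db Da Dc lab lbc; rewrite asym.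
- by have := trans Db Dc Da lcb lba; rewrite asym.
Qed.
End LinearOrderSigns.

Section GraphFlows.
Context {K : numFieldType} {d : nat} (G : lieGroupType K d).
Variable l : ciliated_fat_graph.
Local Notation AA := (@assignments_atlas K d G l).
Local Notation opp := (@Defs.opp l).
Local Notation AG := (lie_atlas : set (chart G _)).

Definition cilia_sign (a b : ends l) : K :=
  (cilia_lt a b)%:R - (cilia_lt b a)%:R.

Lemma mem_vertex (a : ends l) (n : vertex l) : (a \in val n) = (vertex_of a == n).
Proof.
have [triv cov] : finset.trivIset (vertices l) /\
    finset.cover (vertices l) = [set: ends l]%SET.
  have := verticesP l; rewrite /finset.partition => /and3P[/eqP c t _].
  by split.
rewrite -val_eqE /=; case: n => n nV /=; apply/idP/eqP => [an|<-].
  exact: finset.def_pblock triv nV an.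
by rewrite finset.mem_pblock cov inE.
Qed.

Lemma cilia_signs : vertex_signs (@vertex_of l) cilia_sign.
Proof.
split=> [a b _|a b c ab bc]; first by rewrite /cilia_sign opprB.
have Da : a \in val (vertex_of c) by rewrite mem_vertex ab bc.
have Db : b \in val (vertex_of c) by rewrite mem_vertex bc.
have Dc : c \in val (vertex_of c) by rewrite mem_vertex.
have nV := valP (vertex_of c).
exact: (linear_order_signs (cilia_irr nV) (cilia_trans nV) (cilia_total nV)
  Da Db Dc).
Qed.

Lemma manifold_assignments : manifold AA.
Proof. exact: (manifold_pow _ (manifold_lie G)). Qed.

Let mG : manifold AG := manifold_lie G.
Let mAG : manifold (prod_atlas AA AG) := manifold_prod manifold_assignments mG.

Lemma end_flow_right (a : ends l) : right_flow AA (fun h x => end_flow a h x).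
Proof.
split.
- apply: (morph_ptws mG mAG) => b; rewrite /end_flow.
  have mb : morph (prod_atlas AA AG) AG (fun p => p.1 b).
    exact: (morph_comp (morph_fst AA AG) (morph_eval AG b)).
  have mh : morph (prod_atlas AA AG) AG (fun p => p.2) by exact: morph_snd.
  case: (b == a); first exact: (morphM mAG mb mh).
  case: (b == opp a) => //; exact: (morphM mAG (morphV mh) mb).
- move=> x; apply/funext => b; rewrite /end_flow.
  by case: (b == a); case: (b == opp a); rewrite ?mulg1 ?invg1 ?mul1g.
- move=> h k x; apply/funext => b; rewrite /end_flow.
  by case: (b == a); case: (b == opp a); rewrite ?invgM ?mulgA.
Qed.

Lemma opp_eq_sym (a b : ends l) : (a == opp b) = (b == opp a).
Proof. by apply/eqP/eqP => ->; rewrite oppK. Qed.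

(** The case to watch is b = opp a, where both flows move the same two components; one multiplies on
    the right and the other on the left. *)
Lemma end_flow_comm (a b : ends l) (h k : G) x : a != b ->
  end_flow a h (end_flow b k x) = end_flow b k (end_flow a h x).
Proof.
move=> ab; apply/funext => c; rewrite /end_flow.
have [->|ca] := eqVneq c a.
  by rewrite (negbTE ab); case: (a == opp b); rewrite ?mulgA.
have [->|cb] := eqVneq c b; first by case: (b == opp a); rewrite ?mulgA.
have [->|_] := eqVneq c (opp a) => //.
by rewrite (inj_eq (can_inj (@oppK l))) (negbTE ab).
Qed.

Lemma end_flow_connections (a : ends l) (h : G) x :
  connections G l x -> connections G l (end_flow a h x).
Proof.
move=> cx b; rewrite /end_flow (inj_eq (can_inj (@oppK l))).
have [->|ba] := eqVneq b a.
  by rewrite (negbTE (opp_neq a)) invgM cx.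
have [->|bo] := eqVneq b (opp a).
  by rewrite oppK eqxx invgM invgK -{1}[a]oppK cx.
by rewrite [_ == a]eq_sym opp_eq_sym (negbTE bo) cx.
Qed.

(** With A = x a, the component at a becomes h^-1 A = A (A^-1 h^-1 A), so the conjugating element is
    A^-1; the component at [opp a] follows suit because x is a connection. *)
Lemma end_flow_opp (a : ends l) (h : G) x : connections G l x ->
  end_flow (opp a) h x = end_flow a ((x a)^-1 * h^-1 * (x a)^-1^-1)%g x.
Proof.
move=> cx; apply/funext => b; rewrite /end_flow oppK.
have [->|ba] := eqVneq b a.
  by rewrite eq_sym (negbTE (opp_neq a)) invgK !mulgA mulgV mul1g.
have [->|//] := eqVneq b (opp a).
by rewrite cx !invgM !invgK -!mulgA mulgV mulg1.
Qed.

End GraphFlows.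

Section GraphBivector.
Context {K : numFieldType} {d : nat}.
Variable l : ciliated_fat_graph.
Variable r : vertex l -> 'M[K]_d.
Let rho n := r n - 1%:M.
Hypothesis rho_anti : forall n i j, rho n i j = - rho n j i.

Let r_rho n i j : r n i j = rho n i j + (i == j)%:R.
Proof. by rewrite !mxE addrNK. Qed.
Let r_rhoT n i j : r n j i = - rho n i j + (i == j)%:R.
Proof. by rewrite r_rho -rho_anti eq_sym. Qed.

Lemma cilia_trichotomy (n : vertex l) a b : a \in val n -> b \in val n ->
  (cilia_lt a b)%:R + (cilia_lt b a)%:R + (a == b)%:R = 1 :> K.
Proof.
move=> an bn; have nV := valP n.
have irr := cilia_irr nV; have trans := cilia_trans nV.
have total := cilia_total nV.
have [<-|ab] := eqVneq a b; first by rewrite irr // !add0r.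
have asym c c' : c \in val n -> c' \in val n -> cilia_lt c c' ->
    cilia_lt c' c = false.
  move=> cn c'n lc; apply/negP => lc'.
  by have := irr _ cn; rewrite (trans _ _ _ c'n cn cn lc lc').
by have /orP[h|h] := total a b an bn ab; rewrite h asym // ?addr0 ?add0r ?addr0.
Qed.

(** The coefficient of [fa a i * ga b j] is r_ij if a < b, - r_ji if b < a and (r_ij - r_ji) / 2 if
    a = b. With r_ij = rho_ij + delta_ij and r_ji = - rho_ij + delta_ij these are rho + delta, rho -
    delta and rho. *)
Lemma vertex_bivector (n : vertex l) (fa ga : ends l -> 'I_d -> K) :
  \sum_(a in val n) \sum_(b in val n | cilia_lt a b) \sum_i \sum_j
      r n i j * (fa a i * ga b j - fa b j * ga a i)
  + 2^-1 * \sum_(a in val n) \sum_i \sum_j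
      r n i j * (fa a i * ga a j - fa a j * ga a i) =
  \sum_(a in val n) \sum_(b in val n) \sum_i \sum_j
    (rho n i j + cilia_sign a b * (i == j)%:R) * fa a i * ga b j.
Proof.
pose M a b := \sum_i \sum_j r n i j * (fa a i * ga b j).
pose M' a b := \sum_i \sum_j r n j i * (fa a i * ga b j).
have ME a b : \sum_i \sum_j r n i j * (fa a i * ga b j - fa b j * ga a i) =
    M a b - M' b a.
  rewrite /M /M' [X in _ = _ - X]exchange_big -sumrB; apply: eq_bigr => i _.
  by rewrite -sumrB; apply: eq_bigr => j _; rewrite mulrBr.
have step1 : \sum_(a in val n) \sum_(b in val n | cilia_lt a b) (M a b - M' b a) =
    \sum_(a in val n) \sum_(b in val n)
      ((cilia_lt a b)%:R * M a b - (cilia_lt b a)%:R * M' a b).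
  transitivity (\sum_(a in val n) \sum_(b in val n) (cilia_lt a b)%:R * M a b -
      \sum_(a in val n) \sum_(b in val n) (cilia_lt a b)%:R * M' b a).
    rewrite -sumrB; apply: eq_bigr => a _; rewrite -sumrB big_mkcondr.
    by apply: eq_bigr => b _; case: ifP; rewrite ?mul1r ?mul0r ?subr0.
  rewrite [X in _ - X]exchange_big -sumrB; apply: eq_bigr => a _.
  by rewrite -sumrB.
have step2 : \sum_(a in val n) (M a a - M' a a) =
    \sum_(a in val n) \sum_(b in val n) (a == b)%:R * (M a b - M' a b).
  apply: eq_bigr => a an; rewrite (bigD1 a) //= eqxx mul1r big1 ?addr0 //.
  by move=> b /andP[_ ba]; rewrite eq_sym (negbTE ba) mul0r.
transitivity (\sum_(a in val n) \sum_(b in val n | cilia_lt a b) (M a b - M' b a) +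
    2^-1 * \sum_(a in val n) (M a a - M' a a)).
  congr (_ + _ * _); last by apply: eq_bigr => a _; exact: ME.
  by apply: eq_bigr => a _; apply: eq_bigr => b _; exact: ME.
rewrite step1 step2 mulr_sumr -big_split; apply: eq_bigr => a an /=.
rewrite mulr_sumr -big_split; apply: eq_bigr => b bn /=.
rewrite /M /M' -sumrB !mulr_sumr -sumrB -big_split; apply: eq_bigr => i _ /=.
rewrite -sumrB !mulr_sumr -sumrB -big_split; apply: eq_bigr => j _ /=.
rewrite r_rho r_rhoT /cilia_sign.
(* Trichotomy eliminates the equality indicator, which leaves an identity valid for arbitrary values
   of the two order indicators. *)
have -> : (a == b)%:R = 1 - (cilia_lt a b)%:R - (cilia_lt b a)%:R :> K.
  have solve (x y w : K) : x + y + w = 1 -> w = 1 - x - y by move=> <-; ring.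
  exact: solve (cilia_trichotomy an bn).
rewrite -[in RHS]mulrA; move: (fa a i * ga b j) (rho n i j) (i == j)%:R => z p q.
move: (cilia_lt a b)%:R (cilia_lt b a)%:R => x y.
by field.
Qed.

End GraphBivector.

Section ConnectionsPoisson.
Context {K : numFieldType} {d : nat} (G : lieGroupType K d).
Hypothesis comm : mixed_derivatives_commute K.
Variable Q : 'M[K]_d.
Hypothesis invQ : nondegenerate_invariant G Q.
Variable e : 'I_d -> 'rV[K]_d.
Hypothesis onb : orthonormal_basis Q e.
Variable l : ciliated_fat_graph.
Variable r : vertex l -> 'M[K]_d.
Hypothesis rcybe : forall n, CYBE G e (r n).
Hypothesis rsym : forall n, symmetric_part_is_casimir e (r n).
Local Notation opp := (@Defs.opp l).
Local Notation AA := (@assignments_atlas K d G l).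

Definition antisym_part (n : vertex l) : 'M[K]_d := r n - 1%:M.

Lemma antisym_part_anti n i j : antisym_part n i j = - antisym_part n j i.
Proof. by have H := symmetric_part_antisym onb (rsym n) i j; exact H. Qed.

Lemma antisym_part_CYBE n : modified_CYBE G Q e (antisym_part n).
Proof. exact: (modified_CYBE_of_CYBE comm invQ onb (rsym n) (rcybe n)). Qed.

Definition end_flows (a : ends l) (h : G) (x : assignments G l) := end_flow a h x.

Lemma vertex_sum (fa ga : ends l -> 'I_d -> K) :
  \sum_(n : vertex l) \sum_(a in val n) \sum_(b in val n) \sum_i \sum_j
    (antisym_part n i j + cilia_sign a b * (i == j)%:R) * fa a i * ga b j =
  \sum_a \sum_b \sum_i \sum_j
    flow_coef (@vertex_of l) antisym_part (@cilia_sign K l) (a, i) (b, j) *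
      fa a i * ga b j.
Proof.
rewrite [RHS](partition_big (@vertex_of l) xpredT) //=; apply: eq_bigr => n _.
apply: eq_big => [a|a an]; first exact: mem_vertex.
rewrite mem_vertex in an; rewrite big_mkcond; apply: eq_bigr => b _.
rewrite mem_vertex /flow_coef /= (eqP an) eq_sym; case: eqP => // _.
by rewrite big1 // => i _; rewrite big1 // => j _; rewrite !mul0r.
Qed.

Lemma fock_rosly_flow f g x :
  fock_rosly G e r f g x =
  flow_bivector e end_flows (@vertex_of l) antisym_part (@cilia_sign K l) f g x.
Proof.
rewrite flow_bivector_pairs.
pose fa k a i := Xfield (G := G) a (e i) k x.
apply: etrans _ (vertex_sum (fa f) (fa g)); apply: eq_bigr => n _.
exact: (vertex_bivector antisym_part_anti n (fa f) (fa g)).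
Qed.

Lemma end_flows_right a : right_flow AA (end_flows a).
Proof. exact: end_flow_right. Qed.

Lemma end_flows_comm a b h k x : a != b ->
  end_flows a h (end_flows b k x) = end_flows b k (end_flows a h x).
Proof. exact: end_flow_comm. Qed.

Lemma connections_poisson :
  is_poisson (connections G l) (connections_sheaf G l) (fock_rosly G e r).
Proof.
have mA := manifold_assignments G l.
apply: (local_poisson comm invQ onb mA end_flows_right end_flows_comm
  antisym_part_anti antisym_part_CYBE (@cilia_signs K l)).
  move=> x f g F H Sx rf rg; rewrite fock_rosly_flow.
  apply: (flow_bivector_agree e mA (@vertex_of l) antisym_part (@cilia_sign K l)
    end_flows_right (S := connections G l)) rf rg => // a h y.
  exact: end_flow_connections.
move=> x f g h Sx sf sg sh.
apply: (gradient_involution_tri comm invQ onb mA end_flows_right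
  (sigma := opp) (m := fun a => (x a)^-1%g)) => //.
  exact: oppK.
by move=> a k; exact: end_flow_opp.
Qed.

End ConnectionsPoisson.

(** * Connections and gauge transformations *)

Section SourcePoisson.
Context {K : numFieldType} {d : nat} (G : lieGroupType K d).
Hypothesis comm : mixed_derivatives_commute K.
Variable Q : 'M[K]_d.
Hypothesis invQ : nondegenerate_invariant G Q.
Variable e : 'I_d -> 'rV[K]_d.
Hypothesis onb : orthonormal_basis Q e.
Variable l : ciliated_fat_graph.
Variable r : vertex l -> 'M[K]_d.
Hypothesis rcybe : forall n, CYBE G e (r n).
Hypothesis rsym : forall n, symmetric_part_is_casimir e (r n).
Local Notation opp := (@Defs.opp l).
Local Notation AA := (@assignments_atlas K d G l).
Local Notation GA := (@gauge_atlas K d G l).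
Local Notation AG := (lie_atlas : set (chart G _)).
Local Notation source := (assignments G l * gauge_group G l)%type.
Local Notation rho := (antisym_part r).

(* The flow of index [inr (inr n)] moves the component at n by
   left multiplication with h^-1, so that it is a right action generating
   minus the right-invariant fields. *)
Definition source_index : finType := (ends l + (vertex l + vertex l))%type.

Definition source_flow (k : source_index) (h : G) (z : source) : source :=
  match k with
  | inl a => (end_flow a h z.1, z.2)
  | inr (inl n) => (z.1, fun m => if m == n then (z.2 m * h)%g else z.2 m)
  | inr (inr n) => (z.1, fun m => if m == n then (h^-1 * z.2 m)%g else z.2 m)
  end.

Definition source_vertices : finType := (vertex l + (vertex l + vertex l))%type.

Definition source_vertex (k : source_index) : source_vertices :=
  match k with inl a => inl (vertex_of a) | inr k => inr k end.

(** The gauge bivector contains R wedge R with a minus sign, and R wedge R = (-R) wedge (-R); hence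
    the coefficient - rho at the vertex of -R_n. *)
Definition source_rho (n : source_vertices) : 'M[K]_d :=
  match n with
  | inl n => rho n
  | inr (inl n) => rho n
  | inr (inr n) => - rho n
  end.

Definition source_sign (a b : source_index) : K :=
  match a, b with inl a, inl b => cilia_sign a b | _, _ => 0 end.

Definition source_opp (k : source_index) : source_index :=
  match k with
  | inl a => inl (opp a)
  | inr (inl n) => inr (inr n)
  | inr (inr n) => inr (inl n)
  end.

(** For g in the gauge copy at n, h^-1 g = g (g^-1 h^-1 g), so left multiplication is conjugate by
    g^-1 to the inverse of right multiplication; in the other direction the element is g. *)
Definition source_conj (z : source) (k : source_index) : G :=
  match k with
  | inl a => (z.1 a)^-1%g
  | inr (inl n) => (z.2 n)^-1%g
  | inr (inr n) => z.2 n
  end.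

Lemma manifold_source : manifold (prod_atlas AA GA).
Proof.
apply: manifold_prod; first exact: manifold_assignments.
exact: (manifold_pow _ (manifold_lie G)).
Qed.

Lemma source_flow_right k : right_flow (prod_atlas AA GA) (source_flow k).
Proof.
have mG := manifold_lie G.
have mA := manifold_assignments G l.
have mGA : manifold GA := manifold_pow _ mG.
have mS := manifold_source.
have mT := manifold_prod mS mG.
have m11 : morph (prod_atlas (prod_atlas AA GA) AG) AA (fun p => p.1.1).
  exact: (morph_comp (morph_fst (prod_atlas AA GA) AG) (morph_fst AA GA)).
have m12 : morph (prod_atlas (prod_atlas AA GA) AG) GA (fun p => p.1.2).
  exact: (morph_comp (morph_fst (prod_atlas AA GA) AG) (morph_snd AA GA)).
have m2 : morph (prod_atlas (prod_atlas AA GA) AG) AG (fun p => p.2).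
  exact: morph_snd.
have mc n : morph (prod_atlas (prod_atlas AA GA) AG) AG (fun p => p.1.2 n).
  exact: (morph_comp m12 (morph_eval AG n)).
split.
- case: k => [a|[n|n]] /=; apply: (morph_pair mT mA mGA) => //.
  + have mp := morph_pair mT mA mG m11 m2.
    exact: (morph_comp mp (flow_morph (end_flow_right G a))).
  + apply: (morph_ptws mG mT) => m; case: (m == n) => //.
    exact: (morphM mT (mc m) m2).
  + apply: (morph_ptws mG mT) => m; case: (m == n) => //.
    exact: (morphM mT (morphV m2) (mc m)).
- move=> [x g]; case: k => [a|[n|n]] /=; congr pair.
  + exact: (flow1 (end_flow_right G a)).
  + by apply/funext => m; case: (m == n); rewrite ?mulg1.
  + by apply/funext => m; case: (m == n); rewrite ?invg1 ?mul1g.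
- move=> h h' [x g]; case: k => [a|[n|n]] /=; congr pair.
  + exact: (flowM (end_flow_right G a)).
  + by apply/funext => m; case: (m == n); rewrite ?mulgA.
  + by apply/funext => m; case: (m == n); rewrite ?invgM ?mulgA.
Qed.

Lemma source_flow_comm j k (h h' : G) z : j != k ->
  source_flow j h (source_flow k h' z) = source_flow k h' (source_flow j h z).
Proof.
case: z => x g; case: j => [a|[n|n]]; case: k => [b|[m|m]] //= jk;
  congr pair; try (by apply: end_flow_comm);
  apply/funext => p; case: eqP => [->|_] //; case: eqP => [E|_] //;
  by [rewrite !mulgA | rewrite E eqxx in jk].
Qed.

Lemma source_flow_connections k (h : G) z :
  (connections G l `*` setT) z -> (connections G l `*` setT) (source_flow k h z).
Proof.
case: z => x g; case: k => [a|[n|n]] [/= cx _]; split => //=.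
exact: end_flow_connections.
Qed.

Lemma source_oppK : involutive source_opp.
Proof. by case=> [a|[n|n]] //=; rewrite oppK. Qed.

Lemma source_flow_opp k (h : G) z : (connections G l `*` setT) z ->
  source_flow (source_opp k) h z =
  source_flow k (source_conj z k * h^-1 * (source_conj z k)^-1)%g z.
Proof.
case: z => x g [/= cx _]; case: k => [a|[n|n]] /=; congr pair.
- exact: end_flow_opp.
- apply/funext => m; case: eqP => [->|//].
  by rewrite invgK !mulgA mulgV mul1g.
- apply/funext => m; case: eqP => [->|//].
  by rewrite !invgM !invgK -!mulgA mulVg mulg1.
Qed.

(** At the added vertices, which have one end each, the quadratic identity reads 0 = 1 - 1. *)
Lemma source_signs : vertex_signs source_vertex source_sign.
Proof.
have [anti trip] := @cilia_signs K l; split.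
- case=> [a|k] [b|k'] //=; rewrite ?oppr0 // => -[ab].
  by apply: anti; exact/val_inj.
- case=> [a|k] [b|k'] [c|k''] //=.
    move=> [ab] [bc]; apply: trip; exact/val_inj.
  by move=> [->] [->]; rewrite !mul0r !addr0 !eqxx subrr.
Qed.

Lemma source_rho_anti n i j : source_rho n i j = - source_rho n j i.
Proof.
have anti := antisym_part_anti onb rsym.
case: n => [n|[n|n]] /=; try exact: anti.
by rewrite mxE [RHS]/= [in RHS]mxE; congr (- _); exact: anti.
Qed.

(** The left side of the modified equation is quadratic in rho and the right side is free of it, so
    - rho is a solution along with rho. *)
Lemma source_CYBE n : modified_CYBE G Q e (source_rho n).
Proof.
have cybe := antisym_part_CYBE comm invQ onb rcybe rsym.
case: n => [n|[n|n]]; [exact: cybe|exact: cybe|] => u v w /=.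
rewrite [hat Q e (- _) u](hatN Q e (rho n)) [hat Q e (- _) v](hatN Q e (rho n)).
rewrite [hat Q e (- _) w](hatN Q e (rho n)).
apply: etrans _ (cybe n u v w).
move: (hat Q e (rho n) u) (hat Q e (rho n) v) (hat Q e (rho n) w) => u' v' w'.
have NN1 : tri G Q u (- v') (- w') = tri G Q u v' w'.
  apply: etrans (triN2 comm invQ u v' (- w')) _.
  exact: etrans (congr1 -%R (triN3 comm invQ u v' w')) (opprK _).
have NN2 : tri G Q (- u') v (- w') = tri G Q u' v w'.
  apply: etrans (triN1 G comm Q u' v (- w')) _.
  exact: etrans (congr1 -%R (triN3 comm invQ u' v w')) (opprK _).
have NN3 : tri G Q (- u') (- v') w = tri G Q u' v' w.
  apply: etrans (triN1 G comm Q u' (- v') w) _.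
  exact: etrans (congr1 -%R (triN2 comm invQ u' v' w)) (opprK _).
exact: (congr2 (fun p q => p + q) (congr2 (fun p q => p + q) NN1 NN2) NN3).
Qed.

End SourcePoisson.

Section SourceBivector.
Context {K : numFieldType} {d : nat} (G : lieGroupType K d).
Hypothesis comm : mixed_derivatives_commute K.
Variable Q : 'M[K]_d.
Hypothesis invQ : nondegenerate_invariant G Q.
Variable e : 'I_d -> 'rV[K]_d.
Hypothesis onb : orthonormal_basis Q e.
Variable l : ciliated_fat_graph.
Variable r : vertex l -> 'M[K]_d.
Hypothesis rcybe : forall n, CYBE G e (r n).
Hypothesis rsym : forall n, symmetric_part_is_casimir e (r n).
Local Notation AA := (@assignments_atlas K d G l).
Local Notation GA := (@gauge_atlas K d G l).
Local Notation source := (assignments G l * gauge_group G l)%type.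
Local Notation rho := (antisym_part r).
Local Notation SFB := (flow_bivector e (@source_flow K d G l) (@source_vertex l)
  (source_rho r) (@source_sign K l)).

Lemma source_sum (fa ga : source_index l -> 'I_d -> K) :
  \sum_a \sum_b \sum_i \sum_j
    flow_coef (@source_vertex l) (source_rho r) (@source_sign K l) (a, i) (b, j) *
      fa a i * ga b j =
  \sum_a \sum_b \sum_i \sum_j
    flow_coef (@vertex_of l) rho (@cilia_sign K l) (a, i) (b, j) *
      fa (inl a) i * ga (inl b) j +
  \sum_n (\sum_i \sum_j rho n i j * fa (inr (inl n)) i * ga (inr (inl n)) j -
          \sum_i \sum_j rho n i j * fa (inr (inr n)) i * ga (inr (inr n)) j).
Proof.
pose W a b := \sum_i \sum_j
  flow_coef (@source_vertex l) (source_rho r) (@source_sign K l) (a, i) (b, j) *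
    fa a i * ga b j.
have W0 a b : source_vertex a != source_vertex b -> W a b = 0.
  move=> ab; rewrite /W big1 // => i _; rewrite big1 // => j _.
  by rewrite /flow_coef (negbTE ab) !mul0r.
have Wk k : W (inr k) (inr k) =
    \sum_i \sum_j source_rho r (inr k) i j * fa (inr k) i * ga (inr k) j.
  apply: eq_bigr => i _; apply: eq_bigr => j _.
  by rewrite /flow_coef /= eqxx mul0r addr0.
have left : \sum_(a : ends l) \sum_b W (inl a) b = \sum_a \sum_b \sum_i \sum_j
    flow_coef (@vertex_of l) rho (@cilia_sign K l) (a, i) (b, j) *
      fa (inl a) i * ga (inl b) j.
  apply: eq_bigr => a _; rewrite big_sumType /= [X in _ + X]big1 ?addr0; last first.
    by move=> k _; rewrite W0.
  by [].
have right : \sum_k \sum_b W (inr k) b = \sum_k W (inr k) (inr k).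
  apply: eq_bigr => k _; rewrite big_sumType /= big1 ?add0r; last first.
    by move=> a _; rewrite W0.
  by rewrite (bigD1 k) //= big1 ?addr0 // => k' k'k; rewrite W0 // eq_sym.
rewrite -/(\sum_a \sum_b W a b) big_sumType /= left right; congr (_ + _).
rewrite big_sumType /= -big_split; apply: eq_bigr => n _ /=.
rewrite !Wk; congr (_ + _); rewrite -sumrN; apply: eq_bigr => i _.
rewrite -sumrN; apply: eq_bigr => j _.
have -> : source_rho r (inr (inr n)) i j = - rho n i j by rewrite /source_rho mxE.
by rewrite !mulNr.
Qed.

(** Antisymmetrization replaces r_ij by r_ij - r_ji = 2 rho_ij, and the factor one half absorbs the
    2. *)
Lemma gauge_vertex (n : vertex l) (fl gl fr gr : 'I_d -> K) :
  2^-1 * \sum_i \sum_j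
    r n i j * ((fl i * gl j - fl j * gl i) - (fr i * gr j - fr j * gr i)) =
  \sum_i \sum_j rho n i j * fl i * gl j - \sum_i \sum_j rho n i j * fr i * gr j.
Proof.
have anti := antisym_part_anti onb rsym n.
have rE i j : r n i j = rho n i j + (i == j)%:R.
  by rewrite !mxE addrNK.
pose w i j := fl i * gl j - fr i * gr j.
have E : \sum_i \sum_j
    r n i j * ((fl i * gl j - fl j * gl i) - (fr i * gr j - fr j * gr i)) =
    \sum_i \sum_j (r n i j - r n j i) * w i j.
  transitivity (\sum_i \sum_j r n i j * w i j - \sum_i \sum_j r n i j * w j i).
    rewrite -sumrB; apply: eq_bigr => i _; rewrite -sumrB; apply: eq_bigr => j _.
    by rewrite /w; ring.
  rewrite [X in _ - X]exchange_big -sumrB; apply: eq_bigr => i _.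
  by rewrite -sumrB; apply: eq_bigr => j _; rewrite mulrBl.
rewrite E -sumrB mulr_sumr; apply: eq_bigr => i _.
rewrite -sumrB mulr_sumr; apply: eq_bigr => j _.
rewrite !rE (anti j i) [j == i]eq_sym /w.
by move: (rho n i j) (i == j)%:R => p q; field.
Qed.

Lemma source_bivector_flow (z : source) f g F H :
  (connections G l `*` setT) z ->
  represents (prod_atlas AA GA) (connections G l `*` setT) z f F ->
  represents (prod_atlas AA GA) (connections G l `*` setT) z g H ->
  prod_bivector (fock_rosly G e r) (gauge_bivector G e r) f g z = SFB F H z.
Proof.
move=> Sz rf rg; have mS := manifold_source G l.
rewrite flow_bivector_pairs.
pose SP k h (y : source) := @source_flow_connections K d G l k h y.
have fS := @source_flow_right K d G l.
pose D (k : source -> K) a i := flow_field (source_flow a) (e i) k z.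
have fields a i : D f a i = D F a i /\ D g a i = D H a i.
  by split; apply: (flow_field_agree mS (fS a) (e i) (SP a) Sz);
    [exact: rf.2|exact: rg.2].
(* [Rfield] multiplies by h and the flow by h^-1, hence the sign; it occurs in both arguments of the
   bracket and cancels there. *)
have Rf n i (k k' : source -> K) :
    represents (prod_atlas AA GA) (connections G l `*` setT) z k k' ->
    Rfield n (e i) (fun y => k (z.1, y)) z.2 = - D k' (inr (inr n)) i.
  move=> rk; apply: etrans _ (inverse_flow_field mS (e i) (fS (inr (inr n)))
    (SP (inr (inr n))) Sz rk).
  apply: (congr1 (tderive (e i))); apply/funext => h /=; rewrite invgK.
  by [].
rewrite (source_sum (D F) (D H)) /prod_bivector; apply: congr2.
  apply: etrans (fock_rosly_flow onb rsym _ _ _) _.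
  rewrite flow_bivector_pairs; apply: eq_bigr => a _; apply: eq_bigr => b _.
  apply: eq_bigr => i _; apply: eq_bigr => j _.
  exact: (congr2 (fun p q => _ * p * q) (fields (inl a) i).1 (fields (inl b) j).2).
apply: eq_bigr => n _.
pose fl i := Lfield n (e i) (fun y => f (z.1, y)) z.2.
pose gl i := Lfield n (e i) (fun y => g (z.1, y)) z.2.
pose fr i := Rfield n (e i) (fun y => f (z.1, y)) z.2.
pose gr i := Rfield n (e i) (fun y => g (z.1, y)) z.2.
apply: etrans (gauge_vertex n fl gl fr gr) _; apply: congr2.
  apply: eq_bigr => i _; apply: eq_bigr => j _.
  exact: (congr2 (fun p q => _ * p * q) (fields (inr (inl n)) i).1
    (fields (inr (inl n)) j).2).
apply: congr1; apply: eq_bigr => i _; apply: eq_bigr => j _.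
apply: etrans (congr2 (fun p q => rho n i j * p * q) (Rf n i _ _ rf) (Rf n j _ _ rg)) _.
by rewrite !mulrN mulNr opprK.

Qed.

Lemma source_poisson :
  is_poisson (connections G l `*` setT) (source_sheaf G l)
    (prod_bivector (fock_rosly G e r) (gauge_bivector G e r)).
Proof.
have mS := manifold_source G l.
apply: (local_poisson comm invQ onb mS (@source_flow_right K d G l)
  (@source_flow_comm K d G l) (source_rho_anti onb rsym)
  (source_CYBE comm invQ onb rcybe rsym) (@source_signs K l)).
  exact: source_bivector_flow.
move=> z f g h Sz sf sg sh.
apply: (gradient_involution_tri comm invQ onb mS (@source_flow_right K d G l)
  (sigma := @source_opp l) (m := source_conj z)) => //.
  exact: source_oppK.
by move=> a k; exact: source_flow_opp.
Qed.

End SourceBivector.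

(** * Pullback of gradients along the gauge action *)

Section GaugeAction.
Context {K : numFieldType} {d : nat} (G : lieGroupType K d).
Hypothesis comm : mixed_derivatives_commute K.
Variable Q : 'M[K]_d.
Hypothesis invQ : nondegenerate_invariant G Q.
Variable e : 'I_d -> 'rV[K]_d.
Hypothesis onb : orthonormal_basis Q e.
Variable l : ciliated_fat_graph.
Variable r : vertex l -> 'M[K]_d.
Hypothesis rcybe : forall n, CYBE G e (r n).
Hypothesis rsym : forall n, symmetric_part_is_casimir e (r n).
Local Notation opp := (@Defs.opp l).
Local Notation AG := (lie_atlas : set (chart G _)).
Local Notation AA := (@assignments_atlas K d G l).
Local Notation GA := (@gauge_atlas K d G l).
Local Notation SA := (prod_atlas AA GA).
Local Notation source := (assignments G l * gauge_group G l)%type.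
Local Notation rho := (antisym_part r).
Local Notation phi := (gauge_action G l).
Local Notation B := (bform Q).
Local Notation EF := (@end_flows K d G l).
Local Notation SF := (@source_flow K d G l).

Lemma gauge_action_morph : morph SA AA phi.
Proof.
have mG := manifold_lie G; have mS := manifold_source G l.
have mx a : morph SA AG (fun p => p.1 a).
  exact: (morph_comp (morph_fst AA GA) (morph_eval AG a)).
have mg n : morph SA AG (fun p => p.2 n).
  exact: (morph_comp (morph_snd AA GA) (morph_eval AG n)).
apply: (morph_ptws mG mS) => a; apply: (morphM mS) => //.
by apply: (morphM mS) => //; exact: morphV.
Qed.

Lemma gauge_action_connections z :
  (connections G l `*` setT) z -> connections G l (phi z).
Proof.
by move=> [cz _] a; rewrite /gauge_action oppK cz !invgM invgK mulgA.
Qed.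

Lemma gauge_action_represents z f F :
  represents AA (connections G l) (phi z) f F ->
  represents SA (connections G l `*` setT) z (f \o phi) (F \o phi).
Proof.
have [cphi sphi] := gauge_action_morph.
move=> [sF fF]; split; first exact: sphi.
have N : \forall y \near z, connections G l (phi y) -> f (phi y) = F (phi y).
  exact: (cphi z _ fF).
by apply: filterS N => y fy Sy; exact: fy (gauge_action_connections Sy).
Qed.

(** With g the gauge element at [a], moving h past it gives h g = g (g^-1 h g), so the flow
    downstairs runs with a conjugated group element. *)
Lemma gauge_action_end (a : ends l) (h : G) z :
  phi (SF (inl a) h z) =
  EF a ((z.2 (vertex_of a))^-1 * h * (z.2 (vertex_of a))^-1^-1)%g (phi z).
Proof.
case: z => x g; apply/funext => b; rewrite /gauge_action /end_flows /= /end_flow.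
have [->|ba] := eqVneq b a; first by rewrite invgK !mulgA mulgK.
have [->|//] := eqVneq b (opp a).
by rewrite oppK !invgM !invgK !mulgA mulgK.
Qed.

(** The two factors are independent, which covers loops, where an end and its opposite both lie in
    s; [uniq s] ensures that each end is moved once. *)
Lemma flow_seq_ends (s : seq (ends l)) (h : G) x b : uniq s ->
  flow_seq EF s h x b =
  ((if opp b \in s then h^-1 else 1) * x b * (if b \in s then h else 1))%g.
Proof.
elim: s => [|a s IH] /=; first by rewrite mul1g mulg1.
move=> /andP[as_ us]; rewrite {1}/end_flows /end_flow !in_cons IH //.
have [->|ba] := eqVneq b a.
  by rewrite (negbTE as_) (negbTE (opp_neq a)) /= mulg1.
have [->|bo] := eqVneq b (opp a).
  by rewrite oppK eqxx (negbTE as_) /= mul1g !mulgA.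
by rewrite [opp b == a]eq_sym opp_eq_sym (negbTE bo).
Qed.

(** Replacing g_n by g_n h inserts h on the right of each end at n and h^-1 on the left of each
    opposite end, which is the joint flow of the ends at n. *)
Lemma gauge_action_vertex (n : vertex l) (h : G) z :
  phi (SF (inr (inl n)) h z) =
  flow_seq EF (enum [pred a | vertex_of a == n]) h (phi z).
Proof.
case: z => x g; apply/funext => b; rewrite flow_seq_ends ?enum_uniq //.
rewrite !mem_enum !inE /gauge_action /=.
case: eqP => [->|_]; case: eqP => [->|_];
  by rewrite ?mulg1 ?mul1g ?invgM ?mulgA.
Qed.

Lemma flow_field_pull (Psi : G -> source -> source) (Psi' : G -> assignments G l -> assignments G l)
    (m : G) v z F : right_flow AA Psi' ->
  (forall h, phi (Psi h z) = Psi' (m * h * m^-1)%g (phi z)) ->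
  smooth_at AA (phi z) F ->
  flow_field Psi v (F \o phi) z = flow_field Psi' (Ad m v) F (phi z).
Proof.
move=> fP PP sF; have mA := manifold_assignments G l.
apply: etrans _ (tderive_conj m v (flow_smooth mA fP sF)).
by apply: (congr1 (tderive v)); apply/funext => h /=; rewrite PP.
Qed.

Lemma gradient_end a z F : smooth_at AA (phi z) F ->
  gradient e SF (F \o phi) z (inl a) =
  Ad (z.2 (vertex_of a)) (gradient e EF F (phi z) a).
Proof.
move=> sF; have mA := manifold_assignments G l.
rewrite -[z.2 _]invgK -(frame_sum_Ad invQ onb); apply: eq_bigr => i _.
apply: (congr1 (fun c => c *: e i)).
have FP := flow_field_pull (e i) (end_flows_right G a)
  (fun h => gauge_action_end a h z) sF.
apply: etrans FP _.
exact: (flow_field_gradient invQ onb mA (@end_flows_right K d G l) a _ sF).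
Qed.

Lemma gradient_vertex n z F : smooth_at AA (phi z) F ->
  gradient e SF (F \o phi) z (inr (inl n)) =
  \sum_(a | vertex_of a == n) gradient e EF F (phi z) a.
Proof.
move=> sF; have mA := manifold_assignments G l.
rewrite /gradient exchange_big; apply: eq_bigr => i _ /=.
rewrite -scaler_suml; apply: (congr1 (fun c => c *: e i)).
apply: (@etrans _ _
  (flow_field (flow_seq EF (enum [pred a | vertex_of a == n])) (e i) F (phi z))).
  apply: (congr1 (tderive (e i))); apply/funext => h.
  exact: (congr1 F (gauge_action_vertex n h z)).
apply: etrans (flow_seq_field mA (@end_flows_right K d G l) _ _ sF) _.
by rewrite big_enum.
Qed.

(** Deduced from the gradient along L_n, since -R_n is its inverse action conjugated by the gauge
    element. *)
Lemma gradient_vertex_opp n z F : (connections G l `*` setT) z ->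
  smooth_at AA (phi z) F ->
  gradient e SF (F \o phi) z (inr (inr n)) =
  - Ad (z.2 n) (\sum_(a | vertex_of a == n) gradient e EF F (phi z) a).
Proof.
move=> Sz sF; have [_ sphi] := gauge_action_morph.
rewrite -gradient_vertex // -{1}[z.2 n]invgK.
apply: (gradient_conj_inverse invQ onb (manifold_source G l)
  (@source_flow_right K d G l)) (sphi z F sF) => h.
exact: (source_flow_opp (inr (inl n)) h Sz).
Qed.

End GaugeAction.

Section GaugeActionPoisson.
Context {K : numFieldType} {d : nat} (G : lieGroupType K d).
Hypothesis comm : mixed_derivatives_commute K.
Variable Q : 'M[K]_d.
Hypothesis invQ : nondegenerate_invariant G Q.
Variable e : 'I_d -> 'rV[K]_d.
Hypothesis onb : orthonormal_basis Q e.
Variable l : ciliated_fat_graph.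
Variable r : vertex l -> 'M[K]_d.
Hypothesis rcybe : forall n, CYBE G e (r n).
Hypothesis rsym : forall n, symmetric_part_is_casimir e (r n).
Local Notation AA := (@assignments_atlas K d G l).
Local Notation GA := (@gauge_atlas K d G l).
Local Notation SA := (prod_atlas AA GA).
Local Notation rho := (antisym_part r).
Local Notation phi := (gauge_action G l).
Local Notation B := (bform Q).
Local Notation EF := (@end_flows K d G l).
Local Notation SF := (@source_flow K d G l).
Local Notation VP := (vertex_pairing Q e).

(** Invariance of the form removes [Ad m] from the sign terms. It stays in the [rho] term, as [hat]
    of rho is not assumed to commute with [Ad m]; the vertex of -R_n supplies the matching term. *)
Lemma vertex_pairing_end (n : vertex l) (m : G) (F H : source_index l -> 'rV[K]_d)
    (F' H' : ends l -> 'rV[K]_d) :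
  (forall a, vertex_of a = n -> F (inl a) = Ad m (F' a)) ->
  (forall a, vertex_of a = n -> H (inl a) = Ad m (H' a)) ->
  VP (@source_vertex l) (source_rho r) (@source_sign K l) (inl n) F H =
  B (hat Q e (rho n) (Ad m (\sum_(a | vertex_of a == n) F' a)))
    (Ad m (\sum_(a | vertex_of a == n) H' a)) +
  \sum_(a | vertex_of a == n) \sum_(b | vertex_of b == n)
    cilia_sign a b * B (F' a) (H' b).
Proof.
move=> FF HH.
have S (W : nmodType) (X : source_index l -> W) :
    \sum_(a | source_vertex a == inl n) X a =
    \sum_(a | vertex_of a == n) X (inl a).
  by rewrite big_mkcond big_sumType /= [X in _ + X]big1 // addr0 -big_mkcond.
have Ad0 : Ad m 0 = 0 :> 'rV[K]_d.
  have := Ad_linear m 1 0 0; rewrite !scale1r addr0 => E.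
  by apply: (addrI (Ad m 0)); rewrite addr0 -E.
have AdD : {morph @Ad K d G m : u v / u + v}.
  by move=> u v; have := Ad_linear m 1 u v; rewrite !scale1r.
rewrite /vertex_pairing !S !(big_morph _ AdD Ad0) /=; congr (_ + _).
  by congr (B (hat _ _ _ _) _); apply: eq_bigr => a /eqP an; [exact: FF|exact: HH].
apply: eq_bigr => a /eqP an; rewrite S; apply: eq_bigr => b /eqP bn /=.
by rewrite FF // HH // (bform_Ad invQ).
Qed.

Lemma vertex_pairing_vertex (k : vertex l + vertex l)
    (F H : source_index l -> 'rV[K]_d) :
  VP (@source_vertex l) (source_rho r) (@source_sign K l) (inr k) F H =
  B (hat Q e (source_rho r (inr k)) (F (inr k))) (H (inr k)).
Proof.
have S (W : nmodType) (X : source_index l -> W) :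
    \sum_(a | source_vertex a == inr k) X a = X (inr k).
  rewrite (bigD1 (inr k)) //= big1 ?addr0 // => -[a|k'] //= /andP[/eqP[->]].
  by rewrite eqxx.
by rewrite /vertex_pairing !S /= mul0r addr0.
Qed.

Lemma gauge_action_bivector z F H : (connections G l `*` setT) z ->
  smooth_at AA (phi z) F -> smooth_at AA (phi z) H ->
  flow_bivector e SF (@source_vertex l) (source_rho r) (@source_sign K l)
    (F \o phi) (H \o phi) z =
  flow_bivector e EF (@vertex_of l) rho (@cilia_sign K l) F H (phi z).
Proof.
move=> Sz sF sH.
rewrite !(flow_bivector_gradient invQ onb) big_sumType /= big_sumType /=.
rewrite -!big_split; apply: eq_bigr => n _ /=.
set F' := gradient e EF F (phi z); set H' := gradient e EF H (phi z).
have gE a k : smooth_at AA (phi z) k -> vertex_of a = n ->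
    gradient e SF (k \o phi) z (inl a) = Ad (z.2 n) (gradient e EF k (phi z) a).
  by move=> sk <-; exact: (gradient_end invQ onb).
rewrite (@vertex_pairing_end n (z.2 n) _ _ F' H'); first last.
- by move=> a; exact: gE.
- by move=> a; exact: gE.
rewrite !vertex_pairing_vertex.
rewrite (gradient_vertex e n sF) (gradient_vertex e n sH).
rewrite (gradient_vertex_opp invQ onb n Sz sF) (gradient_vertex_opp invQ onb n Sz sH).
rewrite -/F' -/H' /vertex_pairing.
set SF_ := \sum_(a | _) F' a; set SH_ := \sum_(a | _) H' a.
set C := \sum_(a | _) \sum_(b | _) _.
have BN u v : B (hat Q e (- rho n) (- u)) (- v) = - B (hat Q e (rho n) u) v.
  have hN w : hat Q e (rho n) (- w) = - hat Q e (rho n) w.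
    rewrite /hat -sumrN; apply: eq_bigr => i _; rewrite -sumrN.
    apply: eq_bigr => j _.
    by rewrite -scaleN1r bformZ1 mulN1r mulrN scaleNr.
  rewrite hatN hN opprK (bformC invQ) -scaleN1r bformZ1 mulN1r.
  by rewrite (bformC invQ).
(* Here p is the rho-term twisted by [Ad], coming from the ends and with the opposite sign from
   -R_n; q is the untwisted rho-term from L_n; c is the sign term. *)
have arith (p q c : K) : p + c + (q + - p) = q + c by ring.
apply: etrans _ (arith (B (hat Q e (rho n) (Ad (z.2 n) SF_)) (Ad (z.2 n) SH_)) _ C).
by apply: congr1; apply: congr1; exact: BN.
Qed.

Lemma gauge_action_poisson :
  is_poisson_map
    (connections G l `*` setT) (source_sheaf G l)
    (prod_bivector (fock_rosly G e r) (gauge_bivector G e r))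
    (connections G l) (connections_sheaf G l) (fock_rosly G e r)
    (gauge_action G l).
Proof.
have mA := manifold_assignments G l; have mS := manifold_source G l.
have [cphi sphi] := @gauge_action_morph K d G l.
split.
- exact: (source_poisson comm invQ onb rcybe rsym).
- exact: (connections_poisson comm invQ onb rcybe rsym).
- exact: gauge_action_connections.
- move=> U f Of; apply: (represents_sub_sheaf mS) => z Sz Uz.
  have Cz := gauge_action_connections Sz.
  have [F rF SU] := sub_sheaf_represents Of Cz Uz.
  exists (F \o phi); first exact: gauge_action_represents.
  have N : \forall y \near z, connections G l (phi y) -> U (phi y).
    exact: (cphi z _ SU).
  by apply: filterS N => y Uy Sy; exact: Uy (gauge_action_connections Sy).
- move=> U f g Of Og z Sz Uz.
  have Cz := gauge_action_connections Sz.
  have [F rF _] := sub_sheaf_represents Of Cz Uz.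
  have [H rH _] := sub_sheaf_represents Og Cz Uz.
  rewrite (source_bivector_flow onb rsym Sz (gauge_action_represents rF)
    (gauge_action_represents rH)).
  rewrite (gauge_action_bivector Sz rF.1 rH.1) (fock_rosly_flow onb rsym).
  apply/esym; apply: (flow_bivector_agree e mA (@vertex_of l) rho
    (@cilia_sign K l) (@end_flows_right K d G l) (S := connections G l)) rF rH => //.
  by move=> a h y; exact: end_flow_connections.
Qed.

End GaugeActionPoisson.

Theorem proposition3 (R : realType) (d : nat) (G : complexLieGroup R d)
  (HG : reductive G)
  (Q : 'M[R[i]]_d) (HQ : nondegenerate_invariant G Q)
  (e : 'I_d -> 'rV[R[i]]_d) (He : orthonormal_basis Q e)
  (l : ciliated_fat_graph) (r : vertex l -> 'M[R[i]]_d)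
  (Hcybe : forall n, CYBE G e (r n))
  (Hsym : forall n, symmetric_part_is_casimir e (r n)) :
  is_poisson (connections G l) (connections_sheaf G l) (fock_rosly G e r)
  /\
  is_poisson_map
    (connections G l `*` setT) (source_sheaf G l)
    (prod_bivector (fock_rosly G e r) (gauge_bivector G e r))
    (connections G l) (connections_sheaf G l) (fock_rosly G e r)
    (gauge_action G l).
Proof.
have comm := @complex_mixed_derivatives R.
split; first exact: (connections_poisson comm HQ He Hcybe Hsym).
exact: (gauge_action_poisson comm HQ He Hcybe Hsym).
Qed.
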